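(* Let $V$ be a $7$-dimensional real Hilbert space equipped with a cross product, with associative calibration $\phi\in\Lambda^3V^*$, the induced orientation, Hodge operator $*$, and coassociative calibration $\psi:=*\phi\in\Lambda^4V^*$. There are orthogonal splittings $$\Lambda^2V^*=\Lambda^2_7\oplus\Lambda^2_{14},\qquad \Lambda^3V^*=\Lambda^3_1\oplus\Lambda^3_7\oplus\Lambda^3_{27},$$ where $\dim\Lambda^k_d=d$ and \begin{align*} \Lambda^2_7&:=\{\iota(u)\phi: u\in V\}=\{\omega\in\Lambda^2V^*: *(\phi\wedge\omega)=2\omega\},\\ \Lambda^2_{14}&:=\{\omega\in\Lambda^2V^*:\psi\wedge\omega=0\}=\{\omega\in\Lambda^2V^*: *(\phi\wedge\omega)=-\omega\},\\ \Lambda^3_1&:=\langle\phi\rangle,\\ \Lambda^3_7&:=\{\iota(u)\psi: u\in V\},\\ \Lambda^3_{27}&:=\{\omega\in\Lambda^3V^*:\phi\wedge\omega=0,\ \psi\wedge\omega=0\}. \end{align*} Each of the spaces $\Lambda^k_d$ is an irreducible representation of $\mathrm{G}(V,\phi)$, and the representations $\Lambda^2_7$ and $\Lambda^3_7$ are both isomorphic to $V$, $\Lambda^2_{14}$ is isomorphic to the Lie algebra $\mathfrak{g}(V,\phi):=\mathrm{Lie}(\mathrm{G}(V,\phi))\cong\mathfrak{g}_2$, and $\Lambda^3_{27}$ is isomorphic to the space of traceless symmetric endomorphisms of $V$. The orthogonal projections $\pi_7:\Lambda^2V^*\to\Lambda^2_7$ and $\pi_{14}:\Lambda^2V^*\to\Lambda^2_{14}$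 are given by \begin{align*} \pi_7(\omega)&=\tfrac13\omega+\tfrac13*(\phi\wedge\omega)=\tfrac13*\bigl(\psi\wedge*(\psi\wedge\omega)\bigr),\\ \pi_{14}(\omega)&=\tfrac23\omega-\tfrac13*(\phi\wedge\omega)=\omega-\tfrac13*\bigl(\psi\wedge*(\psi\wedge\omega)\bigr). \end{align*}
   Context: A cross product on a real Hilbert space $V$ is a skew-symmetric bilinear map $(u,v)\mapsto u\times v$ with $\langle u\times v,u\rangle=\langle u\times v,v\rangle=0$ and $|u\times v|^2=|u|^2|v|^2-\langle u,v\rangle^2$ for all $u,v$. Its associative calibration is the alternating $3$-form $\phi(u,v,w):=\langle u\times v,w\rangle$. When $\dim V=7$, $V$ is oriented by the unique orientation whose associated volume form $\mathrm{vol}$ satisfies $\iota(u)\phi\wedge\iota(v)\phi\wedge\phi=6\langle u,v\rangle\,\mathrm{vol}$ for all $u,v\in V$; $*:\Lambda^kV^*\to\Lambda^{7-k}V^*$ is the Hodge operator of the inner product and this orientation. $\iota(u)$ denotes interior product. The group $\mathrm{G}(V,\phi):=\{g\in\mathrm{GL}(V): g^*\phi=\phi\}$ is contained in $\mathrm{SO}(V)$; it acts naturally on forms, on its Lie algebra by the adjoint action, and on endomorphisms of $V$ by conjugation. $\mathfrak{g}_2$ is the Lie algebra of $\mathrm{G}_2:=\mathrm{G}(\mathbb{R}^7,\phi_0)$, where, with $e^{ijk}:=dx_i\wedge dx_j\wedge dx_k$, $\phi_0=e^{123}-e^{145}-e^{167}-e^{246}+e^{257}-e^{347}-e^{356}$.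 *)

(* Defs.v *)
From HB Require Import structures.
From mathcomp Require Import all_boot all_order all_algebra.
From mathcomp Require Import perm sesquilinear.
From mathcomp Require Import all_classical all_reals all_analysis.
Import Order.TTheory GRing.Theory Num.Theory.
Import numFieldNormedType.Exports.

Set Implicit Arguments.
Unset Strict Implicit.
Unset Printing Implicit Defensive.

Local Open Scope classical_set_scope.
Local Open Scope ring_scope.

(* A subspace of a finite-dimensional space is finite-dimensional. *)
Lemma vect_axiom_inj (K : fieldType) (L : lmodType K) (W : vectType K)
    (f : {linear L -> W}) : injective f -> {n & Vector.axiom n L}.
Proof.
move=> f_inj.
pose P := [pred n | `[< exists U : {vspace W},
  \dim U = n /\ forall w, w \in U -> exists x, f x = w >] ].
have P0 : exists n, P n.
  exists 0%N; apply/asboolP; exists 0%VS; split; first exact: dimv0.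
  by move=> w; rewrite memv0 => /eqP ->; exists 0; rewrite linear0.
have Pub n : P n -> (n <= \dim {:W})%N.
  by move=> /asboolP[U [<- _]]; exact/dimvS/subvf.
case: (ex_maxnP P0 Pub) => n /asboolP PU Pmax.
have /cid[U [dimU Uf]] := PU.
have fU x : f x \in U.
  apply: contrapT => /negP fxNU.
  have : P (\dim (U + <[f x]>)).
    apply/asboolP; exists (U + <[f x]>)%VS; split=> // w.
    case/memv_addP => u /Uf[y <-] [v /vlineP[c ->] ->].
    by exists (y + c *: x); rewrite linearD linearZ.
  move/Pmax; apply/negP; rewrite -ltnNge -dimU.
  rewrite (ltn_leqif (dimv_leqif_sup (addvSl _ _))).
  by apply: contra fxNU => /(subv_trans (addvSr _ _)); rewrite -memvE.
exists n; rewrite -dimU.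
exists (fun x => \row_i coord (vbasis U) i (f x)).
  by move=> a x y; apply/rowP => i; rewrite !mxE !linearP.
have gP (r : 'rV_(\dim U)) : exists x, f x = \sum_i r 0 i *: (vbasis U)`_i.
  apply: Uf; apply: rpred_sum => i _.
  by rewrite rpredZ// vbasis_mem// mem_nth// size_tuple.
exists (fun r => sval (cid (gP r))) => [x|r].
  apply: f_inj; case: cid => y /= ->; rewrite [RHS](coord_vbasis (fU x)).
  by apply: eq_bigr => i _; rewrite mxE.
apply/rowP => i; rewrite mxE; case: cid => y /= ->.
by rewrite coord_sum_free// (basis_free (vbasisP U)).
Qed.

Section AlternatingForms.
Variables (R : realType) (V : vectType R).

Definition alternating k (f : ('I_k -> V) -> R^o) : Prop :=
  (forall v i, scalar (fun x => f [eta v with i |-> x])) /\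
  (forall v i j, i != j -> v i = v j -> f v = 0).

Definition alternating_pred k : {pred ('I_k -> V) -> R^o} :=
  fun f => `[< alternating f >].

Lemma alternating_submod_closed k : submod_closed (@alternating_pred k).
Proof.
split=> [|a f g /asboolP[fl f0] /asboolP[gl g0]]; apply/asboolP; split.
- by move=> v i a x y; change (0 = a * 0 + 0 :> R); rewrite mulr0 addr0.
- by [].
- move=> v i b x y; pose u z := [eta v with i |-> z].
  change (a * f (u (b *: x + y)) + g (u (b *: x + y)) =
    b * (a * f (u x) + g (u x)) + (a * f (u y) + g (u y))).
  by rewrite fl gl !mulrDr !mulrA (mulrC b a) addrACA.
- move=> v i j ij vij; change (a * f v + g v = 0).
  by rewrite (f0 _ _ _ ij vij) (g0 _ _ _ ij vij) mulr0 addr0.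
Qed.
HB.instance Definition _ k := GRing.isSubmodClosed.Build R
  (('I_k -> V) -> R^o) (@alternating_pred k) (@alternating_submod_closed k).

(* Lambda^k V^* *)
Record altform k := AltForm {
  altfun :> ('I_k -> V) -> R^o;
  altfunP : altfun \in @alternating_pred k }.

HB.instance Definition _ k := [isSub for @altfun k].
HB.instance Definition _ k := [Choice of altform k by <:].
HB.instance Definition _ k :=
  [SubChoice_isSubLmodule of altform k by <:].


Lemma altform_inj k (a b : altform k) : a =1 b -> a = b.
Proof. by move=> ab; apply/val_inj/funext. Qed.

Lemma altform_linear k (a : altform k) v i :
  scalar (fun x => a [eta v with i |-> x]).
Proof. by case: a => f /= /asboolP[+ _]; apply. Qed.

Lemma altform_alt k (a : altform k) v i j :
  i != j -> v i = v j -> a v = 0.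
Proof. by case: a => f /= /asboolP[_]; apply. Qed.

Definition basis_values k (a : altform k) :
    {ffun {ffun 'I_k -> 'I_(\dim {:V})} -> R^o} :=
  [ffun I : {ffun 'I_k -> 'I_(\dim {:V})} => a (fun i => (vbasis {:V})`_(I i))].

Lemma basis_values_linear k : linear (@basis_values k).
Proof. by move=> c a b; apply/ffunP => I; rewrite !ffunE. Qed.
HB.instance Definition _ k := GRing.isLinear.Build R (altform k) _ _
  (@basis_values k) (@basis_values_linear k).

Lemma basis_values_inj k : injective (@basis_values k).
Proof.
move=> a b /ffunP ab; apply: altform_inj => v.
set e := vbasis {:V} in ab.
suff H n : forall v, (forall i : 'I_k, (n <= i)%N ->
    exists j : 'I_(\dim {:V}), v i = e`_j) -> a v = b v.
  by apply: (H k) => i; rewrite leqNgt ltn_ord.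
elim: n => {v} [|n IHn] v vP.
  pose I : {ffun 'I_k -> 'I_(\dim {:V})} := [ffun i => sval (cid (vP i isT))].
  have -> : v = fun i => e`_(I i).
    by apply/funext => i; rewrite ffunE; case: cid.
  by move: (ab I); rewrite !ffunE.
have [nk|kn] := ltnP n k; last first.
  by apply: IHn => i ni; have := ltn_ord i; rewrite ltnNge (leq_trans kn).
pose i := Ordinal nk.
have -> : v = [eta v with i |-> v i].
  by apply/funext => j /=; case: eqP => // ->.
rewrite (coord_vbasis (memvf (v i))).
have S (c : altform k) : c [eta v with i |-> \sum_j coord e j (v i) *: e`_j] =
    \sum_j coord e j (v i) * c [eta v with i |-> e`_j].
  pose g x := c [eta v with i |-> x].
  have gl : scalar g := altform_linear c v i.
  have g0 : g 0 = 0.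
    by have := gl (-1) 0 0; rewrite scaler0 addr0 mulN1r addNr.
  rewrite -[LHS]/(g _) -[RHS]/(\sum_j _ * g _).
  by elim/big_rec2: _ => // j y z _ <-; exact: gl.
rewrite !S; apply: eq_bigr => j _; congr (_ * _).
apply: IHn => m nm /=; case: eqP => [_|mi]; first by exists j.
by apply: vP; rewrite ltn_neqAle nm andbT; apply/eqP => nm'; apply/mi/val_inj.
Qed.

Lemma altform_vect_iso k : {n & Vector.axiom n (altform k)}.
Proof. exact: (@vect_axiom_inj _ _ _ (@basis_values k)) (@basis_values_inj k). Qed.
HB.instance Definition _ k := Lmodule_hasFinDim.Build R (altform k)
  (projT2 (altform_vect_iso k)).

End AlternatingForms.

Section Operations.
Variables (R : realType) (V : vectType R).

Definition catf k l (u : 'I_k -> V) (v : 'I_l -> V) (i : 'I_(k + l)) : V :=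
  match fintype.split i with inl a => u a | inr b => v b end.

Lemma catf_set k l (u : 'I_k -> V) (v : 'I_l -> V) (i : 'I_l) x :
  catf u [eta v with i |-> x] = [eta catf u v with rshift k i |-> x].
Proof.
apply/funext => j; rewrite /catf /=; case: fintype.splitP => a ja.
  case: eqP => // jE; have := ltn_ord a.
  by rewrite -ja jE /= ltnNge leq_addr.
congr (if _ then _ else _); apply/eqP/eqP => [<-|jE]; first exact/val_inj.
by apply/val_inj/(@addnI k); rewrite -ja jE.
Qed.

Fact contract_subproof k l (u : 'I_k -> V) (w : altform V (k + l)) :
  (fun v : 'I_l -> V => w (catf u v)) \in @alternating_pred R V l.
Proof.
apply/asboolP; split=> [v i a x y|v i j ij vij].
  by rewrite !catf_set altform_linear.
apply: (@altform_alt _ _ _ w _ (rshift k i) (rshift k j)).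
  by rewrite (inj_eq (@rshift_inj _ _)).
by rewrite /catf !(unsplitK (inr _ _)).
Qed.

(* w(u_1, .., u_k, _) *)
Definition contract k l (u : 'I_k -> V) (w : altform V (k + l)) : altform V l :=
  AltForm (contract_subproof u w).

Definition interior_prod k (u : V) (w : altform V k.+1) : altform V k :=
  @contract 1 k (fun=> u) w.

Definition wedge_fun k l (a : altform V k) (b : altform V l)
    (v : 'I_(k + l) -> V) : R^o :=
  (k`! * l`!)%:R^-1 * \sum_(s : 'S_(k + l))
    (-1) ^+ s * (a (fun i => v (s (lshift l i))) *
                 b (fun j => v (s (rshift k j)))).

Fact wedge_subproof k l (a : altform V k) (b : altform V l) :
  wedge_fun a b \in @alternating_pred R V (k + l).
Proof.
apply/asboolP; split=> [v i c x y|v i j ij vij]; rewrite /wedge_fun.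
  rewrite mulrCA -mulrDr; congr (_ * _).
  rewrite mulr_sumr -big_split; apply: eq_bigr => s _ /=.
  rewrite (mulrCA c) -mulrDr; congr (_ * _).
  have updE m (f : 'I_m -> 'I_(k + l)) i0 z : injective f -> f i0 = i ->
      (fun a => if f a == i then z else v (f a)) =
      [eta (fun a => v (f a)) with i0 |-> z].
    move=> f_inj fi; apply/funext => m' /=.
    by rewrite -fi (inj_eq f_inj).
  have updN m (f : 'I_m -> 'I_(k + l)) z : (forall a, f a != i) ->
      (fun a => if f a == i then z else v (f a)) = (fun a => v (f a)).
    by move=> fi; apply/funext => m' /=; rewrite (negPf (fi m')).
  have Linj : injective (fun i => s (lshift l i)).
    by move=> ? ? /perm_inj/lshift_inj.
  have Rinj : injective (fun i => s (rshift k i)).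
    by move=> ? ? /perm_inj/rshift_inj.
  have := permKV s i; case: (split_ordP (s^-1%g i)) => i0 -> si0.
    rewrite !(updE _ _ i0 _ Linj si0) !updN; last first.
    - by move=> a0; rewrite -si0 (inj_eq perm_inj) eq_rlshift.
    - by move=> a0; rewrite -si0 (inj_eq perm_inj) eq_rlshift.
    - by move=> a0; rewrite -si0 (inj_eq perm_inj) eq_rlshift.
    by rewrite altform_linear mulrDl mulrA.
  rewrite !(updE _ _ i0 _ Rinj si0) !updN; last first.
  - by move=> a0; rewrite -si0 (inj_eq perm_inj) eq_lrshift.
  - by move=> a0; rewrite -si0 (inj_eq perm_inj) eq_lrshift.
  - by move=> a0; rewrite -si0 (inj_eq perm_inj) eq_lrshift.
  by rewrite altform_linear mulrDr mulrCA.
set S := (X in _ * X); suff -> : S = 0 by rewrite mulr0.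
suff : S = - S.
  by move/eqP; rewrite -subr_eq0 opprK -mulr2n mulrn_eq0 => /eqP.
rewrite {1}/S (reindex_inj (mulIg (tperm i j))) /= -sumrN.
apply: eq_bigr => s _; rewrite odd_permM odd_tperm ij signr_addb mulrN1 mulNr.
have vt z : v (tperm i j z) = v z by case: tpermP => [->|->|].
congr (- (_ * (_ * _))); congr altfun; apply/funext => m;
  by rewrite permM vt.
Qed.

(* The sum over all permutations divided by k! l!, i.e. the sum over shuffles *)
Definition wedge k l (a : altform V k) (b : altform V l) : altform V (k + l) :=
  AltForm (wedge_subproof a b).

Fact pullback_subproof (W : vectType R) k (g : 'Hom(V, W)) (w : altform W k) :
  (fun v : 'I_k -> V => w (fun i => g (v i))) \in @alternating_pred R V k.
Proof.
apply/asboolP; split=> [v i a x y|v i j ij vij]; last first.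
  by apply: (@altform_alt _ _ _ w _ i j ij); rewrite vij.
have E z : (fun j => g ([eta v with i |-> z] j)) =
    [eta (fun j => g (v j)) with i |-> g z].
  by apply/funext => j /=; case: eqP.
by rewrite !E linearP altform_linear.
Qed.

Definition pullback (W : vectType R) k (g : 'Hom(V, W)) (w : altform W k) :
    altform V k := AltForm (pullback_subproof g w).

End Operations.

Section Euclidean.
Variables (R : realType) (V : vectType R) (ip : {dot V for idfun}).

Definition orthonormal_family n (e : 'I_n -> V) : Prop :=
  forall i j, ip (e i) (e j) = (i == j)%:R.

Lemma orthonormal_family_ex n : (n <= \dim {:V})%N ->
  exists e : 'I_n -> V, orthonormal_family e.
Proof.
elim: n => [_|n IHn n_lt]; first by exists (fun=> 0) => -[].
have [e eP] := IHn (ltnW n_lt).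
have [x xNe] : exists x, x \notin <<codom e>>%VS.
  apply: contrapT => /forallNP xe.
  have : ({:V} <= <<codom e>>)%VS by apply/subvP => x _; apply/negPn/negP/xe.
  move/dimvS/leq_trans/(_ (dim_span _)).
  by rewrite size_codom card_ord leqNgt n_lt.
pose y := x - \sum_i ip x (e i) *: e i.
have y0 : y != 0.
  apply: contra xNe; rewrite subr_eq0 => /eqP ->.
  by apply: rpred_sum => i _; rewrite rpredZ// memv_span// codom_f.
have sym u v : ip u v = ip v u.
  by rewrite (@hermitian_subproof _ _ _ _ ip u v) expr0 mul1r.
have ye i : ip (e i) y = 0.
  rewrite linearBr linear_sumr (bigD1 i)//= big1 => [|j ji].
    by rewrite linearZr_LR /= eP eqxx mulr1 addr0 (sym x) subrr.
  by rewrite linearZr_LR /= eP eq_sym (negPf ji) mulr0.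
have y_gt0 : 0 < ip y y by exact: neq0_dnorm_gt0.
pose z := (Num.sqrt (ip y y))^-1 *: y.
have ze i : ip (e i) z = 0 by rewrite linearZr_LR /= ye mulr0.
have zz : ip z z = 1.
  rewrite linearZr_LR linearZl_LR /= mulrA -invfM -expr2 sqr_sqrtr ?ltW//.
  by rewrite mulVf// gt_eqF.
exists (fun i => oapp e z (unlift ord_max i)) => i j.
case: unliftP => [i' ->|->]; case: unliftP => [j' ->|->] /=.
- by rewrite eP (inj_eq lift_inj).
- by rewrite ze eq_sym (negPf (neq_lift _ _)).
- by rewrite sym ze (negPf (neq_lift _ _)).
- by rewrite zz eqxx.
Qed.

Definition onb : 'I_(\dim {:V}) -> V := xget (fun=> 0) [set e | orthonormal_family e].

Lemma onbP : orthonormal_family onb.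
Proof. by rewrite /onb; apply: xgetPex; apply: orthonormal_family_ex. Qed.

(* Summing over all multi-indices and dividing by k! is the sum over
   increasing ones, so the e^I with I increasing are orthonormal. *)
Definition ipform k (a b : altform V k) : R :=
  k`!%:R^-1 * \sum_(I : {ffun 'I_k -> 'I_(\dim {:V})})
    a (onb \o I) * b (onb \o I).

(* The Hodge operator of the volume form vol, in degree k with k + l = dim V:
   * e^I = vol(e_I, _), equivalently a /\ * w = <a, w> vol for all k-forms a *)
Definition hodge k l (vol : altform V (k + l)) (w : altform V k) : altform V l :=
  k`!%:R^-1 *: \sum_(I : {ffun 'I_k -> 'I_(\dim {:V})})
    w (onb \o I) *: contract (onb \o I) vol.

Definition is_orth_proj (A : vectType R) (b : A -> A -> R) (U : {vspace A})
  (p : A -> A) : Prop :=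
  forall x, p x \in U /\ forall y, y \in U -> b (x - p x) y = 0.

Definition cross_product (cross : {bilinear V -> V -> V}) : Prop :=
  [/\ forall u v, cross u v = - cross v u,
      forall u v, ip (cross u v) u = 0,
      forall u v, ip (cross u v) v = 0 &
      forall u v, ip (cross u v) (cross u v) =
        ip u u * ip v v - ip u v ^+ 2].

Fact assoc_form_subproof (cross : {bilinear V -> V -> V}) :
  cross_product cross ->
  (fun v : 'I_3 -> V => ip (cross (v 0) (v 1)) (v 2)) \in
    @alternating_pred R V 3.
Proof.
case=> cN c1 c2 _; apply/asboolP.
have xx u : cross u u = 0.
  by have /eqP := cN u u; rewrite -subr_eq0 opprK -mulr2n -scaler_nat
    scaler_eq0 pnatr_eq0 => /eqP.
split=> [v i a x y|v i j].
  case: i => -[|[|[|//]]] lti /=.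
  - by rewrite !linearPl.
  - by rewrite linearPr linearPl.
  - by rewrite linearPr.
have v0 : v 0 = v (Ordinal (isT : 0 < 3)%N) by congr v; apply/val_inj.
have v1 : v 1 = v (Ordinal (isT : 1 < 3)%N) by congr v; apply/val_inj.
have v2 : v 2 = v (Ordinal (isT : 2 < 3)%N) by congr v; apply/val_inj.
rewrite v0 v1 v2.
case: i => -[|[|[|//]]] lti; case: j => -[|[|[|//]]] ltj //= _;
  rewrite !(bool_irrelevance lti isT) !(bool_irrelevance ltj isT) => E;
  by rewrite ?E ?xx ?c1 ?c2 -?E ?xx ?c1 ?c2 // ?linear0l.
Qed.

Definition assoc_form (cross : {bilinear V -> V -> V})
    (crossP : cross_product cross) : altform V 3 :=
  AltForm (assoc_form_subproof crossP).

(* The volume form of the orientation induced by phi (dim V = 7): the form of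
   norm 1 such that i(u)phi /\ i(v)phi /\ phi = 6 <u, v> vol *)
Definition assoc_vol (phi : altform V 3) : altform V 7 :=
  xget 0 [set vol : altform V 7 | ipform vol vol = 1 /\
    forall u v,
      (wedge (wedge (interior_prod u phi) (interior_prod v phi)) phi : altform V 7) =
      (6 * ip u v) *: vol].

Definition symmetric_endo (A : 'End(V)) : Prop :=
  forall u v, ip (A u) v = ip u (A v).

End Euclidean.

Section Groups.
Variables (R : realType) (V : vectType R).

Definition lftrace (A : 'End(V)) : R :=
  \tr (passmx.mxof (vbasis {:V}) (vbasis {:V}) A).

Definition Ggroup (phi : altform V 3) : set 'End(V) :=
  [set g | lker g = 0%VS /\ pullback g phi = phi].

Definition smooth_fun (f : R -> R) : Prop :=
  forall n t, derivable (derive1n n f) t 1.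

(* Tangent space at the identity: velocities at 0 of smooth curves in G *)
Definition Lie (G : set 'End(V)) : set 'End(V) :=
  [set A | exists c : R -> 'End(V),
    [/\ c 0 = \1%VF, forall t, G (c t),
        forall (l : {scalar V}) u, smooth_fun (fun t => l (c t u)) &
        forall (l : {scalar V}) u, derive1 (fun t => l (c t u)) 0 = l (A u)]].

Definition lie_bracket (A B : 'End(V)) : 'End(V) := ((A \o B) - (B \o A))%VF.

(* A G-representation is given by an ambient space A, a map rho by which each
   g in G acts on A, and a subspace U of A *)

Definition form_act k (g : 'End(V)) (w : altform V k) : altform V k :=
  pullback (g^-1)%VF w.

Definition conj_act (g A : 'End(V)) : 'End(V) := (g \o A \o g^-1)%VF.

Definition std_act (g : 'End(V)) (v : V) : V := g v.

Definition invariant (G : set 'End(V)) (A : vectType R)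
    (rho : 'End(V) -> A -> A) (U : {vspace A}) : Prop :=
  forall g x, G g -> x \in U -> rho g x \in U.

Definition irreducible (G : set 'End(V)) (A : vectType R)
    (rho : 'End(V) -> A -> A) (U : {vspace A}) : Prop :=
  [/\ invariant G rho U, U != 0%VS &
      forall W : {vspace A}, (W <= U)%VS -> invariant G rho W ->
        W = 0%VS \/ W = U].

Definition rep_iso (G : set 'End(V)) (A B : vectType R)
    (rho : 'End(V) -> A -> A) (U : {vspace A})
    (sigma : 'End(V) -> B -> B) (W : {vspace B}) : Prop :=
  exists f : 'Hom(A, B),
    [/\ (f @: U)%VS = W, (U :&: lker f)%VS = 0%VS &
        forall g x, G g -> x \in U -> f (rho g x) = sigma g (f x)].

End Groups.

Definition lie_iso (R : realType) (V V' : vectType R)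
    (g : {vspace 'End(V)}) (g' : {vspace 'End(V')}) : Prop :=
  exists f : 'Hom('End(V), 'End(V')),
    [/\ (f @: g)%VS = g', (g :&: lker f)%VS = 0%VS &
        forall A B, A \in g -> B \in g ->
          f (lie_bracket A B) = lie_bracket (f A) (f B)].

Section Standard.
Variable R : realType.
Local Notation R7 := 'rV[R]_7.

Fact dx_subproof (i : 'I_7) :
  (fun v : 'I_1 -> R7 => v 0 0 i) \in @alternating_pred R R7 1.
Proof.
apply/asboolP; split=> [v j a x y|v j j']; last by rewrite !ord1.
by rewrite !ord1 /= !mxE.
Qed.

(* dx_1, ..., dx_7 are indexed from 1 *)
Definition dx (i : nat) : altform R7 1 := AltForm (dx_subproof (inord i.-1)).

Definition dx3 (i j k : nat) : altform R7 3 := wedge (wedge (dx i) (dx j)) (dx k).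

Definition phi0 : altform R7 3 :=
  dx3 1 2 3 - dx3 1 4 5 - dx3 1 6 7 - dx3 2 4 6 + dx3 2 5 7
  - dx3 3 4 7 - dx3 3 5 6.

End Standard.

(* Main.v *)
From Stdlib Require Import ZArith.
From HB Require Import structures.
From mathcomp Require Import all_boot all_order all_algebra.
From mathcomp Require Import perm sesquilinear.
From mathcomp Require Import all_classical all_reals all_analysis.
From mathcomp Require Import ring lra ssrZ.
Require Import Defs.
Import Order.TTheory GRing.Theory Num.Theory.
Set Implicit Arguments.
Unset Strict Implicit.
Unset Printing Implicit Defensive.
Local Open Scope ring_scope.
Delimit Scope Z_scope with BZ.

(** Write phi(a,b,c) = <a x b, c> and psi(a,b,c,d) = <a x b, c x d> -
    <a,c><b,d> + <a,d><b,c>.  Two contraction identities over an orthonormal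
    basis e follow from the axioms of a cross product and carry the rest:
    sum phi(a,e_k,e_l) phi(b,e_k,e_l) = 6 <a,b> ([contract_phi_phi]) and
    sum phi(a,e_k,e_l) psi(e_k,e_l,b,c) = 4 phi(a,b,c) ([contract_phi_psi]).

    Three orthonormal vectors u, v, w with w orthogonal to u x v generate, by
    cross products, an orthonormal basis with a fixed multiplication table, the
    table of the imaginary octonions ([special_frame], [frame_cross]).  In such
    a basis the volume form of the orientation is the determinant, and the
    equality of psi with the Hodge dual of phi is a finite computation with
    integers ([hodge_phi], [assoc_volE], [star_phi]).

    On a 2-form w put s(w) = 1/2 sum w(e_j,e_k) e_j x e_k.  Contracting w with
    star phi = psi and with star psi = phi gives
      star (phi /\ w) = i(s(w)) phi - w,   s(i(u) phi) = 3 u,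
      star (psi /\ star (psi /\ w)) = i(s(w)) phi
    ([star5_phi], [svec_into], [star5_psi_star6_psi]).  So the 2-forms split
    into the image of u |-> i(u) phi and the kernel of s, these are the
    eigenspaces for 2 and -1, and w |-> 1/3 i(s(w)) phi is the projection onto
    the first one along the second one.

    On 3-forms, let an endomorphism A act on phi as a derivation ([kform]).
    When A is symmetric and traceless, contracting the result with phi gives
    back 4 A, and the result is orthogonal to phi and to all i(u) psi.  This
    identifies the traceless symmetric endomorphisms with a 27-dimensional
    space of 3-forms, and 1 + 7 + 27 = 35 leaves no room for anything else
    ([three_forms]).

    An element of G preserves the inner product and the cross product, and
    conversely the map between two frames as above lies in G ([basis_map_G]).
    Hence G is transitive on unit vectors and on orthonormal pairs.  This makes
    V irreducible, and with it the two 7-dimensional spaces.  For the other two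
    spaces, take a nonzero element A of an invariant subspace and orthonormal
    u, v with A(u,v) nonzero.  Sums of translates of A by elements of G that
    permute a frame up to signs kill all components but a multiple of a fixed
    element attached to u and v ([average_sym], [average_skew]); these elements
    form one orbit, and they span ([S0_irreducible], [L214_irreducible]).

    The velocity at the identity of a curve in G is skew and annihilates phi,
    which by contraction puts it in the 14-dimensional space of 2-forms
    ([Lie_lieG]).  Conversely, the 2-forms whose endomorphism is the velocity
    of a curve in G with trigonometric polynomial entries form an invariant
    subspace, which is nonzero because turning w in the plane of w and u x w
    moves a frame through frames ([tangent_circle]).  By irreducibility all
    of the 14-dimensional space is reached ([lieG_Lie]).  Finally, coordinates
    in a special frame carry phi to the standard form on seven-dimensional
    space ([coordinates]), and conjugation by them identifies the Lie
    algebras. *)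

(** * Subspaces cut out by closed predicates *)

Section LinearAlgebra.
Variable K : fieldType.

(** A predicate closed under linear combinations need not be decidable, so the
    subspace is found as one of maximal dimension among those inside the
    predicate. *)
Lemma vspace_of_closed (V : vectType K) (P : V -> Prop) :
  P 0 -> (forall a u v, P u -> P v -> P (a *: u + v)) ->
  exists U : {vspace V}, forall v, v \in U <-> P v.
Proof.
move=> P0 PL; pose Q := [pred n | `[< exists U : {vspace V},
  \dim U = n /\ forall v, v \in U -> P v >] ].
have Q0 : exists n, Q n.
  exists 0%N; apply/asboolP; exists 0%VS; split; first exact: dimv0.
  by move=> v; rewrite memv0 => /eqP ->.
have Qub n : Q n -> (n <= \dim {:V})%N.
  by move=> /asboolP[U [<- _]]; exact/dimvS/subvf.
case: (ex_maxnP Q0 Qub) => n /asboolP[U [dimU UP]] Qmax.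
exists U => v; split; first exact: UP.
move=> Pv; apply: contrapT => /negP vNU.
have : Q (\dim (U + <[v]>)).
  apply/asboolP; exists (U + <[v]>)%VS; split=> // w.
  by case/memv_addP => u /UP Pu [y /vlineP[c ->] ->]; rewrite addrC; exact: PL.
move/Qmax; apply/negP; rewrite -ltnNge -dimU.
rewrite (ltn_leqif (dimv_leqif_sup (addvSl _ _))).
by apply: contra vNU => /(subv_trans (addvSr _ _)); rewrite -memvE.
Qed.

Lemma dim_le_inj (V W : vectType K) (U : {vspace V}) (f : {linear V -> W}) :
  {in U, forall x, f x = 0 -> x = 0} -> (\dim U <= \dim {:W})%N.
Proof.
move=> f_inj; rewrite -(@limg_dim_eq _ _ _ (linfun f)); first exact/dimvS/subvf.
apply/eqP; rewrite -subv0; apply/subvP => x; rewrite memv_cap memv_ker lfunE memv0.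
by case/andP=> xU /eqP/(f_inj _ xU)/eqP.
Qed.

End LinearAlgebra.

(** * Alternating forms on explicit tuples of vectors *)

Section AlternatingForms.
Variables (R : realType) (V : vectType R).

(** Arguments of a form are given as a sequence, so that concatenation and case
    analysis on the arguments are those of sequences. The default 0 fills in
    missing entries. *)
Definition vec (s : seq V) k : 'I_k -> V := fun i => s`_i.

Lemma codom_vec k (v : 'I_k -> V) : vec (codom v) (k := k) = v.
Proof.
apply/funext => i; rewrite /vec /codom /image_mem.
by rewrite (nth_map i) ?size_enum_ord ?nth_ord_enum // nth_ord_enum.
Qed.

Lemma catf_vec k l (s t : seq V) : size s = k ->
  catf (vec s (k := k)) (vec t (k := l)) = vec (s ++ t) (k := k + l).
Proof.
move=> sk; apply/funext => i; rewrite /catf /vec.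
case: fintype.splitP => j ->; rewrite nth_cat sk ?ltn_ord //.
by rewrite ltnNge leq_addr /= addKn.
Qed.

Definition fcons k (x : V) (v : 'I_k -> V) : 'I_k.+1 -> V :=
  @catf R V 1 k (fun=> x) v.

Lemma fcons_vec k (x : V) (s : seq V) :
  fcons x (vec s (k := k)) = vec (x :: s) (k := k.+1).
Proof.
rewrite -[x :: s]cat1s -(@catf_vec 1 k) //; congr (@catf R V 1 k).
by apply/funext => i; rewrite ord1.
Qed.

Lemma fcons_eta k (v : 'I_k.+1 -> V) :
  v = fcons (v 0) (fun i : 'I_k => v (lift ord0 i)).
Proof.
apply/funext => i; rewrite /fcons /catf; case: fintype.splitP => j ij.
  by congr v; apply/val_inj; rewrite /= ij ord1.
by congr v; apply/val_inj.
Qed.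

Lemma interiorE k (x : V) (a : altform V k.+1) v :
  interior_prod x a v = a (fcons x v).
Proof. by []. Qed.

Lemma interior_vec k (x : V) (a : altform V k.+1) s :
  interior_prod x a (vec s (k := k)) = a (vec (x :: s) (k := k.+1)).
Proof. by rewrite interiorE fcons_vec. Qed.

Lemma altformD k (a b : altform V k) v : (a + b) v = a v + b v.
Proof. by []. Qed.
Lemma altformB k (a b : altform V k) v : (a - b) v = a v - b v.
Proof. by []. Qed.
Lemma altformZ k c (a : altform V k) v : (c *: a) v = c * a v.
Proof. by []. Qed.
Lemma altform0 k v : (0 : altform V k) v = 0.
Proof. by []. Qed.
Lemma altform_sum k (I : finType) (P : pred I) (F : I -> altform V k) v :
  (\sum_(i | P i) F i) v = \sum_(i | P i) F i v.
Proof. by elim/big_rec2: _ => // i y z _ <-. Qed.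

Lemma altform_head_linear k (a : altform V k.+1) (v : 'I_k -> V) :
  scalar (fun x => a (fcons x v) : R^o).
Proof.
have E x : fcons x v = [eta fcons 0 v with ord0 |-> x].
  apply/funext => i /=; rewrite /fcons /catf; case: fintype.splitP => j ij.
    by rewrite (_ : i = ord0) ?eqxx //; apply/val_inj; rewrite /= ij ord1.
  case: eqP => // i0; suff : (i : nat) = 0%N by rewrite ij.
  by rewrite i0.
by move=> c x y; rewrite (E (c *: x + y)) (E x) (E y) altform_linear.
Qed.

(** The interior product as a function of the vector, in the argument order in
    which it is a linear map. *)
Definition into k (a : altform V k.+1) (x : V) : altform V k := interior_prod x a.

Lemma into_linear k (a : altform V k.+1) : linear (into a).
Proof.
move=> c x y; apply: altform_inj => v.
by rewrite altformD altformZ !interiorE altform_head_linear.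
Qed.
HB.instance Definition _ k (a : altform V k.+1) :=
  GRing.isLinear.Build R V (altform V k) _ (into a) (@into_linear k a).

(** Enough for a transposition of i and j, where it follows by expanding the form
    at u i + u j in both places; permutations are products of those. *)
Lemma altform_perm k (a : altform V k) (s : 'S_k) v :
  a (fun i => v (s i)) = (-1) ^+ s * a v.
Proof.
have tp (i j : 'I_k) u : i != j -> a (fun l => u (tperm i j l)) = - a u.
  move=> ij.
  pose w (x y : V) (l : 'I_k) := if l == j then y else if l == i then x else u l.
  have wl y : scalar (fun x => a (w x y) : R^o).
    have E x : w x y = [eta [eta u with j |-> y] with i |-> x].
      apply/funext => l; rewrite /w /=; have [->|//] := eqVneq l j.
      by rewrite eq_sym (negPf ij).
    by move=> c x x'; rewrite !E altform_linear.
  have wr x : scalar (fun y => a (w x y) : R^o).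
    have E y : w x y = [eta [eta u with i |-> x] with j |-> y] by [].
    by move=> c y y'; rewrite !E altform_linear.
  have w0 x : a (w x x) = 0.
    by apply: (altform_alt _ ij); rewrite /w eqxx (negPf ij) eqxx.
  have := w0 (u i + u j); have -> : a (w (u i + u j) (u i + u j)) =
      a (w (u j) (u i)) + a (w (u i) (u j)).
    have := wl (u i + u j) 1 (u i) (u j); rewrite !scale1r mul1r => ->.
    have := wr (u i) 1 (u i) (u j); rewrite !scale1r mul1r => ->.
    have := wr (u j) 1 (u i) (u j); rewrite !scale1r mul1r => ->.
    by rewrite !w0 add0r addr0 addrC.
  have <- : u = w (u i) (u j).
    by apply/funext => l; rewrite /w; case: eqP => [->|_] //; case: eqP => [->|].
  have -> : (fun l => u (tperm i j l)) = w (u j) (u i).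
    apply/funext => l; rewrite /w; case: tpermP => [->|->|/eqP/negPf-> /eqP/negPf-> //].
      by rewrite (negPf ij) eqxx.
    by rewrite eqxx.
  by move/eqP; rewrite addr_eq0 => /eqP.
have [ts -> tsP] := prod_tpermP s; elim: ts tsP v => [_|[i j] ts IH /= /andP[ij tsP]] v.
  rewrite big_nil odd_perm1 mul1r; congr (altfun a); apply/funext => i.
  by rewrite perm1.
rewrite big_cons odd_permM odd_tperm /= ij signr_addb mulN1r mulNr -IH //.
rewrite -(tp i j _ ij).
by congr (altfun a); apply/funext => l; rewrite permM.
Qed.

End AlternatingForms.
Arguments vec {R V} s {k}.

(** * Sums over an orthonormal basis, wedge products and the Hodge operator *)

Section Sums.
Variables (R : realType) (V : vectType R) (n : nat) (e : 'I_n -> V).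

(** Iterated sums over the basis, indexed by sequences of vectors: splitting a
    multi-index is then concatenation. *)
Fixpoint msum k (H : seq V -> R) : R :=
  if k is k'.+1 then \sum_i msum k' (fun s => H (e i :: s)) else H [::].

Lemma eq_msum k (H H' : seq V -> R) :
  (forall s, size s = k -> H s = H' s) -> msum k H = msum k H'.
Proof.
elim: k H H' => [|k IH] H H' HH' /=; first exact: HH'.
by apply: eq_bigr => i _; apply: IH => s sk; apply: HH'; rewrite /= sk.
Qed.

Lemma msumZ k c (H : seq V -> R) : msum k (fun s => c * H s) = c * msum k H.
Proof.
elim: k H => [|k IH] H //=; rewrite mulr_sumr; apply: eq_bigr => i _; exact: IH.
Qed.

Lemma msum_sum k m (H : 'I_m -> seq V -> R) :
  msum k (fun s => \sum_i H i s) = \sum_i msum k (H i).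
Proof.
elim: k H => [|k IH] H //=; rewrite exchange_big; apply: eq_bigr => i _.
exact: IH.
Qed.

Lemma exchange_msum k l (G : seq V -> seq V -> R) :
  msum k (fun s => msum l (G s)) = msum l (fun t => msum k (G^~ t)).
Proof.
elim: k G => [|k IH] G //=.
by under eq_bigr => i _ do rewrite (IH (fun s => G (e i :: s))); rewrite -msum_sum.
Qed.

Lemma msum_cat k l (H : seq V -> R) :
  msum (k + l) H = msum k (fun s => msum l (fun t => H (s ++ t))).
Proof.
by elim: k H => [|k IH] H //=; apply: eq_bigr => i _; rewrite IH.
Qed.

Lemma sum_ffun_msum k (F : ('I_k -> V) -> R) :
  \sum_(I : {ffun 'I_k -> 'I_n}) F (e \o I) = msum k (fun s => F (vec s)).
Proof.
elim: k F => [|k IH] F /=.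
  rewrite (big_pred1 (ffun0 (card_ord 0))) /=.
    by congr F; apply/funext => -[].
  by move=> I /=; apply/esym/eqP/ffunP => -[].
under [RHS]eq_bigr => i _.
  under eq_msum => s _ do rewrite -fcons_vec.
  rewrite -(IH (fun v => F (fcons (e i) v))).
  over.
rewrite pair_big /=.
pose g (p : 'I_n * {ffun 'I_k -> 'I_n}) : {ffun 'I_k.+1 -> 'I_n} :=
  [ffun i => oapp p.2 p.1 (unlift ord0 i)].
pose h (I : {ffun 'I_k.+1 -> 'I_n}) := (I ord0, [ffun i => I (lift ord0 i)]).
rewrite (reindex g) /=.
  apply: eq_bigr => -[i I] _ /=; rewrite [e \o _]fcons_eta; congr (F (fcons _ _)).
    by rewrite /= ffunE unlift_none.
  by apply/funext => j; rewrite /= ffunE liftK.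
exists h => [[i I]|I] _; rewrite /g /h /=.
  rewrite ffunE unlift_none; congr pair; apply/ffunP => j.
  by rewrite !ffunE liftK.
by apply/ffunP => j; rewrite ffunE; case: unliftP => [j' ->|->] /=; rewrite ?ffunE.
Qed.

End Sums.

Section Euclidean.
Variables (R : realType) (V : vectType R) (ip : {dot V for idfun}).

Lemma ipC u v : ip u v = ip v u.
Proof. by rewrite (@hermitian_subproof _ _ _ _ ip u v) expr0 mul1r. Qed.

Lemma ip_eq0 u : ip u u = 0 -> u = 0.
Proof.
move=> u0; apply/eqP; apply: contraT => uN0.
by have : 0 < ip u u by [exact: neq0_dnorm_gt0]; rewrite u0 ltxx.
Qed.

(** The expansion is part of the definition so that no dimension has to be
    compared each time it is used. *)
Definition onbasis n (e : 'I_n -> V) : Prop :=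
  orthonormal_family ip e /\ forall v, v = \sum_i ip v (e i) *: e i.

Lemma orthonormal_onbasis n (e : 'I_n -> V) :
  \dim {:V} = n -> orthonormal_family ip e -> onbasis e.
Proof.
move=> dimV eP; split=> // v.
have ipe (c : 'I_n -> R) j : ip (\sum_i c i *: e i) (e j) = c j.
  rewrite linear_sumlz (bigD1 j) //= big1 => [|i ij].
    by rewrite linearZl_LR /= eP eqxx mulr1 addr0.
  by rewrite linearZl_LR /= eP (negPf ij) mulr0.
pose X := [tuple e i | i < n].
have Xi (i : 'I_n) : X`_i = e i by rewrite -tnth_nth tnth_mktuple.
have Xfree : free X.
  apply/freeP => c c0 j; rewrite -[LHS]ipe.
  by under eq_bigr => i _ do rewrite -Xi; rewrite c0 linear0l.
have Xbasis : basis_of {:V} X by rewrite basisEfree Xfree subvf size_tuple dimV leqnn.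
have := coord_basis Xbasis (memvf v).
under eq_bigr => i _ do rewrite Xi.
by move=> vE; under eq_bigr => i _ do rewrite {1}vE ipe; rewrite -vE.
Qed.

Lemma onb_onbasis : onbasis (onb ip).
Proof. exact/orthonormal_onbasis/onbP. Qed.

Section TwoBases.
Variables (n m : nat) (e : 'I_n -> V) (f : 'I_m -> V).
Hypotheses (eP : onbasis e) (fP : onbasis f).

Lemma parseval u v : ip u v = \sum_i ip u (e i) * ip v (e i).
Proof.
rewrite {1}[u]eP.2 linear_sumlz; apply: eq_bigr => i _ /=.
by rewrite linearZl_LR /= (ipC v).
Qed.

Lemma eq_ip u v : (forall i, ip u (e i) = ip v (e i)) -> u = v.
Proof. by move=> uv; rewrite [u]eP.2 [v]eP.2; apply: eq_bigr => i _; rewrite uv. Qed.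

Lemma sum_ip_scalar (p : {scalar V}) v : \sum_i ip v (e i) * p (e i) = p v.
Proof. by rewrite [in RHS](eP.2 v) linear_sum; apply: eq_bigr => i _; rewrite linearZ. Qed.

End TwoBases.

(** The trace of a bilinear form with respect to the inner product. This is why
    inner products of forms and the Hodge operator can be computed in any
    orthonormal basis. *)
Lemma sum_bilinear_indep n m (e : 'I_n -> V) (f : 'I_m -> V)
    (B : V -> V -> R) : onbasis e -> onbasis f ->
  (forall u, scalar (B u)) -> (forall v, scalar (B^~ v)) ->
  \sum_i B (e i) (e i) = \sum_j B (f j) (f j).
Proof.
move=> eP fP Br Bl.
pose Brs u : {scalar V} := HB.pack (B u : V -> R^o) (GRing.isLinear.Build R V R^o _ _ (Br u)).
pose Bls v : {scalar V} := HB.pack (B^~ v : V -> R^o) (GRing.isLinear.Build R V R^o _ _ (Bl v)).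
under eq_bigr => i _ do rewrite -[B _ _]/(Brs (e i) (e i)) -(sum_ip_scalar fP).
rewrite exchange_big /=; apply: eq_bigr => j _.
under eq_bigr => i _ do rewrite ipC -[B _ _]/(Bls (f j) (e i)).
by rewrite (sum_ip_scalar eP).
Qed.

(** One index at a time, by [sum_bilinear_indep]. *)
Lemma msum_indep n m (e : 'I_n -> V) (f : 'I_m -> V) k (a b : altform V k) :
  onbasis e -> onbasis f ->
  msum e k (fun s => a (vec s) * b (vec s)) = msum f k (fun s => a (vec s) * b (vec s)).
Proof.
move=> eP fP; elim: k a b => [|k IH] a b //=.
transitivity (\sum_i msum f k (fun s => into a (e i) (vec s) * into b (e i) (vec s))).
  apply: eq_bigr => i _; rewrite -IH; apply: eq_msum => s _.
  by rewrite !interior_vec.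
rewrite -!msum_sum; apply: eq_msum => s _.
rewrite (@sum_bilinear_indep _ _ e f (fun x y => into a x (vec s) * into b y (vec s))) //.
- by apply: eq_bigr => i _; rewrite !interior_vec.
- by move=> u c x y; rewrite linearP altformD altformZ /=; ring.
- by move=> u c x y; rewrite linearP altformD altformZ /=; ring.
Qed.

Fact rcontract_subproof k l (x : 'I_l -> V) (w : altform V (k + l)) :
  (fun v : 'I_k -> V => w (catf v x)) \in @alternating_pred R V k.
Proof.
apply/asboolP; split=> [v i a y z|v i j ij vij].
  have E z' : catf [eta v with i |-> z'] x = [eta catf v x with lshift l i |-> z'].
    apply/funext => j; rewrite /catf /=; case: (split_ordP j) => j' ->.
      by rewrite (inj_eq (@lshift_inj _ _)).
    by rewrite eq_rlshift.
  by rewrite (E (a *: y + z)) (E y) (E z) altform_linear.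
apply: (@altform_alt _ _ _ w _ (lshift l i) (lshift l j)).
  by rewrite (inj_eq (@lshift_inj _ _)).
by rewrite /catf !(unsplitK (inl _ _)).
Qed.

(** Fixing the last arguments, whereas [contract] fixes the first ones: the Hodge
    operator sums over the first arguments of the volume form, and for fixed
    last ones that sum is an inner product. *)
Definition rcontract k l (x : 'I_l -> V) (w : altform V (k + l)) : altform V k :=
  AltForm (rcontract_subproof x w).

Section Basis.
Variables (n : nat) (e : 'I_n -> V) (eP : onbasis e).

Lemma ipformE k (a b : altform V k) :
  ipform ip a b = k`!%:R^-1 * msum e k (fun s => a (vec s) * b (vec s)).
Proof.
rewrite /ipform (sum_ffun_msum _ (fun v => a v * b v)); congr (_ * _).
exact: (msum_indep _ _ onb_onbasis eP).
Qed.

Lemma hodgeE k l (vol : altform V (k + l)) (w : altform V k) t : size t = l ->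
  hodge ip vol w (vec t) =
  k`!%:R^-1 * msum e k (fun s => w (vec s) * vol (vec (s ++ t))).
Proof.
move=> tl; rewrite /hodge altformZ altform_sum; congr (_ * _).
under eq_bigr => I _.
  rewrite altformZ -[contract _ _ _]/(rcontract (vec t) vol (onb ip \o I)).
  over.
rewrite (sum_ffun_msum _ (fun v => w v * rcontract (vec t) vol v)).
rewrite (msum_indep _ _ onb_onbasis eP); apply: eq_msum => s sk /=.
by rewrite catf_vec.
Qed.

(** Since F is alternating, each permutation in the definition of the wedge
    product contributes the same sum; the factorials then cancel. So pairing a
    wedge product with F is contracting F with the two factors in turn. *)
Lemma ipform_wedge k l (a : altform V k) (b : altform V l) (F : altform V (k + l)) :
  (k + l)`!%:R^-1 * msum e (k + l) (fun s => wedge a b (vec s) * F (vec s)) =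
  l`!%:R^-1 * msum e l (fun t => b (vec t) *
    (k`!%:R^-1 * msum e k (fun s => a (vec s) * F (vec (s ++ t))))).
Proof.
rewrite -(sum_ffun_msum e (fun v => wedge a b v * F v)).
pose H v := a (fun i => v (lshift l i)) * b (fun j => v (rshift k j)) * F v.
transitivity ((k`! * l`!)%:R^-1 * \sum_(I : {ffun 'I_(k + l) -> 'I_n}) H (e \o I)).
  under eq_bigr => I _ do rewrite /= /wedge_fun -mulrA mulr_suml.
  rewrite -mulr_sumr exchange_big /= mulrCA; congr (_ * _).
  transitivity ((k + l)`!%:R^-1 * \sum_(s : 'S_(k + l))
      \sum_(I : {ffun 'I_(k + l) -> 'I_n}) H (e \o I)).
    congr (_ * _); apply: eq_bigr => s _.
    pose g (I : {ffun 'I_(k + l) -> 'I_n}) := [ffun i => I (s i)].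
    rewrite [RHS](reindex g) /=; last first.
      exists (fun I : {ffun 'I_(k + l) -> 'I_n} => [ffun i => I ((s^-1)%g i)]) => I _;
        by apply/ffunP => i; rewrite !ffunE ?permK ?permKV.
    apply: eq_bigr => I _; rewrite /H.
    have -> : F (e \o g I) = (-1) ^+ s * F (e \o I).
      by rewrite -altform_perm; congr (altfun F); apply/funext => i; rewrite /= ffunE.
    rewrite [RHS]mulrCA mulrA; congr (_ * _ * _); congr (_ * _);
    by congr altfun; apply/funext => i; rewrite /= ffunE.
  rewrite sumr_const card_Sn -[X in _ * X]mulr_natl mulrA mulVf ?mul1r // pnatr_eq0 -lt0n fact_gt0.
rewrite sum_ffun_msum msum_cat natrM invfM.
under [in RHS]eq_msum => t _.
  rewrite mulrCA -msumZ.
  over.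
rewrite msumZ mulrA (mulrC l`!%:R^-1); congr (_ * _).
transitivity (msum e k (fun s => msum e l (fun t =>
    b (vec t) * (a (vec s) * F (vec (s ++ t)))))).
  apply: eq_msum => s sk; apply: eq_msum => t tl.
  rewrite /H mulrCA mulrA; congr (_ * _ * _); congr altfun; apply/funext => i.
    by rewrite /vec nth_cat /= sk ltn_ord.
  by rewrite /vec nth_cat /= sk ltnNge leq_addr /= addKn.
exact: exchange_msum.
Qed.

(** The form in which [ipform_wedge] is used: the Hodge dual of a wedge product is
    obtained by contracting the Hodge dual of one factor with the other one. *)
Lemma hodge_wedge k l m (a : altform V k) (b : altform V l)
    (vol : altform V (k + l + m)) x : size x = m ->
  hodge ip vol (wedge a b) (vec x) =
  l`!%:R^-1 * msum e l (fun t => b (vec t) *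
    (k`!%:R^-1 * msum e k (fun s => a (vec s) * vol (vec (s ++ t ++ x))))).
Proof.
move=> xm; rewrite hodgeE //.
have -> : msum e (k + l) (fun s => wedge a b (vec s) * vol (vec (s ++ x))) =
   msum e (k + l) (fun s => wedge a b (vec s) * rcontract (vec x) vol (vec s)).
  by apply: eq_msum => s skl /=; rewrite catf_vec.
rewrite ipform_wedge; congr (_ * _); apply: eq_msum => t tl.
congr (_ * (_ * _)); apply: eq_msum => s sk /=.
by rewrite catf_vec ?size_cat ?sk ?tl // catA.
Qed.

Lemma eq_on_basis k (a b : altform V k) :
  (forall I : {ffun 'I_k -> 'I_n}, a (e \o I) = b (e \o I)) -> a = b.
Proof.
move=> ab; apply/eqP; rewrite -subr_eq0; apply/eqP.
have {ab} : forall I : {ffun 'I_k -> 'I_n}, (a - b) (e \o I) = 0.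
  by move=> I; rewrite altformB ab subrr.
move: (a - b) => {b}{}a.
elim: k a => [|k IH] a a0.
  apply: altform_inj => v; rewrite altform0 -(a0 (ffun0 (card_ord 0))).
  by congr altfun; apply/funext => -[].
have aS i : into a (e i) = 0.
  apply: IH => I; rewrite interiorE -(a0 [ffun j => oapp I i (unlift ord0 j)]).
  congr altfun; rewrite [RHS]fcons_eta; congr fcons; rewrite /= ?ffunE ?unlift_none //.
  by apply/funext => j /=; rewrite ffunE liftK.
apply: altform_inj => v; rewrite [v]fcons_eta -interiorE -[interior_prod _ _]/(into a _).
rewrite [v 0](eP.2) linear_sum big1 // => i _.
by rewrite linearZ /= aS scaler0.
Qed.

(** A multi-index with a repetition contributes 0, the others can be sorted. *)
Lemma eq_on_sorted k (a b : altform V k) :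
  (forall t : k.-tuple 'I_n, sorted ltn (map val t) ->
    a (vec (map e t)) = b (vec (map e t))) -> a = b.
Proof.
move=> ab; apply/eqP; rewrite -subr_eq0; apply/eqP.
have {ab} : forall t : k.-tuple 'I_n, sorted ltn (map val t) ->
    (a - b) (vec (map e t)) = 0.
  by move=> t st; rewrite altformB ab // subrr.
move: (a - b) => {b}{}a a0.
apply: eq_on_basis => I; rewrite altform0.
have [Iinj|] := boolP (injectiveb I); last first.
  case/injectivePn => i [j ij Iij].
  by apply: (altform_alt _ ij); rewrite /= Iij.
pose t := [tuple I i | i < k].
have leI : total (fun i j : 'I_n => (i <= j)%N) by move=> i j; exact: leq_total.
pose t' := sort (fun i j : 'I_n => (i <= j)%N) t.
have t'P : perm_eq t' t by rewrite perm_sort.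
have t'k : size t' == k by rewrite size_sort size_tuple.
have /tuple_permP[s sE] : perm_eq (Tuple t'k) t by [].
have tuniq : uniq t by rewrite map_inj_uniq ?enum_uniq //; exact/injectiveP.
have t's : sorted ltn (map val (Tuple t'k)).
  rewrite ltn_sorted_uniq_leq map_inj_uniq; last exact: val_inj.
  by rewrite (perm_uniq t'P) tuniq /= sorted_map; apply: sort_sorted.
have := a0 _ t's.
have -> : vec (map e (Tuple t'k)) = fun i => (e \o I) (s i).
  apply/funext => i; rewrite /vec (nth_map (I i)) ?size_tuple //.
  by rewrite sE nth_mktuple tnth_mktuple.
by rewrite altform_perm => /eqP; rewrite mulf_eq0 signr_eq0 /= => /eqP.
Qed.

(** A form is determined by its values on increasing tuples of basis vectors. *)
Lemma dim_altform_le k : (\dim {:altform V k} <= 'C(n, k))%N.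
Proof.
pose T := {t : k.-tuple 'I_n | sorted ltn (map val t)}.
pose ev (a : altform V k) : {ffun T -> R^o} := 
    [ffun t : T => a (vec (map e (tval (val t))))].
have ev_lin : linear ev.
  by move=> c a b; apply/ffunP => t; rewrite !ffunE.
pose evl : {linear altform V k -> {ffun T -> R^o}} :=
  HB.pack ev (GRing.isLinear.Build R _ _ _ _ ev_lin).
have dimT : \dim {:{ffun T -> R^o}} = 'C(n, k).
  rewrite dimvf /dim /= muln1 card_sig -card_ltn_sorted_tuples.
  by apply: eq_card => t; rewrite !inE.
rewrite -dimT; apply: (@dim_le_inj _ _ _ _ evl) => a _ /ffunP a0.
apply: eq_on_sorted => t st.
by have := a0 (exist _ t st : T); rewrite !ffunE.
Qed.

End Basis.

Lemma ipformC k (a b : altform V k) : ipform ip a b = ipform ip b a.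
Proof. by congr (_ * _); apply: eq_bigr => I _; rewrite mulrC. Qed.

Lemma ipform_eq0 k (a : altform V k) : ipform ip a a = 0 -> a = 0.
Proof.
move/eqP; rewrite mulf_eq0 invr_eq0 pnatr_eq0 gtn_eqF ?fact_gt0 //=.
rewrite psumr_eq0 => [/allP a0|I _]; last by rewrite -expr2 sqr_ge0.
apply: (eq_on_basis onb_onbasis) => I; rewrite altform0.
by have /implyP/(_ isT) := a0 I (mem_index_enum I); rewrite mulf_eq0 orbb => /eqP.
Qed.

Lemma ipformPl k c (a a' b : altform V k) :
  ipform ip (c *: a + a') b = c * ipform ip a b + ipform ip a' b.
Proof.
rewrite /ipform mulrCA -mulrDr; congr (_ * _); rewrite mulr_sumr -big_split.
by apply: eq_bigr => I _; rewrite altformD altformZ /=; ring.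
Qed.

Lemma ipform0l k (b : altform V k) : ipform ip 0 b = 0.
Proof. by rewrite /ipform big1 ?mulr0 // => I _; rewrite altform0 mul0r. Qed.

Lemma ipformZl k c (a b : altform V k) : ipform ip (c *: a) b = c * ipform ip a b.
Proof. by rewrite -[c *: a]addr0 ipformPl ipform0l addr0. Qed.

Lemma ipformDl k (a a' b : altform V k) :
  ipform ip (a + a') b = ipform ip a b + ipform ip a' b.
Proof. by rewrite -[a in LHS]scale1r ipformPl mul1r. Qed.

End Euclidean.
Arguments rcontract {R V k l}.

(** * Cross products and special frames *)

Section CrossProduct.
Variables (R : realType) (V : vectType R).
Variables (ip : {dot V for idfun}) (cross : {bilinear V -> V -> V}).
Hypothesis crossP : cross_product ip cross.
Local Notation "<< u , v >>" := (ip u v) (at level 0, u, v at level 99).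
Local Notation "u ** v" := (cross u v) (at level 40, left associativity).

Lemma ipDl u v w : <<u + v, w>> = <<u, w>> + <<v, w>>.
Proof. exact: linearDl. Qed.
Lemma ipDr u v w : <<w, u + v>> = <<w, u>> + <<w, v>>.
Proof. exact: linearDr. Qed.
Lemma ipNl u w : <<- u, w>> = - <<u, w>>.
Proof. exact: linearNl. Qed.
Lemma ipNr u w : <<w, - u>> = - <<w, u>>.
Proof. exact: linearNr. Qed.
Lemma ipBl u v w : <<u - v, w>> = <<u, w>> - <<v, w>>.
Proof. exact: linearBl. Qed.
Lemma ipBr u v w : <<w, u - v>> = <<w, u>> - <<w, v>>.
Proof. exact: linearBr. Qed.
Lemma ipZl c u w : <<c *: u, w>> = c * <<u, w>>.
Proof. exact: linearZl_LR. Qed.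
Lemma ipZr c u w : <<w, c *: u>> = c * <<w, u>>.
Proof. exact: linearZr_LR. Qed.
Lemma ip0l w : <<0, w>> = 0.
Proof. exact: linear0l. Qed.
Lemma ip0r w : <<w, 0>> = 0.
Proof. exact: linear0r. Qed.
Lemma ip_suml n (F : 'I_n -> V) w : <<\sum_i F i, w>> = \sum_i <<F i, w>>.
Proof. exact: linear_sumlz. Qed.
Definition ipE := (ipDl, ipDr, ipNl, ipNr, ipBl, ipBr, ipZl, ipZr, ip0l, ip0r).

Lemma ip_nondeg u v : (forall w, <<u, w>> = <<v, w>>) -> u = v.
Proof.
move=> uv; apply/eqP; rewrite -subr_eq0; apply/eqP/(@ip_eq0 _ _ ip).
by rewrite ipBl uv subrr.
Qed.

Lemma crossDl u v w : (u + v) ** w = u ** w + v ** w.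
Proof. exact: linearDl. Qed.
Lemma crossDr u v w : w ** (u + v) = w ** u + w ** v.
Proof. exact: linearDr. Qed.
Lemma crossNl u w : (- u) ** w = - (u ** w).
Proof. exact: linearNl. Qed.
Lemma crossNr u w : w ** (- u) = - (w ** u).
Proof. exact: linearNr. Qed.
Lemma crossZl c u w : (c *: u) ** w = c *: (u ** w).
Proof. exact: linearZl_LR. Qed.
Lemma crossZr c u w : w ** (c *: u) = c *: (w ** u).
Proof. exact: linearZr_LR. Qed.
Definition crossE := (crossDl, crossDr, crossNl, crossNr, crossZl, crossZr).

Lemma crossC u v : u ** v = - (v ** u).
Proof. by case: crossP. Qed.

Lemma crossvv u : u ** u = 0.
Proof.
have /eqP := crossC u u; rewrite -subr_eq0 opprK -mulr2n -scaler_nat.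
by rewrite scaler_eq0 pnatr_eq0 => /eqP.
Qed.

Lemma ip_crossl u v : <<u ** v, u>> = 0. Proof. by case: crossP. Qed.
Lemma ip_crossr u v : <<u ** v, v>> = 0. Proof. by case: crossP. Qed.

Lemma triple_swap u v w : <<u ** v, w>> = - <<u ** w, v>>.
Proof.
have := ip_crossr u (v + w); rewrite !crossE !ipE !ip_crossr add0r addr0.
by move/eqP; rewrite addr_eq0 => /eqP.
Qed.

Lemma triple_rot u v w : <<u ** v, w>> = <<v ** w, u>>.
Proof. by rewrite (triple_swap v w) (crossC v u) ipNl opprK. Qed.

Lemma cross_norm u v w :
  <<u ** v, u ** w>> = <<u, u>> * <<v, w>> - <<u, v>> * <<u, w>>.
Proof.
case: crossP => _ _ _ N.
have := N u (v + w); rewrite !crossE !ipE !N (ipC _ w v) (ipC _ (u ** w)) => H; lra.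
Qed.

Lemma cross_cross u v : u ** (u ** v) = <<u, v>> *: u - <<u, u>> *: v.
Proof.
apply: ip_nondeg => w; rewrite triple_swap cross_norm !ipE (ipC _ w v).
by rewrite opprB mulrC.
Qed.

(** Polarization of [cross_cross] in its first argument. *)
Lemma cross_cross_polar u v w :
  u ** (v ** w) = <<u, w>> *: v + <<v, w>> *: u - (2 * <<u, v>>) *: w - v ** (u ** w).
Proof.
have := cross_cross (u + v) w; rewrite !crossE !ipE !cross_cross (ipC _ v u) => H.
apply: ip_nondeg => x; have := congr1 (ip^~ x) H; rewrite /= !ipE => {}H; lra.
Qed.

(** The triples that generate the cross product algebra: u, v, u x v is a
    quaternionic triple and w is a direction for Cayley-Dickson doubling. *)
Definition special u v w :=
  [/\ <<u, u>> = 1, <<v, v>> = 1, <<w, w>> = 1 &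
   [/\ <<u, v>> = 0, <<u, w>> = 0, <<v, w>> = 0 & <<u ** v, w>> = 0]].

Section Special.
Variables (u v w : V) (S : special u v w).

Lemma special_swap : special v u w.
Proof.
case: S => uu vv ww [uv uw vw uvw]; split=> //; split=> //; first by rewrite ipC.
by rewrite crossC ipNl uvw oppr0.
Qed.

Lemma cross_cyc : v ** (u ** v) = u.
Proof.
case: S => uu vv ww [uv uw vw uvw].
by rewrite (crossC u) crossNr cross_cross vv (ipC _ v) uv scale0r sub0r scale1r opprK.
Qed.

Lemma special_rot : special v (u ** v) w.
Proof.
case: S => uu vv ww [uv uw vw uvw]; split=> //.
  by rewrite cross_norm uu vv uv mul1r mul0r subr0.
split=> //; first by rewrite ipC ip_crossr.
by rewrite cross_cyc.
Qed.

Lemma special_cross_cross : u ** (u ** w) = - w.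
Proof.
case: S => uu vv ww [uv uw vw uvw].
by rewrite cross_cross uu uw scale0r sub0r scale1r.
Qed.

Lemma special_crossr : w ** (u ** w) = u.
Proof.
case: S => uu vv ww [uv uw vw uvw].
rewrite (crossC u) crossNr cross_cross ww (ipC _ w) uw.
by rewrite scale0r sub0r scale1r opprK.
Qed.

(** For a special triple the cross product is anti-associative, as octonions are. *)
Lemma special_cross_assoc : u ** (v ** w) = - (u ** v ** w).
Proof.
case: S => uu vv ww [uv uw vw uvw].
rewrite (crossC v w) crossNr cross_cross_polar uv uw (ipC _ w v) vw mulr0 !scale0r.
by rewrite !add0r !oppr0 sub0r opprK (crossC w).
Qed.

Lemma special_cross_prod : (u ** w) ** (v ** w) = - (u ** v).
Proof.
case: S => uu vv ww [uv uw vw uvw].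
rewrite (crossC v w) crossNr cross_cross_polar ip_crossr (ipC _ w v) vw.
rewrite triple_swap uvw oppr0 mulr0 !scale0r !add0r oppr0 sub0r opprK.
rewrite (crossC (u ** w)) crossNr.
have := special_swap => S'.
have -> : v ** (u ** w) = u ** v ** w.
  rewrite cross_cross_polar uw (ipC _ v u) uv vw mulr0 !scale0r !add0r oppr0 sub0r.
  by rewrite special_cross_assoc opprK.
rewrite (crossC _ w) crossNr opprK cross_cross ww ipC uvw.
by rewrite scale0r sub0r scale1r.
Qed.

End Special.

(** The signs are chosen such that the structure constants are those of the
    standard form on seven-dimensional space. *)
Definition special_frame u v w (i : 'I_7) : V :=
  [:: u; v; u ** v; w; - (u ** w); - (v ** w); - (u ** v ** w)]`_i.

(** Cross multiplication by w is an isometry on the span of u, v, u x v, which is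
    orthogonal to its image. *)
Lemma special_orthonormal u v w : special u v w ->
  orthonormal_family ip (special_frame u v w).
Proof.
move=> S; case: (S) => uu vv ww [uv uw vw uvw].
have S2 := special_rot S; case: (S2) => _ pp _ [vp _ _ _].
have S3 := special_rot S2; case: (S3) => _ _ _ [pu _ _ _].
rewrite (cross_cyc S) in pu.
have n1 : <<u ** w, u ** w>> = 1 by rewrite cross_norm uu ww uw mul0r subr0 mul1r.
have n2 : <<v ** w, v ** w>> = 1 by rewrite cross_norm vv ww vw mul0r subr0 mul1r.
have n3 : <<u ** v ** w, u ** v ** w>> = 1.
  by rewrite cross_norm pp ww uvw mul0r subr0 mul1r.
have cc x y : <<x, y>> = 0 -> <<x, w>> = 0 -> <<x ** w, y ** w>> = 0.
  move=> xy xw; rewrite (crossC x) (crossC y) !ipE opprK cross_norm xy (ipC _ w) xw.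
  by rewrite mulr0 mul0r subr0.
have c12 := cc u v uv uw; have c13 := cc u (u ** v) (etrans (ipC _ _ _) pu) uw.
have c23 := cc v (u ** v) vp vw.
have t x y : <<x ** w, y>> = <<y ** x, w>> by rewrite -triple_rot.
have o11 : <<u ** w, u>> = 0 by rewrite ip_crossl.
have o12 : <<u ** w, v>> = 0 by rewrite t crossC ipNl uvw oppr0.
have o13 : <<u ** w, u ** v>> = 0.
  by rewrite t crossC (crossC u v) crossNr opprK (cross_cyc (special_swap S)) vw.
have o21 : <<v ** w, u>> = 0 by rewrite t uvw.
have o22 : <<v ** w, v>> = 0 by rewrite ip_crossl.
have o23 : <<v ** w, u ** v>> = 0 by rewrite t crossC ipNl (cross_cyc S) uw oppr0.
have o31 : <<u ** v ** w, u>> = 0.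
  by rewrite t (crossC u v) crossNr ipNl (cross_cyc (special_swap S)) vw oppr0.
have o32 : <<u ** v ** w, v>> = 0 by rewrite t (cross_cyc S).
have o33 : <<u ** v ** w, u ** v>> = 0 by rewrite ip_crossl.
have r1 : <<u ** w, w>> = 0 by rewrite ip_crossr.
have r2 : <<v ** w, w>> = 0 by rewrite ip_crossr.
have r3 : <<u ** v ** w, w>> = 0 by rewrite ip_crossr.
pose facts := (uu, vv, ww, uv, uw, vw, uvw, pp, vp, pu, n1, n2, n3, c12, c13, c23,
  o11, o12, o13, o21, o22, o23, o31, o32, o33, r1, r2, r3).
suff H : forall i j : 'I_7, (i <= j)%N -> <<special_frame u v w i, special_frame u v w j>> = (i == j)%:R.
  move=> i j; case: (leqP i j) => [|/ltnW] ij; first exact: H.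
  by rewrite ipC H // eq_sym.
move=> i j; case: i => -[|[|[|[|[|[|[|//]]]]]]] lti; case: j => -[|[|[|[|[|[|[|//]]]]]]] ltj //= _;
  rewrite /special_frame /= ?ipNl ?ipNr ?opprK ?facts ?oppr0 //;
  by rewrite ipC ?facts ?oppr0.
Qed.

(** The entry +k or -k stands for plus or minus the k-th vector of the frame,
    counted from 1, and 0 for the zero vector. *)
Definition cross_table : seq (seq Z) :=
  [:: [:: 0; 3; -2; -5; 4; -7; 6];
      [:: -3; 0; 1; -6; 7; 4; -5];
      [:: 2; -1; 0; -7; -6; 5; 4];
      [:: 5; 6; 7; 0; -1; -2; -3];
      [:: -4; -7; 6; 1; 0; -3; 2];
      [:: 7; -4; -5; 2; 3; 0; -1];
      [:: -6; 5; -4; 3; -2; 1; 0]]%BZ.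

Definition table_entry (i j : nat) : Z := nth 0%BZ (nth [::] cross_table i) j.

(** The value of phi on three vectors of a special frame. *)
Definition structZ (i j k : nat) : Z :=
  match table_entry i j with
  | Z0 => 0%BZ
  | Zpos p => if (Pos.to_nat p).-1 == k then 1%BZ else 0%BZ
  | Zneg p => if (Pos.to_nat p).-1 == k then (-1)%BZ else 0%BZ
  end.

(** Identities between values of forms on a frame are checked in binary integers
    and transported to the reals. *)
Definition zr (z : Z) : R := (int_of_Z z)%:~R.

(** All products follow from [special_cross_cross], [special_crossr],
    [special_cross_assoc] and [special_cross_prod] applied to the three
    special triples (u, v, w), (v, u x v, w) and (u x v, u, w). *)
Lemma frame_cross u v w : special u v w -> forall i j,
  special_frame u v w i ** special_frame u v w j =
  match table_entry i j with
  | Z0 => 0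
  | Zpos p => special_frame u v w (inord (Pos.to_nat p).-1)
  | Zneg p => - special_frame u v w (inord (Pos.to_nat p).-1)
  end.
Proof.
move=> S.
have S2 := special_rot S; have S3 := special_rot S2; rewrite (cross_cyc S) in S3.
have a1 := cross_cyc S; have a2 := cross_cyc S2; rewrite a1 in a2.
have b1 : v ** u = - (u ** v) by rewrite crossC.
have b2 : u ** v ** v = - u by rewrite crossC a1.
have b3 : u ** (u ** v) = - v by rewrite crossC a2.
have c1 := special_cross_cross S; have c2 := special_cross_cross S2.
have c3 := special_cross_cross S3.
have d1 := special_crossr S; have d2 := special_crossr S2; have d3 := special_crossr S3.
have e1 : u ** w ** w = - u by rewrite crossC d1.
have e2 : v ** w ** w = - v by rewrite crossC d2.
have e3 : u ** v ** w ** w = - (u ** v) by rewrite crossC d3.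
have f1 : w ** u = - (u ** w) by rewrite crossC.
have f2 : w ** v = - (v ** w) by rewrite crossC.
have f3 : w ** (u ** v) = - (u ** v ** w) by rewrite crossC.
have g1 := special_cross_assoc S; have g2 := special_cross_assoc S2.
have g3 := special_cross_assoc S3; rewrite a1 in g2; rewrite a2 in g3.
have h1 : v ** (u ** w) = u ** v ** w.
  by rewrite (special_cross_assoc (special_swap S)) b1 crossNl opprK.
have h2 : u ** v ** (v ** w) = u ** w.
  by rewrite (special_cross_assoc (special_swap S2)) b2 crossNl opprK.
have h3 : u ** (u ** v ** w) = v ** w.
  by rewrite (special_cross_assoc (special_swap S3)) b3 crossNl opprK.
have k1 := special_cross_prod S; have k2 := special_cross_prod S2.
have k3 := special_cross_prod S3; rewrite a1 in k2; rewrite a2 in k3.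
have l1 : v ** w ** (u ** w) = u ** v by rewrite crossC k1 opprK.
have l2 : u ** v ** w ** (v ** w) = u by rewrite crossC k2 opprK.
have l3 : u ** w ** (u ** v ** w) = v by rewrite crossC k3 opprK.
have m1 : u ** w ** u = w by rewrite crossC c1 opprK.
have m2 : v ** w ** v = w by rewrite crossC c2 opprK.
have m3 : u ** v ** w ** (u ** v) = w by rewrite crossC c3 opprK.
have n1 : v ** w ** u = u ** v ** w by rewrite crossC g1 opprK.
have n2 : u ** v ** w ** v = u ** w by rewrite crossC g2 opprK.
have n3 : u ** w ** (u ** v) = v ** w by rewrite crossC g3 opprK.
have o1 : u ** w ** v = - (u ** v ** w) by rewrite crossC h1.
have o2 : v ** w ** (u ** v) = - (u ** w) by rewrite crossC h2.
have o3 : u ** v ** w ** u = - (v ** w) by rewrite crossC h3.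
pose facts := (crossvv, a1, a2, b1, b2, b3, c1, c2, c3, d1, d2, d3, e1, e2, e3,
  (f1, f2, f3, g1, g2, g3, h1, h2, h3), (k1, k2, k3, l1, l2, l3),
  (m1, m2, m3, n1, n2, n3, o1, o2, o3)).
case=> -[|[|[|[|[|[|[|//]]]]]]] lti; case=> -[|[|[|[|[|[|[|//]]]]]]] ltj;
  rewrite /special_frame /table_entry /= ?inordK //= ?crossNl ?crossNr ?opprK ?facts
    ?opprK ?oppr0 //.
Qed.

Lemma frame_phi u v w : special u v w -> forall i j k,
  <<special_frame u v w i ** special_frame u v w j, special_frame u v w k>> = zr (structZ i j k).
Proof.
move=> S i j k; rewrite (frame_cross S) /structZ.
have tabP : all (all (fun z => (Z.abs_nat z).-1 < 7)%N) cross_table.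
  by [].
have : ((Z.abs_nat (table_entry i j)).-1 < 7)%N.
  have /allP := allP tabP _ (mem_nth [::] (ltn_ord i : i < size cross_table)%N).
  apply; apply: mem_nth; move: i j => {k}.
  by case=> -[|[|[|[|[|[|[|//]]]]]]] lti; case=> j ltj.
case: (table_entry i j) => [|p|p] lt7.
- by rewrite ip0l.
- rewrite (special_orthonormal S) -val_eqE /= (inordK lt7).
  by case: (_ == _).
- rewrite ipNl (special_orthonormal S) -val_eqE /= (inordK lt7).
  by case: (_ == _); rewrite ?oppr0.
Qed.

End CrossProduct.

(** * Values of the volume form as integers *)

Section Vandermonde.
Variable R : realType.

Lemma zrM x y : zr R (x * y)%BZ = zr R x * zr R y.
Proof. by rewrite /zr -intrM -(rmorphM int_of_Z). Qed.
Lemma zrD x y : zr R (x + y)%BZ = zr R x + zr R y.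
Proof. by rewrite /zr -intrD -(rmorphD int_of_Z). Qed.
Lemma zrB x y : zr R (x - y)%BZ = zr R x - zr R y.
Proof. by rewrite /zr -intrB -(rmorphB int_of_Z). Qed.
Lemma zr_nat n : zr R (Z.of_nat n) = n%:R.
Proof. by rewrite /zr; case: n => //= n; rewrite SuccNat2Pos.id_succ. Qed.

(** The Vandermonde product of the list, in recursive form: a product of
    differences detects repetitions and the sign of a permutation at once. *)
Fixpoint vdm (s : seq R) : R :=
  if s is x :: s' then foldr (fun y p => (y - x) * p) (vdm s') s' else 1.

Fixpoint vdmZ (s : seq nat) : Z :=
  if s is x :: s' then
    foldr (fun y p => (Z.of_nat y - Z.of_nat x) * p)%BZ (vdmZ s') s' else 1%BZ.

Lemma zr_vdmZ s : zr R (vdmZ s) = vdm [seq n%:R | n <- s].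
Proof.
elim: s => [|x s IH] //=; rewrite -IH; elim: {IH}s (vdmZ s) => //= y s IH z.
by rewrite zrM zrB !zr_nat IH.
Qed.

Lemma prod_vdm (s : seq R) :
  \prod_(i < size s) \prod_(j < size s | (i < j)%N) (s`_j - s`_i) = vdm s.
Proof.
elim: s => [|x s IH]; first by rewrite big_ord0.
rewrite big_ord_recl /= big_mkcond big_ord_recl /= mul1r.
under [X in _ * X]eq_bigr => i _.
  rewrite big_mkcond big_ord_recl /= mul1r -big_mkcond /=.
  over.
rewrite IH; elim: {IH}s (vdm s) => [|y s IH] z /=; first by rewrite big_ord0 mul1r.
by rewrite big_ord_recl /= -mulrA IH.
Qed.

(** Comparing two Vandermonde determinants gives the sign of an index map, or 0
    when it repeats an index, as a quotient of integers. This makes values of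
    the volume form computable. *)
Lemma det_indicator n (I : 'I_n -> 'I_n) :
  \det (\matrix_(i, j) (I i == j)%:R : 'M[R]_n) * vdm [seq i%:R | i <- iota 0 n] =
  vdm [seq (nat_of_ord (I i))%:R | i <- enum 'I_n].
Proof.
have V (a : 'I_n -> 'I_n) : vdm [seq (nat_of_ord (a i))%:R | i <- enum 'I_n] =
    \det (Vandermonde n (\row_i (nat_of_ord (a i))%:R)) :> R.
  rewrite det_Vandermonde -prod_vdm size_map size_enum_ord.
  apply: eq_bigr => i _; apply: eq_bigr => j _.
  rewrite !mxE !(nth_map i) -?enumT ?size_enum_ord //.
  by rewrite !nth_ord_enum.
rewrite V (_ : [seq i%:R | i <- iota 0 n] =
    [seq (nat_of_ord (id i))%:R | i <- enum 'I_n]); last first.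
  by rewrite -val_enum_ord -map_comp.
rewrite (V id) -[\det (Vandermonde n (\row_i (id i)%:R))]det_tr -det_mulmx -[RHS]det_tr.
congr (\det _); apply/matrixP => i k; rewrite !mxE.
rewrite (bigD1 (I i)) //= big1 => [|j jI]; rewrite !mxE; last first.
  by rewrite eq_sym (negPf jI) mul0r.
by rewrite eqxx mul1r addr0.
Qed.

End Vandermonde.

Fixpoint zsum k (H : seq nat -> Z) : Z :=
  if k is k'.+1 then
    foldr (fun i z => zsum k' (fun s => H (i :: s)) + z)%BZ 0%BZ (iota 0 7)
  else H [::].

Definition structZ3 (s : seq nat) : Z :=
  structZ (nth 0%N s 0) (nth 0%N s 1) (nth 0%N s 2).

Definition deltaZ (i j : nat) : Z := if i == j then 1%BZ else 0%BZ.

(** The inner product of two products of basis vectors is 1, -1 or 0 according to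
    their table entries. *)
Definition psiZ (s : seq nat) : Z :=
  let i := nth 0%N s 0 in let j := nth 0%N s 1 in
  let k := nth 0%N s 2 in let l := nth 0%N s 3 in
  let x := table_entry i j in let y := table_entry k l in
  ((if Z.eqb x y then Z.abs (Z.sgn x) else if Z.eqb x (- y) then - 1 else 0)
   - deltaZ i k * deltaZ j l + deltaZ i l * deltaZ j k)%BZ.

(** The second factor is a function of the unit type, so that it is not evaluated
    when the first one vanishes; most structure constants do. *)
Definition mulZ (x : Z) (y : unit -> Z) : Z := if x is Z0 then 0%BZ else (x * y tt)%BZ.

(** Quantification over increasing multi-indices, which are enough for alternating
    forms. *)
Fixpoint all_idx k m (P : seq nat -> bool) : bool :=
  if k is k'.+1 then
    all (fun i => all_idx k' i.+1 (fun s => P (i :: s))) (iota m (7 - m))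
  else P [::].

Definition volC : Z := vdmZ (iota 0 7).

(** The coefficients of star phi = psi, multiplied by 3! and by the Vandermonde
    product of 0, ..., 6. *)
Lemma check_psi : all_idx 4 0 (fun q => Z.eqb
  (zsum 3 (fun t => mulZ (structZ3 t) (fun=> vdmZ (t ++ q)))) (6 * (volC * psiZ q)))%BZ.
Proof. by vm_compute. Qed.

(** As [check_psi], with phi contracted with the last arguments of the volume
    form. *)
Lemma check_psi_left : all_idx 4 0 (fun q => Z.eqb
  (zsum 3 (fun t => mulZ (structZ3 t) (fun=> vdmZ (q ++ t)))) (6 * (volC * psiZ q)))%BZ.
Proof. by vm_compute. Qed.

(** The coefficients of star psi = phi, multiplied by 4! and by the Vandermonde
    product of 0, ..., 6. *)
Lemma check_phi : all_idx 3 0 (fun q => Z.eqb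
  (zsum 4 (fun t => mulZ (psiZ t) (fun=> vdmZ (t ++ q)))) (24 * (volC * structZ3 q)))%BZ.
Proof. by vm_compute. Qed.

Lemma all_idxP k P : all_idx k 0 P ->
  forall s, size s = k -> sorted ltn s -> all (gtn 7) s -> P s.
Proof.
have H m Q : all_idx k m Q -> forall s, size s = k -> sorted ltn s -> all (leq m) s ->
    all (gtn 7) s -> Q s.
  elim: k m Q => [|k IH] m Q; first by move=> Q0 [].
  rewrite /= => /allP HQ [|i s] //= [sk] ss /andP[mi ms] /andP[i7 s7].
  apply: (IH i.+1 (fun s => Q (i :: s))) => //.
  - apply: HQ; rewrite mem_iota mi /= subnKC //; exact: leq_trans mi (ltnW i7).
  - exact: path_sorted ss.
  - exact: order_path_min ltn_trans ss.
by move=> P0 s sk ss s7; apply: (H 0%N P) => //; apply/allP.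
Qed.

(** * The two calibrations in a special frame *)

Section Volume.
Variables (R : realType) (V : vectType R).
Variables (ip : {dot V for idfun}) (cross : {bilinear V -> V -> V}).
Hypothesis crossP : cross_product ip cross.
Local Notation "<< u , v >>" := (ip u v) (at level 0, u, v at level 99).
Local Notation "u ** v" := (cross u v) (at level 40, left associativity).
Local Notation phi := (assoc_form crossP).

Lemma phiE u v w : phi (vec [:: u; v; w]) = <<u ** v, w>>.
Proof. by []. Qed.

(** An explicit formula for the coassociative calibration, from which its values
    are computed; [star_phi] identifies it with the Hodge dual of phi. *)
Definition psi_value u v x y : R := <<u ** v, x ** y>> - <<u, x>> * <<v, y>> + <<u, y>> * <<v, x>>.

Lemma psif_P1 c u u' v x y : psi_value (c *: u + u') v x y = c * psi_value u v x y + psi_value u' v x y.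
Proof. by rewrite /psi_value !(crossE, ipE); ring. Qed.
Lemma psif_P2 c u v v' x y : psi_value u (c *: v + v') x y = c * psi_value u v x y + psi_value u v' x y.
Proof. by rewrite /psi_value !(crossE, ipE); ring. Qed.
Lemma psif_P3 c u v x x' y : psi_value u v (c *: x + x') y = c * psi_value u v x y + psi_value u v x' y.
Proof. by rewrite /psi_value !(crossE, ipE); ring. Qed.
Lemma psif_P4 c u v x y y' : psi_value u v x (c *: y + y') = c * psi_value u v x y + psi_value u v x y'.
Proof. by rewrite /psi_value !(crossE, ipE); ring. Qed.

Lemma psif_swap12 u v x y : psi_value v u x y = - psi_value u v x y.
Proof. by rewrite /psi_value (crossC crossP v) !ipE; ring. Qed.

Lemma psif_swap34 u v x y : psi_value u v y x = - psi_value u v x y.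
Proof. by rewrite /psi_value (crossC crossP y) !ipE; ring. Qed.

Lemma psif_pair u v x y : psi_value x y u v = psi_value u v x y.
Proof.
rewrite /psi_value (ipC _ (x ** y)) (ipC _ x u) (ipC _ y v) (ipC _ x v) (ipC _ y u).
by ring.
Qed.

(** This is the norm axiom of the cross product, and it is what makes psi
    alternating: the symmetries within and between the two pairs of arguments
    are formal. *)
Lemma psif_norm u v y : psi_value u v u y = 0.
Proof. by rewrite /psi_value (cross_norm crossP) (ipC _ v u); ring. Qed.

Lemma psif_swap13 u v x y : psi_value x v u y = - psi_value u v x y.
Proof.
have := psif_norm (u + x) v y; rewrite -{1 2}[u]scale1r psif_P1 !psif_P3 !psif_norm.
by rewrite mul1r mulr0 add0r addr0 mul1r => /eqP; rewrite addrC addr_eq0 => /eqP.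
Qed.

Lemma psif_swap23 u v x y : psi_value u x v y = - psi_value u v x y.
Proof. by rewrite psif_swap12 psif_swap13 psif_swap12 opprK. Qed.

Lemma psif_rot u v x y : psi_value v x y u = - psi_value u v x y.
Proof. by rewrite psif_swap34 psif_swap23 psif_swap12 opprK. Qed.

Lemma psif_diag u x y : psi_value u u x y = 0.
Proof. by rewrite /psi_value (crossvv crossP) ip0l; ring. Qed.

Fact psi_subproof : (fun v : 'I_4 -> V =>
    psi_value (v (Ordinal (isT : 0 < 4)%N)) (v (Ordinal (isT : 1 < 4)%N))
         (v (Ordinal (isT : 2 < 4)%N)) (v (Ordinal (isT : 3 < 4)%N)) : R^o)
  \in @alternating_pred R V 4.
Proof.
have p14 u v x : psi_value u v x u = 0 by rewrite psif_swap34 psif_norm oppr0.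
have p23 u v y : psi_value u v v y = 0 by rewrite psif_swap12 psif_norm oppr0.
have p24 u v x : psi_value u v x v = 0 by rewrite psif_swap12 p14 oppr0.
have p34 u v x : psi_value u v x x = 0 by rewrite psif_pair psif_diag.
apply/asboolP; split=> [v i a x y|v i j].
  case: i => -[|[|[|[|//]]]] lti /=.
  - exact: psif_P1.
  - exact: psif_P2.
  - exact: psif_P3.
  - exact: psif_P4.
case: i => -[|[|[|[|//]]]] lti; case: j => -[|[|[|[|//]]]] ltj //= _;
  rewrite !(bool_irrelevance lti isT) !(bool_irrelevance ltj isT) => E;
  by rewrite E (psif_diag, psif_norm, p14, p23, p24, p34).
Qed.

Definition psi_form : altform V 4 := AltForm psi_subproof.

Lemma psiE u v x y : psi_form (vec [:: u; v; x; y]) = psi_value u v x y.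
Proof. by []. Qed.

Fact coord_det_subproof n (f : 'I_n -> V) :
  (fun v : 'I_n -> V => \det (\matrix_(i, j) <<v i, f j>>) : R^o)
  \in @alternating_pred R V n.
Proof.
apply/asboolP; split=> [v i a x y|v i j ij vij]; last first.
  by apply: (determinant_alternate ij) => k; rewrite !mxE vij.
rewrite -[X in _ = _ + X]mul1r.
apply: (@determinant_multilinear _ _ _ _ _ i a 1).
- by apply/rowP => k; rewrite !mxE /= eqxx ipDl ipZl mul1r.
- by apply/matrixP => k l; rewrite !mxE /= eq_sym (negPf (neq_lift _ _)).
- by apply/matrixP => k l; rewrite !mxE /= eq_sym (negPf (neq_lift _ _)).
Qed.

(** The wedge product of the linear forms dual to the family. *)
Definition coord_det n (f : 'I_n -> V) : altform V n := AltForm (coord_det_subproof f).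

Section Contractions.
Variables (n : nat) (e : 'I_n -> V) (eP : onbasis ip e).

Lemma sum_ip_ip x y : \sum_i <<x, e i>> * <<e i, y>> = <<x, y>>.
Proof. by rewrite (parseval eP); apply: eq_bigr => i _; rewrite (ipC _ y). Qed.

Lemma sum_ip_e : \sum_i <<e i, e i>> = n%:R.
Proof.
under eq_bigr => i _ do rewrite eP.1 eqxx.
by rewrite sumr_const card_ord.
Qed.

Lemma contract_phi_phi1 a b x y :
  \sum_k <<a ** b, e k>> * <<x ** y, e k>> = <<a ** b, x ** y>>.
Proof. by rewrite -(parseval eP). Qed.

(** The sum over l is, by Parseval, the inner product of two cross products with
    e_k, which the norm axiom evaluates. *)
Lemma contract_phi_phi a x :
  \sum_k \sum_l <<a ** e k, e l>> * <<x ** e k, e l>> = (n%:R - 1) * <<a, x>>.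
Proof.
under eq_bigr => k _.
  rewrite contract_phi_phi1 (crossC crossP a) (crossC crossP x) !ipE opprK.
  rewrite (cross_norm crossP) (ipC _ (e k) a).
  over.
rewrite sumrB -mulr_suml sum_ip_e sum_ip_ip; ring.
Qed.

(** Expanding psi leaves one term for [contract_phi_phi] and two terms with a
    Kronecker symbol; the coefficient is (n - 1) - 2. *)
Lemma contract_phi_psi a b c :
  \sum_k \sum_l <<a ** e k, e l>> * psi_value (e k) (e l) b c = (n%:R - 3) * <<a ** b, c>>.
Proof.
transitivity (\sum_k (\sum_l <<a ** e k, e l>> * <<b ** c ** e k, e l>>
    - <<e k, b>> * (\sum_l <<a ** e k, e l>> * <<e l, c>>)
    + <<e k, c>> * (\sum_l <<a ** e k, e l>> * <<e l, b>>))).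
  apply: eq_bigr => k _; rewrite !mulr_sumr -sumrB -big_split; apply: eq_bigr => l _.
  by rewrite /= /psi_value (ipC _ (e k ** e l)) (triple_rot crossP (b ** c)) (ipC _ _ (b ** c)); ring.
have S x y : \sum_k <<e k, x>> * (\sum_l <<a ** e k, e l>> * <<e l, y>>) = <<a ** x, y>>.
  under eq_bigr => k _ do rewrite sum_ip_ip (triple_swap crossP) mulrN mulrC.
  rewrite sumrN sum_ip_ip (triple_swap crossP) opprK //.
rewrite big_split sumrB /= contract_phi_phi !S (triple_swap crossP a c).
rewrite (ipC _ a) -(triple_rot crossP a); ring.
Qed.

End Contractions.

Section Frame.
Variables (f : 'I_7 -> V) (fP : onbasis ip f).
Hypothesis f_phi : forall i j k, <<f i ** f j, f k>> = zr R (structZ i j k).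
Hypothesis f_cross : forall i j, f i ** f j =
  match table_entry i j with
  | Z0 => 0
  | Zpos p => f (inord (Pos.to_nat p).-1)
  | Zneg p => - f (inord (Pos.to_nat p).-1)
  end.
Let fn (m : nat) : V := f (inord m).

Lemma msum_zsum k (G : seq V -> R) (H : seq nat -> Z) :
  (forall s, size s = k -> all (gtn 7) s -> G (map fn s) = zr R (H s)) ->
  msum f k G = zr R (zsum k H).
Proof.
elim: k G H => [|k IH] G H GH; first exact: (GH [::]).
have step (i : 'I_7) : msum f k (fun s => G (f i :: s)) =
    zr R (zsum k (fun s => H (nat_of_ord i :: s))).
  apply: IH => s sk s7; rewrite -GH /= ?sk ?s7 ?ltn_ord //.
  by rewrite /fn inord_val.
rewrite /= !zrD -[zr R 0]/(0 : R) addr0.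
by rewrite !big_ord_recl big_ord0 addr0 !step.
Qed.

Lemma map_tuple_fn k (t : k.-tuple 'I_7) : map f t = map fn (map val t).
Proof. by rewrite -map_comp; apply: eq_map => i; rewrite /fn /= inord_val. Qed.

Lemma val_tuple_lt k (t : k.-tuple 'I_7) : all (gtn 7) (map val t).
Proof. by rewrite all_map; apply/allP => i _ /=; exact: ltn_ord. Qed.

Lemma fn_phi s : size s = 3%N -> all (gtn 7) s ->
  phi (vec (map fn s)) = zr R (structZ3 s).
Proof.
move: s => [|a [|b [|c []]]] //= _ /and4P[a7 b7 c7 _].
rewrite /structZ3 /= -[in RHS](inordK a7) -[in RHS](inordK b7) -[in RHS](inordK c7).
by rewrite -f_phi.
Qed.

Lemma zr_deltaZ a b : (a < 7)%N -> (b < 7)%N -> <<fn a, fn b>> = zr R (deltaZ a b).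
Proof.
move=> a7 b7; rewrite /fn fP.1 -val_eqE /= !inordK // /deltaZ.
by case: (_ == _).
Qed.

Lemma fn_psi s : size s = 4%N -> all (gtn 7) s ->
  psi_form (vec (map fn s)) = zr R (psiZ s).
Proof.
move: s => [|a [|b [|c [|d []]]]] //= _ /and5P[a7 b7 c7 d7 _].
rewrite -[LHS]/(psi_value (fn a) (fn b) (fn c) (fn d)) /psi_value /psiZ zrD zrB !zrM -!zr_deltaZ //; congr (_ - _ + _).
have entry7 i j : ((Z.abs_nat (table_entry i j)).-1 < 7)%N.
  have tabP : all (all (fun z => (Z.abs_nat z).-1 < 7)%N) cross_table by [].
  rewrite /table_entry; have [lti|] := ltnP i 7; last by move=> ?; rewrite (@nth_default _ _ cross_table) ?nth_nil.
  have /allP H := allP tabP _ (mem_nth [::] (lti : i < size cross_table)%N).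
  have [ltj|lej] := ltnP j (size (nth [::] cross_table i)); last by rewrite nth_default.
  exact: H (mem_nth _ ltj).
have fnE i j : (i < 7)%N -> (j < 7)%N -> fn i ** fn j = match table_entry i j with
  | Z0 => 0
  | Zpos p => fn (Pos.to_nat p).-1
  | Zneg p => - fn (Pos.to_nat p).-1
  end by move=> i7 j7; rewrite /fn f_cross !inordK.
rewrite !fnE //.
have := entry7 a b; have := entry7 c d.
have posE p q : ((Pos.to_nat p).-1 == (Pos.to_nat q).-1) = Pos.eqb p q.
  apply/eqP/idP => [E|/Pos.eqb_eq -> //]; apply/Pos.eqb_eq/Pos2Nat.inj.
  move: E; case: (Pos2Nat.is_succ p) => m ->; case: (Pos2Nat.is_succ q) => m' ->.
  by move=> /= ->.
case: (table_entry a b) => [|p|p]; case: (table_entry c d) => [|q|q] q7 p7 /=;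
  rewrite ?ip0l ?ip0r ?ipNl ?ipNr ?opprK ?zr_deltaZ // /deltaZ ?posE.
all: by case: ifP => _; rewrite /zr /= ?oppr0.
Qed.

Definition vol1 : altform V 7 := coord_det f.

(** Both sides are multiplied by the Vandermonde product of 0, ..., 6 to stay in
    the integers. *)
Lemma fn_vol s : size s = 7%N -> all (gtn 7) s ->
  vol1 (vec (map fn s)) * zr R volC = zr R (vdmZ s).
Proof.
move=> s7 slt; have sE : s = map val [seq (inord (nth 0%N s (nat_of_ord i)) : 'I_7) | i <- enum 'I_7].
  rewrite -map_comp; apply: (@eq_from_nth _ 0%N); first by rewrite size_map size_enum_ord.
  move=> i; rewrite s7 => i7; rewrite (nth_map ord0) ?size_enum_ord //= nth_enum_ord //.
  by rewrite inordK //; apply: (allP slt); rewrite mem_nth // s7.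
pose I (i : 'I_7) : 'I_7 := inord (nth 0%N s i).
have sE' : [seq n%:R | n <- s] = [seq (nat_of_ord (I i))%:R | i <- enum 'I_7] :> seq R.
  by rewrite {1}sE -!map_comp.
rewrite !zr_vdmZ sE' -(det_indicator R I); congr (_ * _).
congr (\det _); apply/matrixP => i j; rewrite !mxE /vec (nth_map 0%N) ?s7 //.
by rewrite /fn fP.1.
Qed.

Lemma volC_neq0 : zr R volC != 0.
Proof. by rewrite /zr intr_eq0. Qed.

Lemma hodge_phi : hodge ip (vol1 : altform V (3 + 4)) phi = psi_form.
Proof.
apply: (eq_on_sorted fP) => t st; rewrite (hodgeE fP) ?size_map ?size_tuple //.
rewrite map_tuple_fn fn_psi ?val_tuple_lt ?size_map ?size_tuple //.
set q := map val t; have q4 : size q = 4%N by rewrite size_map size_tuple.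
have /Z.eqb_eq := all_idxP check_psi q4 st (val_tuple_lt t).
move=> /(congr1 (zr R)); rewrite (zrM R _ (volC * _)%BZ) (zrM R volC).
rewrite -(msum_zsum (G := fun s => zr R volC * (phi (vec s) * vol1 (vec (s ++ map fn q))))).
  rewrite msumZ => E; rewrite (mulfI volC_neq0 (etrans E (mulrCA _ _ _))).
  by rewrite -[zr R 6]/(3`!%:R : R) mulrA mulVf ?mul1r // pnatr_eq0.
move=> s s3 s7; rewrite fn_phi // -map_cat mulrCA (mulrC (zr R volC)) fn_vol.
- by rewrite /mulZ; case: (structZ3 s) => [|p|p]; rewrite ?mul0r ?zrM.
- by rewrite size_cat s3 q4.
- by rewrite all_cat s7 val_tuple_lt.
Qed.

Lemma hodge_psi : hodge ip (vol1 : altform V (4 + 3)) psi_form = phi.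
Proof.
apply: (eq_on_sorted fP) => t st; rewrite (hodgeE fP) ?size_map ?size_tuple //.
rewrite map_tuple_fn fn_phi ?val_tuple_lt ?size_map ?size_tuple //.
set q := map val t; have q3 : size q = 3%N by rewrite size_map size_tuple.
have /Z.eqb_eq := all_idxP check_phi q3 st (val_tuple_lt t).
move=> /(congr1 (zr R)); rewrite (zrM R _ (volC * _)%BZ) (zrM R volC).
rewrite -(msum_zsum (G := fun s => zr R volC * (psi_form (vec s) * vol1 (vec (s ++ map fn q))))).
  rewrite msumZ => E; rewrite (mulfI volC_neq0 (etrans E (mulrCA _ _ _))).
  by rewrite -[zr R 24]/(4`!%:R : R) mulrA mulVf ?mul1r // pnatr_eq0.
move=> s s4 s7; rewrite fn_psi // -map_cat mulrCA (mulrC (zr R volC)) fn_vol.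
- by rewrite /mulZ; case: (psiZ s) => [|p|p]; rewrite ?mul0r ?zrM.
- by rewrite size_cat s4 q3.
- by rewrite all_cat s7 val_tuple_lt.
Qed.

Lemma star_phi_left q : size q = 4%N ->
  3`!%:R^-1 * msum f 3 (fun s => phi (vec s) * vol1 (vec (q ++ s))) = psi_form (vec q).
Proof.
move=> q4; pose X : altform V 4 := 3`!%:R^-1 *:
  \sum_(I : {ffun 'I_3 -> 'I_7}) phi (f \o I) *: rcontract (f \o I) (vol1 : altform V (4 + 3)).
have XE s : size s = 4%N -> X (vec s) =
    3`!%:R^-1 * msum f 3 (fun t => phi (vec t) * vol1 (vec (s ++ t))).
  move=> s4; rewrite /X altformZ altform_sum; congr (_ * _).
  under eq_bigr => I _ do rewrite altformZ.
  rewrite (sum_ffun_msum _ (fun v => phi v * rcontract v (vol1 : altform V (4 + 3)) (vec s))).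
  by apply: eq_msum => t t3; rewrite /= catf_vec.
rewrite -XE //; congr (altfun _ _) => {q q4}.
apply: (eq_on_sorted fP) => t st; rewrite XE ?size_map ?size_tuple //.
rewrite map_tuple_fn fn_psi ?val_tuple_lt ?size_map ?size_tuple //.
set q := map val t; have q4 : size q = 4%N by rewrite size_map size_tuple.
have /Z.eqb_eq := all_idxP check_psi_left q4 st (val_tuple_lt t).
move=> /(congr1 (zr R)); rewrite (zrM R _ (volC * _)%BZ) (zrM R volC).
rewrite -(msum_zsum (G := fun s => zr R volC * (phi (vec s) * vol1 (vec (map fn q ++ s))))).
  rewrite msumZ => E; rewrite (mulfI volC_neq0 (etrans E (mulrCA _ _ _))).
  by rewrite -[zr R 6]/(3`!%:R : R) mulrA mulVf ?mul1r // pnatr_eq0.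
move=> s s3 s7; rewrite fn_phi // -map_cat mulrCA (mulrC (zr R volC)) fn_vol.
- by rewrite /mulZ; case: (structZ3 s) => [|p|p]; rewrite ?mul0r ?zrM.
- by rewrite size_cat s3 q4.
- by rewrite all_cat s7 val_tuple_lt.
Qed.

(** Only the 7! multi-indices that are permutations contribute, each of them 1. *)
Lemma ipform_vol1 : ipform ip vol1 vol1 = 1.
Proof.
rewrite (ipformE fP) -(sum_ffun_msum f (fun v => vol1 v * vol1 v)).
have volI (I : 'I_7 -> 'I_7) : vol1 (f \o I) = \det (\matrix_(i, j) (I i == j)%:R).
  by congr (\det _); apply/matrixP => i j; rewrite !mxE fP.1.
have volS (s : 'S_7) : vol1 (f \o s) = (-1) ^+ s.
  rewrite volI -det_perm; congr (\det _).
  by apply/matrixP => i j; rewrite !mxE.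
transitivity (7`!%:R^-1 * \sum_(s : 'S_7) (1 : R)).
  congr (_ * _).
  transitivity (\sum_(I : {ffun 'I_7 -> 'I_7}) \sum_(s : 'S_7)
    (-1) ^+ s * ((I == [ffun i => s i])%:R * vol1 (f \o I))).
    apply: eq_bigr => I _; rewrite {1}volI /determinant mulr_suml; apply: eq_bigr => s _.
    rewrite -mulrA; congr (_ * (_ * _)).
    have [->|/eqP/ffunP nI] := eqVneq I [ffun i => s i].
      by rewrite big1 // => i _; rewrite mxE ffunE eqxx.
    apply/eqP/prodf_eq0.
    have /existsNP[i ni] : ~ forall i, I i = s i by move=> H; apply: nI => i; rewrite H ffunE.
    by exists i => //; rewrite mxE; move/eqP: ni => /negPf ->.
  rewrite exchange_big /=; apply: eq_bigr => s _.
  rewrite (bigD1 [ffun i => s i]) //= big1 ?addr0 => [|I /negPf ->]; last by rewrite mul0r mulr0.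
  have E : vol1 (f \o [ffun i => s i]) = (-1) ^+ s.
    by rewrite -volS; congr altfun; apply/funext => i /=; rewrite ffunE.
  by rewrite eqxx mul1r [X in _ * X]E -expr2 sqrr_sign.
by rewrite sumr_const card_Sn mulVf // pnatr_eq0.
Qed.

(** The 7-forms are a line, so it suffices to compare inner products with the
    volume form. Contracting the volume form with phi gives psi, contracting
    psi with i(u) phi gives 2 i(u) phi, and the inner product of 2 i(u) phi
    with i(v) phi is 6 <u, v>. *)
Lemma vol1_wedge u v :
  wedge (wedge (interior_prod u phi) (interior_prod v phi)) phi =
  (6 * ip u v) *: vol1 :> altform V 7.
Proof.
set eta : altform V 7 := (X in X = _).
have vol0 : vol1 != 0.
  apply/eqP => v0; have := ipform_vol1; rewrite v0 ipform0l => /eqP.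
  by rewrite eq_sym oner_eq0.
have [c etaE] : exists c, eta = c *: vol1.
  have line : (<[vol1]> == {:altform V 7})%VS.
    rewrite eqEdim subvf dim_vline vol0.
    exact: leq_trans (dim_altform_le fP 7) _.
  by apply/vlineP; rewrite (eqP line) memvf.
have cE : c = ipform ip eta vol1 by rewrite etaE ipformZl ipform_vol1 mulr1.
rewrite etaE cE; congr (_ *: _).
rewrite (ipformE fP) (ipform_wedge f _ _ (vol1 : altform V (4 + 3))).
set a := interior_prod u phi; set b := interior_prod v phi.
transitivity (3`!%:R^-1 * msum f 3 (fun t => phi (vec t) *
   (2`!%:R^-1 * msum f 2 (fun r => b (vec r) *
     (2`!%:R^-1 * msum f 2 (fun q => a (vec q) * vol1 (vec (q ++ r ++ t)))))))).
  congr (_ * _); apply: eq_msum => t t3; congr (_ * _).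
  have H := ipform_wedge f a b (rcontract (vec t) (vol1 : altform V (4 + 3))).
  transitivity (4`!%:R^-1 * msum f 4 (fun s => wedge a b (vec s) *
      rcontract (vec t) (vol1 : altform V (4 + 3)) (vec s))).
    by congr (_ * _); apply: eq_msum => s s4; rewrite /= catf_vec.
  rewrite [LHS]H; congr (_ * _); apply: eq_msum => r r2; congr (_ * (_ * _)).
  by apply: eq_msum => q q2; rewrite /= catf_vec ?size_cat ?q2 ?r2 // catA.
transitivity (2`!%:R^-1 * msum f 2 (fun r => b (vec r) *
     (2`!%:R^-1 * msum f 2 (fun q => a (vec q) * psi_form (vec (q ++ r)))))).
  transitivity (msum f 2 (fun r => msum f 2 (fun q => msum f 3 (fun t =>
      3`!%:R^-1 * 2`!%:R^-1 * 2`!%:R^-1 *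
      (phi (vec t) * b (vec r) * a (vec q) * vol1 (vec (q ++ r ++ t))))))).
    rewrite -[LHS]msumZ; under [RHS]eq_msum => r _ do rewrite exchange_msum.
    rewrite [RHS]exchange_msum; apply: eq_msum => t _; rewrite -!msumZ.
    apply: eq_msum => r _; rewrite -!msumZ; apply: eq_msum => q _.
    by move: 3`!%:R^-1 2`!%:R^-1 => x y; ring.
  rewrite -[RHS]msumZ; apply: eq_msum => r r2; rewrite -!msumZ.
  apply: eq_msum => q q2; rewrite -star_phi_left ?size_cat ?q2 ?r2 //.
  rewrite -!msumZ; apply: eq_msum => t _; rewrite catA.
  by move: 3`!%:R^-1 2`!%:R^-1 => x y; ring.
transitivity (2`!%:R^-1 * msum f 2 (fun r => <<v ** r`_0, r`_1>> *
   (2`!%:R^-1 * msum f 2 (fun q => <<u ** q`_0, q`_1>> * psi_value q`_0 q`_1 r`_0 r`_1)))).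
  congr (_ * _); apply: eq_msum => -[|x [|y []]] // _.
  rewrite /b interior_vec phiE; congr (_ * (_ * _)).
  apply: eq_msum => -[|x' [|y' []]] // _.
  by rewrite /a interior_vec phiE.
rewrite /= !factS fact0 muln1.
have cP i j : \sum_k \sum_l <<u ** f k, f l>> * psi_value (f k) (f l) (f i) (f j) =
    4 * <<u ** f i, f j>>.
  by rewrite (contract_phi_psi fP); congr (_ * _); ring.
transitivity (2%:R^-1 * \sum_i \sum_j 2 * (<<u ** f i, f j>> * <<v ** f i, f j>>)).
  congr (_ * _); apply: eq_bigr => i _; apply: eq_bigr => j _.
  by rewrite cP; field.
under eq_bigr => i _ do rewrite -mulr_sumr.
by rewrite -mulr_sumr (contract_phi_phi fP); field.
Qed.

End Frame.
End Volume.

(** * Linearity in one argument *)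

Section Slots.
Variables (R : realType) (V : vectType R).

Lemma altform_slot k (a : altform V k) (s t : seq V) c x y : (size s < k)%N ->
  a (vec (s ++ (c *: x + y) :: t)) =
  c * a (vec (s ++ x :: t)) + a (vec (s ++ y :: t)).
Proof.
move=> sk; have E z : vec (s ++ z :: t) =
    [eta vec (s ++ 0 :: t) with Ordinal sk |-> z] :> ('I_k -> V).
  apply/funext => i /=; rewrite /vec !nth_cat -val_eqE /=.
  case: ltngtP => // [lt|->]; last by rewrite subnn.
  by rewrite -(subnSK lt).
by rewrite (E (c *: x + y)) (E x) (E y) altform_linear.
Qed.

(** One free argument after the arguments s and before t. The test on the size
    makes it linear for all s, so that it can be a canonical linear form. *)
Definition slot k (a : altform V k) (s t : seq V) (x : V) : R^o :=
  if (size s < k)%N then a (vec (s ++ x :: t)) else 0.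

Lemma slot_linear k (a : altform V k) s t : scalar (slot a s t).
Proof.
move=> c x y; rewrite /slot; case: ifP => sk; first exact: altform_slot.
by rewrite mulr0 addr0.
Qed.
HB.instance Definition _ k (a : altform V k) s t :=
  GRing.isLinear.Build R V R^o _ (slot a s t) (@slot_linear k a s t).

Lemma form2_swap (w : altform V 2) x y : w (vec [:: y; x]) = - w (vec [:: x; y]).
Proof.
have := altform_perm w (tperm 0 1) (vec [:: x; y]).
rewrite odd_tperm /= expr1 mulN1r => <-.
congr (altfun w); apply/funext => -[[|[|//]] lti]; rewrite /vec.
  by rewrite (_ : Ordinal lti = 0) ?tpermL //; apply/val_inj.
by rewrite (_ : Ordinal lti = 1) ?tpermR //; apply/val_inj.
Qed.

Lemma form2_xx (w : altform V 2) x : w (vec [:: x; x]) = 0.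
Proof. by apply: (@altform_alt _ _ _ w _ 0 1). Qed.

Lemma eq_form2 (w w' : altform V 2) :
  (forall x y, w (vec [:: x; y]) = w' (vec [:: x; y])) -> w = w'.
Proof.
move=> ww; apply: altform_inj => v.
by rewrite -(codom_vec v) /codom /image_mem !enum_ordSl enum_ord0 /= ww.
Qed.

Lemma eq_form3 (w w' : altform V 3) :
  (forall x y z, w (vec [:: x; y; z]) = w' (vec [:: x; y; z])) -> w = w'.
Proof.
move=> ww; apply: altform_inj => v.
by rewrite -(codom_vec v) /codom /image_mem !enum_ordSl enum_ord0 /= ww.
Qed.

Lemma wedge_linear k l (a : altform V k) : linear (@wedge R V k l a).
Proof.
move=> c b b'; apply: altform_inj => v; rewrite altformD altformZ /= /wedge_fun.
rewrite mulrCA -mulrDr; congr (_ * _); rewrite mulr_sumr -big_split.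
by apply: eq_bigr => s _; rewrite altformD altformZ mulrDr mulrDr !(mulrCA _ c).
Qed.
HB.instance Definition _ k l (a : altform V k) :=
  GRing.isLinear.Build R (altform V l) (altform V (k + l)) _ (@wedge R V k l a)
    (@wedge_linear k l a).

Variable (ip : {dot V for idfun}).

Section Expand.
Variables (n : nat) (e : 'I_n -> V) (eP : onbasis ip e).

Lemma form2_expand (w : altform V 2) x y :
  w (vec [:: x; y]) =
  \sum_j \sum_k ip (e j) x * ip (e k) y * w (vec [:: e j; e k]) :> R.
Proof.
have E1 : \sum_j ip x (e j) * w (vec [:: e j; y]) = w (vec [:: x; y]) :=
  sum_ip_scalar eP (slot w [::] [:: y]) x.
rewrite -E1; apply: eq_bigr => j _.
have E2 : \sum_k ip y (e k) * w (vec [:: e j; e k]) = w (vec [:: e j; y]) :=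
  sum_ip_scalar eP (slot w [:: e j] [::]) y.
by rewrite -E2 mulr_sumr; apply: eq_bigr => k _; rewrite mulrA (ipC _ x) (ipC _ y).
Qed.
End Expand.

Lemma hodge_linear k l (vol : altform V (k + l)) : linear (@hodge R V ip k l vol).
Proof.
move=> c a b; apply: altform_inj => v; rewrite altformD altformZ !altformZ !altform_sum.
rewrite mulrCA -mulrDr; congr (_ * _); rewrite mulr_sumr -big_split.
apply: eq_bigr => I _; rewrite !altformZ altformD altformZ mulrDl.
by rewrite mulrA.
Qed.
HB.instance Definition _ k l vol :=
  GRing.isLinear.Build R (altform V k) (altform V l) _ (@hodge R V ip k l vol)
    (@hodge_linear k l vol).

End Slots.

(** * The Hodge operator of the induced orientation *)

Section Stars.
Variables (R : realType) (V : vectType R) (dimV : \dim {:V} = 7%N).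
Variables (ip : {dot V for idfun}) (cross : {bilinear V -> V -> V}).
Hypothesis crossP : cross_product ip cross.
Local Notation "<< u , v >>" := (ip u v) (at level 0, u, v at level 99).
Local Notation "u ** v" := (cross u v) (at level 40, left associativity).
Local Notation phi := (assoc_form crossP).
Local Notation psi := (psi_form crossP).
Local Notation vol := (assoc_vol ip phi).
Local Notation special := (special ip cross).
Local Notation frame := (special_frame cross).

Lemma unit_scale x : x != 0 -> exists2 c, 0 < c & <<c *: x, c *: x>> = 1.
Proof.
move=> x0; have xx : 0 < <<x, x>> by exact: neq0_dnorm_gt0.
exists (Num.sqrt <<x, x>>)^-1; first by rewrite invr_gt0 sqrtr_gt0.
rewrite ipZl ipZr mulrA -invfM -expr2 sqr_sqrtr ?ltW //.
by rewrite mulVf // gt_eqF.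
Qed.

(** Fewer than 7 linear forms on V have a common nonzero zero. *)
Lemma unit_orth (s : seq V) : (size s < 7)%N ->
  exists2 w, <<w, w>> = 1 & {in s, forall x, <<w, x>> = 0}.
Proof.
move=> s7.
suff [w w0 ws] : exists2 w, w != 0 & {in s, forall x, <<w, x>> = 0}.
  have [c _ cw] := unit_scale w0; exists (c *: w) => // x xs.
  by rewrite ipZl ws // mulr0.
pose f (v : V) : 'rV[R]_(size s) := \row_i <<v, s`_i>>.
have f_lin : linear f by move=> c x y; apply/rowP => i; rewrite !mxE ipDl ipZl.
pose fl : {linear V -> 'rV[R]_(size s)} := HB.pack f (GRing.isLinear.Build R _ _ _ _ f_lin).
apply: contrapT => H.
have : (\dim {:V} <= \dim {:'rV[R]_(size s)})%N.
  apply: (@dim_le_inj _ _ _ _ fl) => v _ fv; apply/eqP; apply: contraT => v0.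
  exfalso; apply: H; exists v => // x xs.
  have xi : (index x s < size s)%N by rewrite index_mem.
  have := congr1 (fun r : 'rV[R]_(size s) => r 0 (Ordinal xi)) fv.
  by rewrite /fl /= !mxE /= nth_index.
by rewrite dimV dimvf dim_matrix mul1r leqNgt s7.
Qed.

Lemma special_ex u v : <<u, u>> = 1 -> <<v, v>> = 1 -> <<u, v>> = 0 ->
  exists w, special u v w.
Proof.
move=> uu vv uv; have [] := @unit_orth [:: u; v; u ** v] => // w ww ws.
have ortho x : x \in [:: u; v; u ** v] -> <<x, w>> = 0 by move=> xs; rewrite ipC ws.
exists w; split=> //; split=> //; apply: ortho; by rewrite !inE eqxx ?orbT.
Qed.

Lemma frame_onbasis u v w : special u v w -> onbasis ip (frame u v w).
Proof. by move=> S; apply: orthonormal_onbasis => //; exact: special_orthonormal. Qed.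

Lemma special_exists : exists u v w, special u v w.
Proof.
have [u uu _] := @unit_orth [::] isT.
have [v vv vs] := @unit_orth [:: u] isT.
have vu : <<u, v>> = 0 by rewrite ipC vs // inE.
by have [w S] := special_ex uu vv vu; exists u, v, w.
Qed.

(** The determinant in a special frame satisfies the property by which the volume
    form is chosen, and taking v = u a unit vector in that property determines
    the form. *)
Lemma assoc_volE u v w : special u v w -> vol = vol1 ip (frame u v w).
Proof.
move=> S; have fP := frame_onbasis S.
have [_ volP] : ipform ip vol vol = 1 /\ forall u v,
    (wedge (wedge (interior_prod u phi) (interior_prod v phi)) phi : altform V 7) =
    (6 * ip u v) *: vol.
  apply: (@xgetPex _ 0 [set vol : altform V 7 | ipform ip vol vol = 1 /\ forall u v,
    (wedge (wedge (interior_prod u phi) (interior_prod v phi)) phi : altform V 7) =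
    (6 * ip u v) *: vol]).
  exists (vol1 ip (frame u v w)); split; first exact: ipform_vol1.
  exact: (vol1_wedge crossP fP (frame_phi crossP S) (frame_cross crossP S)).
have := volP u u.
rewrite [LHS](vol1_wedge crossP fP (frame_phi crossP S) (frame_cross crossP S)).
by case: S => -> _ _ _; move/scalerI; rewrite mulr1 => ->.
Qed.

Lemma star_phi : hodge ip (vol : altform V (3 + 4)) phi = psi.
Proof.
have [u [v [w S]]] := special_exists.
rewrite (assoc_volE S); have fP := frame_onbasis S.
exact: (hodge_phi crossP fP (frame_phi crossP S) (frame_cross crossP S)).
Qed.

Lemma star_psi : hodge ip (vol : altform V (4 + 3)) psi = phi.
Proof.
have [u [v [w S]]] := special_exists.
rewrite (assoc_volE S); have fP := frame_onbasis S.
exact: (hodge_psi crossP fP (frame_phi crossP S) (frame_cross crossP S)).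
Qed.

Section Basis.
Variables (n : nat) (e : 'I_n -> V) (eP : onbasis ip e).

(** Contracting the volume form with phi first leaves psi. *)
Lemma star_phi_wedge (w : altform V 2) x y :
  hodge ip (vol : altform V (5 + 2)) (wedge phi w) (vec [:: x; y]) =
  2^-1 * \sum_j \sum_k w (vec [:: e j; e k]) * psi_value ip cross (e j) (e k) x y :> R.
Proof.
rewrite [LHS](hodge_wedge eP phi w (vol : altform V (3 + 2 + 2)) (x := [:: x; y]) erefl) // !factS fact0 muln1; congr (_ * _).
rewrite /=; apply: eq_bigr => j _; apply: eq_bigr => k _; congr (_ * _).
by rewrite -(hodgeE eP (vol : altform V (3 + 4)) phi (t := [:: e j; e k; x; y])) // star_phi.
Qed.

(** Contracting the volume form with psi first leaves phi. *)
Lemma star_psi_wedge (w : altform V 2) x :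
  hodge ip (vol : altform V (6 + 1)) (wedge psi w) (vec [:: x]) =
  2^-1 * \sum_j \sum_k w (vec [:: e j; e k]) * <<e j ** e k, x>> :> R.
Proof.
rewrite [LHS](hodge_wedge eP psi w (vol : altform V (4 + 2 + 1)) (x := [:: x]) erefl) // !factS fact0 muln1; congr (_ * _).
rewrite /=; apply: eq_bigr => j _; apply: eq_bigr => k _; congr (_ * _).
by rewrite -(hodgeE eP (vol : altform V (4 + 3)) psi (t := [:: e j; e k; x])) // star_psi.
Qed.

Lemma star_psi_wedge1 (a : altform V 1) x y :
  hodge ip (vol : altform V (5 + 2)) (wedge psi a) (vec [:: x; y]) =
  \sum_i a (vec [:: e i]) * <<e i ** x, y>> :> R.
Proof.
rewrite [LHS](hodge_wedge eP psi a (vol : altform V (4 + 1 + 2)) (x := [:: x; y]) erefl) // factS fact0 muln1 invr1 mul1r.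
rewrite /=; apply: eq_bigr => i _; congr (_ * _).
by rewrite -(hodgeE eP (vol : altform V (4 + 3)) psi (t := [:: e i; x; y])) // star_psi.
Qed.

(** The sign comes from moving the last argument of psi to the front. *)
Lemma star_phi_wedge3 (w : altform V 3) x :
  hodge ip (vol : altform V (6 + 1)) (wedge phi w) (vec [:: x]) =
  - ipform ip w (interior_prod x psi).
Proof.
rewrite [LHS](hodge_wedge eP phi w (vol : altform V (3 + 3 + 1)) (x := [:: x]) erefl) // (ipformE eP) -mulrN; congr (_ * _).
rewrite -[RHS]mulN1r -msumZ.
apply: eq_msum => s s3; rewrite mulN1r -mulrN; congr (_ * _).
rewrite -(hodgeE eP (vol : altform V (3 + 4)) phi) ?size_cat ?s3 // star_phi.
move: s s3 => [|a [|b [|c []]]] // _.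
by rewrite interior_vec !psiE (psif_rot crossP).
Qed.

Lemma star_psi_wedge3 (w : altform V 3) :
  hodge ip (vol : altform V (7 + 0)) (wedge psi w) (vec [::]) = ipform ip w phi.
Proof.
rewrite [LHS](hodge_wedge eP psi w (vol : altform V (4 + 3 + 0)) (x := [::]) erefl) // (ipformE eP); congr (_ * _).
apply: eq_msum => s s3; congr (_ * _).
by rewrite -(hodgeE eP (vol : altform V (4 + 3)) psi) ?size_cat ?s3 // star_psi cats0.
Qed.

End Basis.
End Stars.

(** * Contractions of 2-forms and 3-forms with the calibrations *)

Section Splitting.
Variables (R : realType) (V : vectType R) (dimV : \dim {:V} = 7%N).
Variables (ip : {dot V for idfun}) (cross : {bilinear V -> V -> V}).
Hypothesis crossP : cross_product ip cross.
Local Notation "<< u , v >>" := (ip u v) (at level 0, u, v at level 99).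
Local Notation "u ** v" := (cross u v) (at level 40, left associativity).
Local Notation phi := (assoc_form crossP).
Local Notation psi := (psi_form crossP).
Local Notation psif := (psi_value ip cross).
Local Notation vol := (assoc_vol ip phi).
Local Notation star5 := (@hodge R V ip 5 2 vol).
Local Notation star6 := (@hodge R V ip 6 1 vol).
Variables (e : 'I_7 -> V) (eP : onbasis ip e).

Lemma into_phiE u x y : into phi u (vec [:: x; y]) = <<u ** x, y>>.
Proof. by rewrite interior_vec. Qed.

Lemma into_psiE u x y z : into psi u (vec [:: x; y; z]) = psif u x y z.
Proof. by rewrite interior_vec. Qed.

(** The transpose of u |-> i(u) phi for the inner products of V and of 2-forms
    ([ipform_into_phi]); all the projections on 2-forms are expressed by this
    vector. *)
Definition svec (w : altform V 2) : V :=
  2^-1 *: \sum_j \sum_k w (vec [:: e j; e k]) *: (e j ** e k).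

Lemma svec_linear : linear svec.
Proof.
move=> c a b; rewrite /svec scalerA mulrC -scalerA -scalerDr; congr (_ *: _).
rewrite scaler_sumr -big_split; apply: eq_bigr => j _.
rewrite scaler_sumr -big_split; apply: eq_bigr => k _.
by rewrite altformD altformZ scalerDl scalerA.
Qed.
HB.instance Definition _ := GRing.isLinear.Build R _ _ _ svec svec_linear.

Lemma svec_ip w x : <<svec w, x>> =
  2^-1 * \sum_j \sum_k w (vec [:: e j; e k]) * <<e j ** e k, x>>.
Proof.
rewrite ipZl ip_suml; congr (_ * _); apply: eq_bigr => j _.
by rewrite ip_suml; apply: eq_bigr => k _; rewrite ipZl.
Qed.

(** Of the three terms of psi, the first gives i(s) phi for s the vector of w, and
    the other two give -w(x,y)/2 and w(y,x)/2. *)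
Lemma star5_phi w : star5 (wedge phi w) = into phi (svec w) - w.
Proof.
apply: eq_form2 => x y; rewrite altformB into_phiE.
rewrite [LHS](star_phi_wedge dimV crossP eP) /psi_value.
have E z t : w (vec [:: z; t]) = \sum_j \sum_k w (vec [:: e j; e k]) * (<<e j, z>> * <<e k, t>>) :> R.
  by rewrite (form2_expand eP); apply: eq_bigr => j _; apply: eq_bigr => k _; rewrite mulrC.
rewrite (triple_rot crossP (svec w)) ipC svec_ip.
transitivity (2^-1 * ((\sum_j \sum_k w (vec [:: e j; e k]) * <<e j ** e k, x ** y>>)
   - w (vec [:: x; y]) + w (vec [:: y; x])) : R).
  congr (_ * _); rewrite !E -sumrB -big_split; apply: eq_bigr => j _.
  rewrite -sumrB -big_split; apply: eq_bigr => k _ /=.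
  by rewrite -mulrBr -mulrDr.
rewrite (form2_swap w x y); move: (w _) => z; move: (\sum_i _) => t.
by field.
Qed.

Lemma svec_into u : svec (into phi u) = 3 *: u.
Proof.
apply: (@ip_nondeg _ _ ip) => x; rewrite svec_ip ipZl.
transitivity (2^-1 * \sum_j \sum_k <<u ** e j, e k>> * <<x ** e j, e k>>).
  congr (_ * _); apply: eq_bigr => j _; apply: eq_bigr => k _.
  by rewrite into_phiE -(triple_rot crossP x).
by rewrite (contract_phi_phi crossP eP); field.
Qed.

Lemma star6_psi w x : star6 (wedge psi w) (vec [:: x]) = <<svec w, x>>.
Proof. by rewrite svec_ip [LHS](star_psi_wedge dimV crossP eP). Qed.

Lemma star5_psi_star6_psi w : star5 (wedge psi (star6 (wedge psi w))) = into phi (svec w).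
Proof.
apply: eq_form2 => x y; rewrite [LHS](star_psi_wedge1 dimV crossP eP).
have E : \sum_i ip (svec w) (e i) * <<e i ** x, y>> = <<svec w ** x, y>> :=
  sum_ip_scalar eP (slot phi [::] [:: x; y]) (svec w).
rewrite into_phiE -E; apply: eq_bigr => i _.
by rewrite -star6_psi.
Qed.

Lemma ipform_into_phi u w : ipform ip (into phi u) w = <<u, svec w>>.
Proof.
rewrite (ipformE eP) (ipC _ u) svec_ip /= !factS fact0 muln1; congr (_ * _).
apply: eq_bigr => j _; apply: eq_bigr => k _.
by rewrite mulrC; congr (_ * _); rewrite [LHS]into_phiE (triple_rot crossP).
Qed.

Lemma ipform3 (a b : altform V 3) : ipform ip a b =
  6^-1 * \sum_i \sum_j \sum_k a (vec [:: e i; e j; e k]) * b (vec [:: e i; e j; e k]).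
Proof. by rewrite (ipformE eP). Qed.

Lemma psif_23 u v y : psif u v v y = 0.
Proof. by rewrite (psif_swap12 crossP) psif_norm ?oppr0. Qed.

Lemma psif_24 u v x : psif u v x v = 0.
Proof. by rewrite (psif_swap34 crossP) psif_23 oppr0. Qed.

Lemma sum_psif4 u v x y : \sum_l <<y, e l>> * psif u v x (e l) = psif u v x y.
Proof. exact: (sum_ip_scalar eP (slot psi [:: u; v; x] [::]) y). Qed.

Lemma sum_psif3 u v x y : \sum_l <<x, e l>> * psif u v (e l) y = psif u v x y.
Proof. exact: (sum_ip_scalar eP (slot psi [:: u; v] [:: y]) x). Qed.

Lemma ipform_phi_psi u : ipform ip phi (into psi u) = 0.
Proof.
rewrite ipform3 big1 ?mulr0 // => j _.
transitivity (\sum_k \sum_l <<e j ** e k, e l>> * psif (e k) (e l) u (e j)).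
  by apply: eq_bigr => k _; apply: eq_bigr => l _; rewrite into_psiE psif_pair.
by rewrite (contract_phi_psi crossP eP) (triple_rot crossP) (ip_crossr crossP) mulr0.
Qed.

(** Expanding one of the two factors psi leaves a contraction of phi with psi and
    terms in which psi has a repeated argument. *)
Lemma ipform_psi_psi u v : ipform ip (into psi u) (into psi v) = 4 * <<u, v>>.
Proof.
rewrite ipform3.
transitivity (6^-1 * \sum_j (4 * <<u ** e j, v ** e j>>)).
  congr (_ * _); apply: eq_bigr => j _.
  transitivity (\sum_k \sum_l <<v ** e j ** e k, e l>> * psif (e k) (e l) u (e j) -
     \sum_k \sum_l (<<v, e k>> * <<e j, e l>> - <<v, e l>> * <<e j, e k>>) * psif u (e j) (e k) (e l)).
    rewrite -sumrB; apply: eq_bigr => k _; rewrite -sumrB; apply: eq_bigr => l _.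
    rewrite !into_psiE {2}/psi_value (psif_pair ip cross u (e j)) (ipC _ (v ** e j)).
    rewrite (triple_rot crossP (v ** e j)) (ipC _ _ (v ** e j)); ring.
  rewrite (contract_phi_psi crossP eP) (triple_rot crossP (v ** e j)).
  have -> : \sum_k \sum_l (<<v, e k>> * <<e j, e l>> - <<v, e l>> * <<e j, e k>>) *
      psif u (e j) (e k) (e l) = 0.
    transitivity (\sum_k <<v, e k>> * (\sum_l <<e j, e l>> * psif u (e j) (e k) (e l))
       - \sum_k <<e j, e k>> * (\sum_l <<v, e l>> * psif u (e j) (e k) (e l))).
      rewrite -sumrB; apply: eq_bigr => k _; rewrite !mulr_sumr -sumrB.
      by apply: eq_bigr => l _; ring.
    under eq_bigr => k _ do rewrite sum_psif4.
    under [X in _ - X]eq_bigr => k _ do rewrite sum_psif4.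
    by rewrite !sum_psif3 psif_23 psif_24 subr0.
  by rewrite subr0; congr (_ * _); ring.
rewrite -mulr_sumr.
transitivity (6^-1 * (4 * \sum_j \sum_k <<u ** e j, e k>> * <<v ** e j, e k>>)).
  by congr (_ * (_ * _)); apply: eq_bigr => j _; rewrite -(parseval eP).
by rewrite (contract_phi_phi crossP eP); field.
Qed.

Fact kform_subproof (A : 'End(V)) : (fun v : 'I_3 -> V =>
    <<A (v 0) ** v 1, v 2>> + <<v 0 ** A (v 1), v 2>> + <<v 0 ** v 1, A (v 2)>> : R^o)
  \in @alternating_pred R V 3.
Proof.
have AP c x y : A (c *: x + y) = c *: A x + A y by rewrite linearP.
apply/asboolP; split=> [v i c x y|v i j].
  by case: i => -[|[|[|//]]] lti /=; rewrite ?AP !(crossE, ipE); ring.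
have v0 : v 0 = v (Ordinal (isT : 0 < 3)%N) by congr v; apply/val_inj.
have v1 : v 1 = v (Ordinal (isT : 1 < 3)%N) by congr v; apply/val_inj.
have v2 : v 2 = v (Ordinal (isT : 2 < 3)%N) by congr v; apply/val_inj.
have k01 x y : <<A x ** x, y>> + <<x ** A x, y>> + <<x ** x, A y>> = 0.
  by rewrite (crossC crossP (A x)) (crossvv crossP) ipNl ip0l addr0 addNr.
have k12 x y : <<A x ** y, y>> + <<x ** A y, y>> + <<x ** y, A y>> = 0.
  by rewrite (ip_crossr crossP) add0r (triple_swap crossP) addNr.
have k02 x y : <<A x ** y, x>> + <<x ** A y, x>> + <<x ** y, A x>> = 0.
  by rewrite (ip_crossl crossP) addr0 (triple_rot crossP (A x))
    (crossC crossP y x) ipNl addNr.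
rewrite v0 v1 v2.
case: i => -[|[|[|//]]] lti; case: j => -[|[|[|//]]] ltj //= _;
  rewrite !(bool_irrelevance lti isT) !(bool_irrelevance ltj isT) => E;
  by rewrite E (k01, k12, k02).
Qed.

(** The derivative at t = 0 of the pullback of phi by 1 + t A. *)
Definition kform (A : 'End(V)) : altform V 3 := AltForm (kform_subproof A).

Lemma kformE A x y z : kform A (vec [:: x; y; z]) =
  <<A x ** y, z>> + <<x ** A y, z>> + <<x ** y, A z>>.
Proof. by []. Qed.

Lemma kform_linear : linear kform.
Proof.
move=> c A B; apply: eq_form3 => x y z; rewrite altformD altformZ !kformE.
by rewrite !add_lfunE !scale_lfunE !(crossE, ipE); ring.
Qed.
HB.instance Definition _ := GRing.isLinear.Build R _ _ _ kform kform_linear.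

(** The trace is defined by a matrix in a basis that need not be orthonormal. *)
Lemma lftraceE A : lftrace A = \sum_i <<A (e i), e i>>.
Proof.
rewrite /lftrace /mxtrace.
under [RHS]eq_bigr => i _.
  rewrite {1}(coord_vbasis (memvf (e i))) linear_sum ip_suml.
  under eq_bigr => k _ do rewrite linearZ ipZl mulrC.
  over.
rewrite exchange_big /=; apply: eq_bigr => k _.
rewrite mxE /= passmx.vecof_delta -passmx.coord_rVof.
exact: (esym (sum_ip_scalar eP (coord (vbasis {:V}) k) (A (vbasis {:V})`_k))).
Qed.

Lemma kform_contract A x y :
  \sum_b \sum_c kform A (vec [:: x; e b; e c]) * <<y ** e b, e c>> =
  6 * <<A x, y>> + 2 * (\sum_b <<x ** A (e b), y ** e b>>) :> R.
Proof.
have E (B : 'I_7 -> V) (u : V) : \sum_b \sum_c <<B b, e c>> * <<u ** e b, e c>> =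
    \sum_b <<B b, u ** e b>>.
  by apply: eq_bigr => b _; rewrite -(parseval eP).
transitivity (\sum_b \sum_c <<A x ** e b, e c>> * <<y ** e b, e c>> +
    \sum_b \sum_c <<x ** A (e b), e c>> * <<y ** e b, e c>> +
    \sum_b \sum_c <<x ** A (e b), e c>> * <<y ** e b, e c>>).
  rewrite [X in _ = _ + X]exchange_big -!big_split; apply: eq_bigr => b _.
  rewrite -!big_split; apply: eq_bigr => c _; rewrite kformE.
  rewrite (triple_swap crossP x (A (e c))) (triple_swap crossP y (e c)) /=; ring.
by rewrite (contract_phi_phi crossP eP) !E; ring.
Qed.

Lemma sym_skew_sum (A : 'End(V)) (g : V -> V -> R) :
  symmetric_endo ip A -> (forall u, scalar (g u)) ->
  (forall x y, g x y = - g y x) -> \sum_a g (e a) (A (e a)) = 0.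
Proof.
move=> Asym gl gN.
have gE a : g (e a) (A (e a)) = \sum_c <<A (e a), e c>> * g (e a) (e c).
  pose gs : {scalar V} := HB.pack (g (e a) : V -> R^o)
    (GRing.isLinear.Build R V R^o _ _ (gl (e a))).
  exact: (esym (sum_ip_scalar eP gs (A (e a)))).
under eq_bigr => a _ do rewrite gE.
set S := LHS; suff : S = - S by move=> H; lra.
rewrite /S {1}exchange_big -sumrN; apply: eq_bigr => a _; rewrite -sumrN.
by apply: eq_bigr => c _; rewrite Asym gN mulrN ipC.
Qed.

(** Up to inner products, the remaining sum in [kform_contract] is a sum of psi
    over A in two of its arguments, which vanishes because psi is skew and A
    symmetric in them. *)
Lemma kform_contract_S0 A x y : symmetric_endo ip A -> lftrace A = 0 ->
  \sum_b \sum_c kform A (vec [:: x; e b; e c]) * <<y ** e b, e c>> = 4 * <<A x, y>> :> R.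
Proof.
move=> Asym trA; rewrite kform_contract.
have -> : \sum_b <<x ** A (e b), y ** e b>> = - <<A x, y>>.
  transitivity (\sum_b psif x (A (e b)) y (e b) + <<x, y>> * (\sum_b <<A (e b), e b>>)
      - \sum_b <<A y, e b>> * <<e b, x>>).
    rewrite mulr_sumr -big_split -sumrB; apply: eq_bigr => b _ /=.
    by rewrite /psi_value (Asym y) (ipC _ y) (ipC _ (e b) x); ring.
  rewrite -lftraceE trA mulr0 addr0 (sum_ip_ip eP) (Asym y) (ipC _ y).
  rewrite (sym_skew_sum (g := fun u v => psif x v y u)) ?sub0r //.
    by move=> u c z t; rewrite psif_P2.
  move=> u z.
  by rewrite (psif_swap34 crossP) (psif_swap23 crossP) (psif_swap34 crossP) opprK.
ring.
Qed.

Lemma kform_inj A : symmetric_endo ip A -> lftrace A = 0 -> kform A = 0 -> A = 0.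
Proof.
move=> Asym trA kA0; apply/lfunP => x; rewrite zero_lfunE.
apply: (@ip_nondeg _ _ ip) => y; rewrite ip0l.
have := kform_contract_S0 x y Asym trA.
rewrite kA0 big1 => [/esym/eqP|b _]; last by rewrite big1 // => c _; rewrite altform0 mul0r.
by rewrite mulf_eq0 pnatr_eq0 => /eqP.
Qed.

Lemma ipform_kform_phi A : symmetric_endo ip A -> lftrace A = 0 ->
  ipform ip (kform A) phi = 0.
Proof.
move=> Asym trA; rewrite ipform3.
under eq_bigr => a _ do rewrite kform_contract_S0 //.
by rewrite -mulr_sumr -lftraceE trA !mulr0.
Qed.

(** The three terms of the derivation contribute equally, and a contraction of phi
    with psi leaves the pairing of the symmetric A with the skew form i(u)
    phi. *)
Lemma ipform_kform_psi A u : symmetric_endo ip A ->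
  ipform ip (kform A) (into psi u) = 0.
Proof.
move=> Asym; rewrite ipform3.
pose T a b c := psif u (e a) (e b) (e c).
have T12 a b c : T b a c = - T a b c by rewrite /T (psif_swap23 crossP).
have T23 a b c : T a c b = - T a b c by rewrite /T (psif_swap34 crossP).
transitivity (6^-1 * (3 * \sum_a \sum_b \sum_c <<A (e a) ** e b, e c>> * T a b c)).
  congr (_ * _); rewrite (_ : 3 = 1 + 1 + 1) ?mulrDl ?mul1r; last by ring.
  transitivity (\sum_a \sum_b \sum_c <<A (e a) ** e b, e c>> * T a b c +
    \sum_a \sum_b \sum_c <<e a ** A (e b), e c>> * T a b c +
    \sum_a \sum_b \sum_c <<e a ** e b, A (e c)>> * T a b c).
    rewrite -!big_split; apply: eq_bigr => a _; rewrite -!big_split; apply: eq_bigr => b _.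
    rewrite -!big_split; apply: eq_bigr => c _ /=; rewrite -!mulrDl.
    by rewrite [X in _ * X = _]into_psiE.
  congr (_ + _ + _).
    rewrite exchange_big; apply: eq_bigr => a _; apply: eq_bigr => b _; apply: eq_bigr => c _.
    by rewrite T12 (crossC crossP) ipNl mulrNN.
  rewrite [RHS]exchange_big; apply: eq_bigr => a _ /=.
  rewrite [RHS]exchange_big; apply: eq_bigr => b _; apply: eq_bigr => c _ /=.
  by rewrite (T12 a c b) (T23 a b c) opprK (triple_rot crossP (A (e c))).
rewrite (_ : \sum_a _ = 4 * \sum_a <<u ** e a, A (e a)>>); last first.
  rewrite mulr_sumr; apply: eq_bigr => a _.
  transitivity (\sum_b \sum_c <<A (e a) ** e b, e c>> * psif (e b) (e c) u (e a)).
    by apply: eq_bigr => b _; apply: eq_bigr => c _; rewrite [in RHS]psif_pair.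
  by rewrite (contract_phi_psi crossP eP) (triple_rot crossP (A (e a))); congr (_ * _); ring.
rewrite (sym_skew_sum (g := fun v w => <<u ** v, w>>)) ?mulr0 //.
  by move=> v c x y; rewrite !ipE.
by move=> x y; rewrite (triple_swap crossP).
Qed.

End Splitting.

(** * The orthogonal splittings and their dimensions *)

Section Dimensions.
Variables (R : realType) (V : vectType R) (dimV : \dim {:V} = 7%N).
Variables (ip : {dot V for idfun}) (cross : {bilinear V -> V -> V}).
Hypothesis crossP : cross_product ip cross.
Local Notation "<< u , v >>" := (ip u v) (at level 0, u, v at level 99).
Local Notation "u ** v" := (cross u v) (at level 40, left associativity).
Local Notation phi := (assoc_form crossP).
Local Notation psi := (psi_form crossP).
Local Notation vol := (assoc_vol ip phi).
Variables (e : 'I_7 -> V) (eP : onbasis ip e).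
Local Notation svec := (svec cross e).
Local Notation kform := (kform crossP).

Fact skew_subproof (A : 'End(V)) :
  (fun v : 'I_2 -> V => <<A (v 0), v 1>> - <<A (v 1), v 0>> : R^o)
  \in @alternating_pred R V 2.
Proof.
have AP c x y : A (c *: x + y) = c *: A x + A y by rewrite linearP.
apply/asboolP; split=> [v i c x y|v i j].
  by case: i => -[|[|//]] lti /=; rewrite ?AP !ipE; ring.
have v0 : v 0 = v (Ordinal (isT : 0 < 2)%N) by congr v; apply/val_inj.
have v1 : v 1 = v (Ordinal (isT : 1 < 2)%N) by congr v; apply/val_inj.
rewrite v0 v1.
case: i => -[|[|//]] lti; case: j => -[|[|//]] ltj //= _;
  rewrite !(bool_irrelevance lti isT) !(bool_irrelevance ltj isT) => E;
  by rewrite E subrr.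
Qed.

Definition skew_form (A : 'End(V)) : altform V 2 := AltForm (skew_subproof A).

Lemma skew_formE A x y : skew_form A (vec [:: x; y]) = <<A x, y>> - <<A y, x>>.
Proof. by []. Qed.

Lemma skew_form_linear : linear skew_form.
Proof.
move=> c A B; apply: eq_form2 => x y; rewrite altformD altformZ !skew_formE.
by rewrite !add_lfunE !scale_lfunE !ipE; ring.
Qed.
HB.instance Definition _ := GRing.isLinear.Build R _ _ _ skew_form skew_form_linear.

Lemma skew_form_eq0 A : skew_form A = 0 <-> symmetric_endo ip A.
Proof.
split=> [A0 x y|Asym].
  have := congr1 (fun w : altform V 2 => w (vec [:: x; y])) A0.
  by rewrite skew_formE altform0 => /eqP; rewrite subr_eq0 (ipC _ _ x) => /eqP.
by apply: eq_form2 => x y; rewrite skew_formE altform0 Asym (ipC _ x) subrr.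
Qed.

Definition form_endo_fun (w : altform V 2) (x : V) : V :=
  \sum_i w (vec [:: x; e i]) *: e i.

Lemma form_endo_fun_linear w : linear (form_endo_fun w).
Proof.
move=> c x y; rewrite /form_endo_fun scaler_sumr -big_split; apply: eq_bigr => i _.
by rewrite (altform_slot w (s := [::])) // scalerDl scalerA.
Qed.
HB.instance Definition _ w := GRing.isLinear.Build R _ _ _ (form_endo_fun w)
  (form_endo_fun_linear w).

(** The endomorphism A with <A x, y> = w(x, y), which is skew. *)
Definition form_endo (w : altform V 2) : 'End(V) := linfun (form_endo_fun w).

Lemma form_endoE w x y : <<form_endo w x, y>> = w (vec [:: x; y]).
Proof.
rewrite lfunE /= ip_suml.
have E : \sum_i ip y (e i) * w (vec [:: x; e i]) = w (vec [:: x; y]) :=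
  sum_ip_scalar eP (slot w [:: x] [::]) y.
by rewrite -[RHS]E; apply: eq_bigr => i _; rewrite ipZl (ipC _ y) mulrC.
Qed.

Lemma form_endo_linear : linear form_endo.
Proof.
move=> c a b; apply/lfunP => x; rewrite add_lfunE scale_lfunE !lfunE /=.
rewrite /form_endo_fun scaler_sumr -big_split; apply: eq_bigr => i _.
by rewrite altformD altformZ scalerDl scalerA.
Qed.
HB.instance Definition _ := GRing.isLinear.Build R _ _ _ form_endo form_endo_linear.

Lemma skew_form_endo w : skew_form (form_endo w) = 2 *: w.
Proof.
apply: eq_form2 => x y; rewrite skew_formE !form_endoE altformZ (form2_swap w x y).
by move: (w _) => z; ring.
Qed.

Lemma form_endo_skew (A : 'End(V)) : (forall x y, <<A x, y>> = - <<A y, x>>) ->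
  form_endo (skew_form A) = 2 *: A.
Proof.
move=> Ask; apply/lfunP => x; apply: (@ip_nondeg _ _ ip) => y.
rewrite form_endoE skew_formE scale_lfunE ipZl (Ask y x); ring.
Qed.

Lemma lftrace_linear : scalar (@lftrace R V).
Proof. by move=> c A B; rewrite /lftrace passmx.mxof_linear mxtraceD mxtraceZ. Qed.
HB.instance Definition _ := GRing.isLinear.Build R _ R^o _ (@lftrace R V : _ -> R^o) lftrace_linear.

(** Written as a kernel, so that its dimension is found by counting: End V has
    dimension 49, and the image of [skew_form] lies in the space of 2-forms. *)
Definition Sym : {vspace 'End(V)} := lker (linfun skew_form).

Lemma SymP A : A \in Sym <-> symmetric_endo ip A.
Proof. by rewrite memv_ker lfunE -skew_form_eq0; split=> /eqP. Qed.

Definition S0 : {vspace 'End(V)} := (Sym :&: lker (linfun (@lftrace R V : _ -> R^o)))%VS.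

Lemma S0P A : A \in S0 <-> symmetric_endo ip A /\ lftrace A = 0.
Proof.
rewrite memv_cap; split=> [/andP[AS]|[AS trA]].
  by rewrite memv_ker lfunE => /eqP trA; split=> //; exact: proj1 (SymP A) AS.
by apply/andP; split; [exact: proj2 (SymP A) AS|rewrite memv_ker lfunE; apply/eqP].
Qed.

Lemma dim_End : \dim {:'End(V)} = 49%N.
Proof. by rewrite dimvf /dim /= -!dimvf dimV. Qed.

Lemma dim_Sym_le : (\dim Sym <= 28)%N.
Proof.
(* a symmetric matrix is determined by its entries with i <= j *)
pose T := {t : 2.-tuple 'I_7 | sorted leq (map val t)}.
pose ev (A : 'End(V)) : {ffun T -> R^o} :=
  [ffun t : T => <<A (e (tnth (val t) 0)), e (tnth (val t) 1)>> ].
have ev_lin : linear ev.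
  by move=> c a b; apply/ffunP => t; rewrite !ffunE add_lfunE scale_lfunE !ipE.
pose evl : {linear 'End(V) -> {ffun T -> R^o}} :=
  HB.pack ev (GRing.isLinear.Build R _ _ _ _ ev_lin).
have dimT : \dim {:{ffun T -> R^o}} = 28%N.
  rewrite dimvf /dim /= muln1 card_sig -[28%N]/'C(2 + 6, 2) -card_sorted_tuples.
  by apply: eq_card => t; rewrite !inE.
rewrite -dimT; apply: (@dim_le_inj _ _ _ _ evl) => A AS /ffunP A0.
have Asym := proj1 (SymP A) AS.
have Aij (i j : 'I_7) : <<A (e i), e j>> = 0.
  wlog ij : i j / (i <= j)%N => [H|].
    by case/orP: (leq_total i j) => ij; [|rewrite Asym ipC]; exact: H.
  have st : sorted leq (map val [tuple i; j]) by rewrite /= ij.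
  by have := A0 (exist _ [tuple i; j] st : T); rewrite !ffunE.
apply/lfunP => x; rewrite zero_lfunE [x](eP.2) linear_sum big1 // => i _.
rewrite linearZ /= (_ : A (e i) = 0) ?scaler0 //.
by apply: (eq_ip eP) => j; rewrite Aij ip0l.
Qed.

(** The two upper bounds 28 for symmetric endomorphisms and 21 for 2-forms add up
    to 49, so both are equalities. *)
Lemma dim_form2 : \dim {:altform V 2} = 21%N.
Proof.
apply/eqP; rewrite eqn_leq (dim_altform_le eP 2) /=.
have := limg_ker_dim (linfun skew_form) {:'End(V)}%VS; rewrite dim_End capfv => H.
rewrite -(leq_add2l 28) -[(28 + 21)%N]/49%N -H.
exact: leq_add dim_Sym_le (dimvS (subvf _)).
Qed.

Definition L27 : {vspace altform V 2} := limg (linfun (into phi)).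
Definition L214 : {vspace altform V 2} := lker (linfun svec).

Lemma L27P w : w \in L27 <-> exists u, w = into phi u.
Proof.
split=> [/memv_imgP[u _ ->]|[u ->]]; first by exists u; rewrite lfunE.
by rewrite -[into phi u]lfunE memv_img // memvf.
Qed.

Lemma L214P w : w \in L214 <-> svec w = 0.
Proof. by rewrite memv_ker lfunE; split=> /eqP. Qed.

Lemma into_phi_inj : lker (linfun (into phi)) = 0%VS.
Proof.
apply/eqP/lker0P => u v; rewrite !lfunE => /(congr1 svec).
rewrite !(svec_into crossP eP) => /scalerI -> //; by rewrite pnatr_eq0.
Qed.

Lemma dim_L27 : \dim L27 = 7%N.
Proof. by rewrite limg_dim_eq ?dimV // into_phi_inj capv0. Qed.

Lemma L27_cap_L214 : (L27 :&: L214)%VS = 0%VS.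
Proof.
apply/eqP; rewrite -subv0; apply/subvP => w /memv_capP[w7 w14].
have [u uw] := proj1 (L27P w) w7; have := proj1 (L214P w) w14.
rewrite uw (svec_into crossP eP) => /eqP; rewrite scaler_eq0 pnatr_eq0 /= => /eqP ->.
by rewrite linear0 mem0v.
Qed.

Lemma L27_add_L214 : (L27 + L214)%VS = {:altform V 2}%VS.
Proof.
apply/eqP; rewrite eqEsubv subvf; apply/subvP => w _.
have -> : w = into phi (3^-1 *: svec w) + (w - into phi (3^-1 *: svec w)) by rewrite addrC subrK.
apply: memv_add; first by apply/L27P; exists (3^-1 *: svec w).
by apply/L214P; rewrite linearB /= (svec_into crossP eP) scalerA mulfV ?scale1r ?subrr.
Qed.

Lemma dim_L214 : \dim L214 = 14%N.
Proof.
have := dimv_disjoint_sum L27_cap_L214; rewrite L27_add_L214 dim_form2 dim_L27 => H.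
by apply/eqP; rewrite -(eqn_add2l 7) -H.
Qed.

(** One inclusion holds because star (psi /\ w) is the linear form of the vector
    of w. The kernel of w |-> psi /\ w has dimension at least 21 - 7 because
    the 6-forms have dimension at most 7, so the two spaces agree. *)
Lemma L214_wedge w : w \in L214 <-> wedge psi w = 0.
Proof.
pose K := lker (linfun (@wedge R V 4 2 psi)).
have KP w' : (w' \in K) = (wedge psi w' == 0) by rewrite memv_ker lfunE.
have KL : (K <= L214)%VS.
  apply/subvP => w'; rewrite KP => /eqP w0; apply/L214P.
  apply: (@ip_nondeg _ _ ip) => x; rewrite -(star6_psi dimV crossP eP) w0.
  by rewrite linear0 altform0 ip0l.
have -> : L214 = K.
  apply/esym/eqP; rewrite eqEdim KL dim_L214 /=.
  have := limg_ker_dim (linfun (@wedge R V 4 2 psi)) {:altform V 2}%VS.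
  rewrite capfv dim_form2 => H; rewrite -(leq_add2r 7) -[(14 + 7)%N]/21%N -H leq_add2l.
  exact: leq_trans (dimvS (subvf _)) (dim_altform_le eP 6).
by rewrite KP; split=> /eqP.
Qed.

Definition L31 : {vspace altform V 3} := <[phi : altform V 3]>%VS.
Definition L37 : {vspace altform V 3} := limg (linfun (into psi)).
Definition L327 : {vspace altform V 3} := (linfun kform @: S0)%VS.

Lemma L37P w : w \in L37 <-> exists u, w = into psi u.
Proof.
split=> [/memv_imgP[u _ ->]|[u ->]]; first by exists u; rewrite lfunE.
by rewrite -[into psi u]lfunE memv_img // memvf.
Qed.

Lemma into_psi_inj : lker (linfun (into psi)) = 0%VS.
Proof.
apply/eqP/lker0P => u v; rewrite !lfunE => uv; apply/eqP; rewrite -subr_eq0.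
apply/eqP/(@ip_eq0 _ _ ip); apply/eqP.
have := ipform_psi_psi crossP eP (u - v) (u - v).
rewrite linearB /= uv subrr ipform0l => /esym/eqP; by rewrite mulf_eq0 pnatr_eq0.
Qed.

Lemma dim_L37 : \dim L37 = 7%N.
Proof. by rewrite limg_dim_eq ?dimV // into_psi_inj capv0. Qed.

Lemma phi_neq0 : (phi : altform V 3) != 0.
Proof.
apply/eqP => phi0; have := into_phi_inj => /eqP/lker0P inj.
have : e 0 = 0.
  apply: inj; rewrite !lfunE linear0; apply: eq_form2 => x y.
  by rewrite interior_vec phi0.
move/(congr1 (ip (e 0))); rewrite eP.1 eqxx ip0r => /eqP.
by rewrite oner_eq0.
Qed.

Lemma dim_L31 : \dim L31 = 1%N.
Proof. by rewrite dim_vline phi_neq0. Qed.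

Lemma L31_orth_L37 : {in L31 & L37, forall a b, ipform ip a b = 0}.
Proof.
move=> a b /vlineP[c ->] bL; have [u ->] := proj1 (L37P b) bL.
by rewrite ipformZl (ipform_phi_psi crossP eP) mulr0.
Qed.

Lemma perp_ex : exists P : {vspace altform V 3}, forall w,
  w \in P <-> ipform ip w phi = 0 /\ forall u, ipform ip w (into psi u) = 0.
Proof.
apply: vspace_of_closed => [|c a b [a1 a2] [b1 b2]].
  by split=> [|u]; rewrite ipform0l.
by split=> [|u]; rewrite ipformPl ?a1 ?b1 ?a2 ?b2 mulr0 addr0.
Qed.

Lemma orth_cap0 (A B : {vspace altform V 3}) :
  {in A & B, forall a b, ipform ip a b = 0} -> (A :&: B)%VS = 0%VS.
Proof.
move=> AB; apply/eqP; rewrite -subv0; apply/subvP => w /memv_capP[wA wB].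
by rewrite memv0 (@ipform_eq0 _ _ ip _ w) ?AB.
Qed.

Lemma orth_add (A B C : {vspace altform V 3}) :
  {in A & C, forall a b, ipform ip a b = 0} -> {in B & C, forall a b, ipform ip a b = 0} ->
  {in (A + B)%VS & C, forall a b, ipform ip a b = 0}.
Proof.
move=> AC BC _ c /memv_addP[a aA [b bB ->]] cC.
by rewrite ipformDl AC // BC // addr0.
Qed.

Lemma kform_S0_cap : (S0 :&: lker (linfun kform))%VS = 0%VS.
Proof.
apply/eqP; rewrite -subv0; apply/subvP => A /memv_capP[AS].
rewrite memv_ker lfunE memv0 => /eqP kA.
have [Asym trA] := proj1 (S0P A) AS.
by apply/eqP; exact: (kform_inj eP Asym trA kA).
Qed.

Lemma dim_S0_ge : (27 <= \dim S0)%N.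
Proof.
have H := limg_ker_dim (linfun (@lftrace R V : _ -> R^o)) Sym.
have symdim : (\dim Sym = 28)%N.
  apply/eqP; rewrite eqn_leq dim_Sym_le /=.
  have := limg_ker_dim (linfun skew_form) {:'End(V)}%VS; rewrite dim_End capfv => H'.
  rewrite -(leq_add2r 21) -[(28 + 21)%N]/49%N -H' leq_add2l -dim_form2.
  exact/dimvS/subvf.
rewrite -(leq_add2r 1) -[(27 + 1)%N]/28%N -symdim -H leq_add2l.
apply: leq_trans (dimvS (subvf _)) _.
by rewrite dimvf.
Qed.

(** The derivation embeds S0, of dimension at least 27, in the orthogonal
    complement of a space of dimension 8 in a space of dimension at most 35.
    So all these bounds are attained. *)
Lemma three_forms : [/\ \dim S0 = 27%N, \dim {:altform V 3} = 35%N, \dim L327 = 27%N &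
  forall w, w \in L327 <-> ipform ip w phi = 0 /\ forall u, ipform ip w (into psi u) = 0].
Proof.
have [P PP] := perp_ex.
have L327P : (L327 <= P)%VS.
  apply/subvP => w /memv_imgP[A AS ->]; rewrite lfunE; apply/PP.
  have [Asym trA] := proj1 (S0P A) AS.
  split=> [|u]; first exact: (ipform_kform_phi crossP eP).
  exact: (ipform_kform_psi crossP eP).
have dimL : \dim L327 = \dim S0 by exact: limg_dim_eq kform_S0_cap.
have o1 : {in L31 & P, forall a b, ipform ip a b = 0}.
  by move=> a b /vlineP[c ->] /PP[b0 _]; rewrite ipformZl ipformC b0 mulr0.
have o2 : {in L37 & P, forall a b, ipform ip a b = 0}.
  by move=> a b aL /PP[_ b0]; have [u ->] := proj1 (L37P a) aL; rewrite ipformC b0.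
have d1 := dimv_disjoint_sum (orth_cap0 L31_orth_L37).
have d2 := dimv_disjoint_sum (orth_cap0 (orth_add o1 o2)).
rewrite d1 dim_L31 dim_L37 in d2.
have d35 := dim_altform_le eP 3.
have dS : (\dim L31 + \dim L37 + \dim P <= \dim {:altform V 3})%N.
  by rewrite dim_L31 dim_L37 -d2; exact/dimvS/subvf.
rewrite dim_L31 dim_L37 in dS.
have P27 : (\dim P <= 27)%N by rewrite -(leq_add2l 8); exact: leq_trans dS d35.
have S27 : \dim S0 = 27%N.
  apply/eqP; rewrite eqn_leq dim_S0_ge andbT -dimL.
  exact: leq_trans (dimvS L327P) P27.
have PE : L327 = P by apply/eqP; rewrite eqEdim L327P dimL S27 P27.
split=> //.
- apply/eqP; rewrite eqn_leq d35 /=; apply: leq_trans dS.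
  by rewrite -PE dimL S27.
- by rewrite dimL.
- by move=> w; rewrite PE; exact: PP.
Qed.

Lemma L327_orth31 : {in L31 & L327, forall a b, ipform ip a b = 0}.
Proof.
have [_ _ _ LP] := three_forms.
by move=> a b /vlineP[c ->] /LP[b0 _]; rewrite ipformZl ipformC b0 mulr0.
Qed.

Lemma L327_orth37 : {in L37 & L327, forall a b, ipform ip a b = 0}.
Proof.
have [_ _ _ LP] := three_forms.
by move=> a b aL /LP[_ b0]; have [u ->] := proj1 (L37P a) aL; rewrite ipformC b0.
Qed.

Lemma three_forms_sum : (L31 + L37 + L327)%VS = {:altform V 3}%VS /\
  directv (L31 + L37 + L327).
Proof.
have [_ d35 d27 _] := three_forms.
have d1 := dimv_disjoint_sum (orth_cap0 L31_orth_L37).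
have d2 := dimv_disjoint_sum (orth_cap0 (orth_add L327_orth31 L327_orth37)).
rewrite d1 dim_L31 dim_L37 d27 in d2.
split; first by apply/eqP; rewrite eqEdim subvf d35 d2.
by apply/directvP; rewrite /= d2 dim_L31 dim_L37 d27.
Qed.

(** If phi /\ w and psi /\ w vanish then w is orthogonal to all i(u) psi and to
    phi. The converse is a comparison of dimensions: the two conditions cut
    out a subspace of dimension at least 35 - 7 - 1. *)
Lemma L327_wedge w : w \in L327 <-> wedge phi w = 0 /\ wedge psi w = 0.
Proof.
have [_ d35 d27 LP] := three_forms.
pose K1 := lker (linfun (@wedge R V 3 3 phi)).
pose f2 := linfun (@wedge R V 4 3 psi).
have KP w' : w' \in (K1 :&: lker f2)%VS <-> wedge phi w' = 0 /\ wedge psi w' = 0.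
  split=> [/memv_capP[]|[h1 h2]]; first by rewrite !memv_ker !lfunE => /eqP ? /eqP.
  by apply/memv_capP; split; rewrite memv_ker lfunE; apply/eqP.
suff -> : L327 = (K1 :&: lker f2)%VS by exact: KP.
apply/esym/eqP; rewrite eqEdim; apply/andP; split.
  apply/subvP => w' /KP[h1 h2]; apply/LP; split=> [|u].
    by rewrite -(star_psi_wedge3 dimV crossP eP) h2 linear0.
  apply/eqP; rewrite -oppr_eq0 -(star_phi_wedge3 dimV crossP eP) h1 linear0.
  by rewrite altform0.
have H1 := limg_ker_dim (linfun (@wedge R V 3 3 phi)) {:altform V 3}%VS.
have H2 := limg_ker_dim f2 K1.
rewrite capfv d35 in H1; rewrite d27.
have b1 : (\dim (limg (linfun (@wedge R V 3 3 phi))) <= 7)%N.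
  exact: leq_trans (dimvS (subvf _)) (dim_altform_le eP 6).
have b2 : (\dim (f2 @: K1) <= 1)%N.
  exact: leq_trans (dimvS (subvf _)) (dim_altform_le eP 7).
have c1 : (28 <= \dim K1)%N by rewrite -(leq_add2r 7) -[(28 + 7)%N]/35%N -H1 leq_add2l.
by rewrite -(leq_add2r 1); apply: leq_trans c1 _; rewrite -H2 leq_add2l.
Qed.

End Dimensions.

(** * Irreducibility along injective equivariant maps *)

Section Representations.
Variables (R : realType) (V : vectType R) (G : set 'End(V)).
Variables (A B : vectType R) (rho : 'End(V) -> A -> A) (sigma : 'End(V) -> B -> B).
Variables (W : {vspace B}) (f : 'Hom(B, A)).
Hypothesis f_inj : (W :&: lker f)%VS = 0%VS.
Hypothesis Winv : invariant G sigma W.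
Hypothesis f_eq : forall g x, G g -> x \in W -> f (sigma g x) = rho g (f x).

Lemma inj_on x : x \in W -> f x = 0 -> x = 0.
Proof.
move=> xW fx; apply/eqP; rewrite -memv0 -f_inj memv_cap xW memv_ker.
exact/eqP.
Qed.

Lemma image_invariant : invariant G rho (f @: W)%VS.
Proof.
move=> g _ Gg /memv_imgP[x xW ->]; rewrite -f_eq //.
exact/memv_img/Winv.
Qed.

(** The inverse of f on the image, followed by the projection onto W because
    [f^-1] is only an inverse up to the kernel of f. *)
Lemma image_rep_iso : rep_iso G rho (f @: W)%VS sigma W.
Proof.
pose h := (f \o projv W)%VF; exists (projv W \o h^-1)%VF.
have hE x : x \in (f @: W)%VS -> f (projv W (h^-1%VF x)) = x.
  move=> xW; have : x \in limg h by rewrite limg_comp limg_proj.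
  by move/limg_lfunVK; rewrite comp_lfunE.
have rE x : x \in W -> (projv W \o h^-1)%VF (f x) = x.
  move=> xW; rewrite comp_lfunE; apply/eqP; rewrite -subr_eq0; apply/eqP/inj_on.
    by rewrite memvB // memv_proj.
  by rewrite linearB /= hE ?subrr // memv_img.
split.
- apply/vspaceP => x; apply/memv_imgP/idP => [[y _ ->]|xW].
    by rewrite comp_lfunE memv_proj.
  by exists (f x); rewrite ?memv_img // rE.
- apply/eqP; rewrite -subv0; apply/subvP => _ /memv_capP[/memv_imgP[x xW ->]].
  by rewrite memv_ker rE // => /eqP ->; rewrite linear0 mem0v.
- move=> g _ Gg /memv_imgP[x xW ->].
  by rewrite -f_eq // !rE //; exact: Winv.
Qed.

Lemma image_irreducible : irreducible G sigma W -> irreducible G rho (f @: W)%VS.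
Proof.
case=> _ W0 Wirr; split; first exact: image_invariant.
  by rewrite -dimv_eq0 limg_dim_eq // dimv_eq0.
move=> U UW Uinv; pose U' := (f @^-1: U :&: W)%VS.
have U'E x : (x \in U') = (f x \in U) && (x \in W) by rewrite memv_cap memv_preim.
have UE : U = (f @: U')%VS.
  apply/vspaceP => y; apply/idP/memv_imgP => [yU|[x]].
    have /memv_imgP[x xW yE] := subvP UW _ yU.
    by exists x => //; rewrite U'E -yE yU.
  by rewrite U'E => /andP[fxU _] ->.
have [|U0|U1] := Wirr U' (capvSr _ _).
- move=> g x Gg; rewrite !U'E => /andP[fxU xW].
  by rewrite f_eq // Uinv // Winv.
- by left; rewrite UE U0 limg0.
- by right; rewrite UE U1.
Qed.

End Representations.

(** * Pullbacks *)

Section Pullback.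
Variables (R : realType) (V : vectType R).

Lemma pullback_vec (W : vectType R) k (g : 'Hom(V, W)) (w : altform W k) s :
  pullback g w (vec s) = w (vec (map g s)).
Proof.
rewrite -[LHS]/(w (fun i => g (vec s i))); congr (altfun w).
apply/funext => i; rewrite /vec.
have [lt|le] := ltnP i (size s); first by rewrite (nth_map 0).
by rewrite !nth_default ?size_map // linear0.
Qed.

Lemma pullback_linear (W : vectType R) k (g : 'Hom(V, W)) :
  linear (@pullback R V W k g).
Proof. by move=> c a b; apply: altform_inj => v. Qed.
HB.instance Definition _ (W : vectType R) k g :=
  GRing.isLinear.Build R (altform W k) (altform V k) _ (@pullback R V W k g)
    (@pullback_linear W k g).

Lemma pullbackZ (W : vectType R) k (g : 'Hom(V, W)) c (w : altform W k) :
  pullback g (c *: w) = c *: pullback g w.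
Proof. exact: altform_inj. Qed.

Lemma pullback_wedge (g : 'End(V)) k l (a : altform V k) (b : altform V l) :
  pullback g (wedge a b) = wedge (pullback g a) (pullback g b).
Proof. exact: altform_inj. Qed.

Lemma pullback_into (g : 'End(V)) k (a : altform V k.+1) u :
  pullback g (into a (g u)) = into (pullback g a) u.
Proof.
apply: altform_inj => v; rewrite -(codom_vec v) pullback_vec !interior_vec.
by rewrite pullback_vec.
Qed.

Lemma invK (g : 'End(V)) : lker g = 0%VS -> (g^-1^-1)%VF = g.
Proof.
move=> /eqP g0; have gV0 : lker g^-1%VF == 0%VS.
  by apply/lker0P => x y /(congr1 g); rewrite !lker0_lfunVK.
have /lker0P inj := gV0; apply/lfunP => x; apply: inj.
by rewrite lker0_lfunVK // lker0_lfunK.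
Qed.

End Pullback.

(** * The symmetry group of the associative calibration *)

Section Group.
Variables (R : realType) (V : vectType R) (dimV : \dim {:V} = 7%N).
Variables (ip : {dot V for idfun}) (cross : {bilinear V -> V -> V}).
Hypothesis crossP : cross_product ip cross.
Local Notation "<< u , v >>" := (ip u v) (at level 0, u, v at level 99).
Local Notation "u ** v" := (cross u v) (at level 40, left associativity).
Local Notation phi := (assoc_form crossP).
Local Notation psi := (psi_form crossP).
Local Notation vol := (assoc_vol ip phi).
Local Notation special := (special ip cross).
Local Notation frame := (special_frame cross).
Local Notation G := (Ggroup phi).

Lemma assoc_vol_wedge u v :
  (wedge (wedge (interior_prod u phi) (interior_prod v phi)) phi : altform V 7) =
  (6 * ip u v) *: vol.
Proof.
have [a [b [c S]]] := special_exists dimV ip cross.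
rewrite (assoc_volE dimV crossP S).
exact: (vol1_wedge crossP (frame_onbasis dimV crossP S) (frame_phi crossP S) (frame_cross crossP S)).
Qed.

Lemma Gphi g : G g -> forall u v w, <<g u ** g v, g w>> = <<u ** v, w>>.
Proof.
move=> [_ gphi] u v w.
have := congr1 (fun a : altform V 3 => a (vec [:: u; v; w])) gphi.
by rewrite pullback_vec.
Qed.

Lemma G_lker g : G g -> lker g == 0%VS.
Proof. by case=> ->. Qed.

(** An element g of the group scales the volume form by some d, because 7-forms
    are a line. The formula of the orientation then says that <g u, g v> d =
    <u, v>, hence also that the cross product of g u and g v is d times g (u x
    v). Comparing norms gives d^3 = 1, so d = 1. *)
Lemma G_ip g : G g -> forall u v, <<g u, g v>> = <<u, v>>.
Proof.
move=> Gg; have [gK gphi] := Gg.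
have [e1 [e2 [e3 S]]] := special_exists dimV ip cross.
have fP := frame_onbasis dimV crossP S.
have [S1 S2 _ [S12 _ _ _]] := S.
have vol0 : vol != 0.
  rewrite (assoc_volE dimV crossP S); apply/eqP => v0.
  have := ipform_vol1 fP; rewrite v0 ipform0l => /eqP.
  by rewrite eq_sym oner_eq0.
have [d dE] : exists d, pullback g vol = d *: vol.
  have line : (<[vol]> == {:altform V 7})%VS.
    rewrite eqEdim subvf dim_vline vol0.
    exact: leq_trans (dim_altform_le fP 7) _.
  by apply/vlineP; rewrite (eqP line) memvf.
have dip u v : <<g u, g v>> * d = <<u, v>>.
  have PW (a b : altform V 2) : pullback g (wedge (wedge a b) phi : altform V 7) =
      wedge (wedge (pullback g a) (pullback g b)) (pullback g phi) by exact: altform_inj.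
  have := PW (into phi (g u)) (into phi (g v)).
  rewrite !pullback_into gphi [X in _ = X]assoc_vol_wedge.
  rewrite [X in pullback g X](assoc_vol_wedge (g u) (g v)) pullbackZ dE scalerA => /eqP.
  rewrite -subr_eq0 -scalerBl scaler_eq0.
  rewrite (negPf vol0) orbF subr_eq0 => /eqP H; apply: (mulfI (_ : 6 != 0 :> R)).
    by rewrite pnatr_eq0.
  by rewrite -H mulrA.
have d0 : d != 0.
  by apply/eqP => d0; have := dip e1 e1; rewrite d0 mulr0 S1 => /eqP; rewrite eq_sym oner_eq0.
have cip u v : <<g u, g v>> = d^-1 * <<u, v>> by rewrite -(dip u v) mulrCA mulVf // mulr1.
have gcross u v : g u ** g v = d *: g (u ** v).
  apply: (@ip_nondeg _ _ ip) => w.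
  by rewrite -(lker0_lfunVK (G_lker Gg) w) (Gphi Gg) ipZl cip mulrA mulfV // mul1r.
have N := cross_norm crossP (g e1) (g e2) (g e2).
have N' := cross_norm crossP e1 e2 e2.
rewrite gcross ipZl ipZr !cip N' S1 S2 S12 in N.
have dd : d * (d * d) = 1.
  have dc : d * d^-1 = 1 by rewrite mulfV.
  move: d^-1 dc N => c dc N; have E2 : d * (d * c) = c * c by lra.
  have E : d = c * c by rewrite -E2 dc mulr1.
  by transitivity ((d * c) * (d * c)); [rewrite {1}E; ring | rewrite dc mulr1].
suff d1 : d = 1 by move=> u v; rewrite cip d1 invr1 mul1r.
have : (d - 1) * (d * d + d + 1) = 0.
  by transitivity (d * (d * d) - 1); [ring | rewrite dd subrr].
move/eqP; rewrite mulf_eq0 subr_eq0 => /orP[/eqP//|/eqP H].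
(* d^2 + d + 1 = (d + 1/2)^2 + 3/4 has no zero *)
have : 0 <= (d + 2^-1) ^+ 2 by exact: sqr_ge0.
nra.
Qed.

Lemma G_cross g : G g -> forall u v, g (u ** v) = g u ** g v.
Proof.
move=> Gg u v; apply: (@ip_nondeg _ _ ip) => w.
rewrite -(lker0_lfunVK (G_lker Gg) w) (Gphi Gg) (G_ip Gg) //.
Qed.

Lemma G_psi g : G g -> pullback g psi = psi.
Proof.
move=> Gg; apply: altform_inj => v; rewrite /= /psi_value.
by rewrite -!(G_cross Gg) !(G_ip Gg).
Qed.

Lemma G_inv g : G g -> G g^-1%VF.
Proof.
move=> Gg; have gV0 : lker g^-1%VF == 0%VS.
  by apply/lker0P => x y /(congr1 g); rewrite !(lker0_lfunVK (G_lker Gg)).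
split; first exact/eqP.
apply: eq_form3 => x y z; rewrite pullback_vec.
rewrite -[LHS]/(<<g^-1%VF x ** g^-1%VF y, g^-1%VF z>>) -(Gphi Gg).
by rewrite !(lker0_lfunVK (G_lker Gg)).
Qed.

Lemma G_onbasis g n (e : 'I_n -> V) : G g -> onbasis ip e -> onbasis ip (g \o e).
Proof.
move=> Gg [e1 e2]; split=> [i j|v]; first by rewrite /= (G_ip Gg).
rewrite -[LHS](lker0_lfunVK (G_lker Gg)) [g^-1%VF v]e2 linear_sum.
apply: eq_bigr => i _; rewrite linearZ /= -(G_ip Gg) (lker0_lfunVK (G_lker Gg)) //.
Qed.

Lemma G_comp g h : G g -> G h -> G (g \o h)%VF.
Proof.
move=> Gg Gh; split.
  have /lker0P ginj := G_lker Gg; have /lker0P hinj := G_lker Gh.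
  by apply/eqP/lker0P => x y; rewrite !comp_lfunE => /ginj/hinj.
apply: eq_form3 => x y z; rewrite pullback_vec /= !comp_lfunE.
by rewrite -[LHS]/(<<g (h x) ** g (h y), g (h z)>>) (Gphi Gg) (Gphi Gh).
Qed.

Lemma G1 : G \1%VF.
Proof.
split; first by apply/eqP/lker0P => x y; rewrite !id_lfunE.
by apply: eq_form3 => x y z; rewrite pullback_vec /= !id_lfunE.
Qed.

Definition basis_map (e f : 'I_7 -> V) : 'End(V) :=
  linfun (fun x => \sum_i <<x, e i>> *: f i).

Fact basis_map_linear (e f : 'I_7 -> V) : linear (fun x => \sum_i <<x, e i>> *: f i).
Proof.
move=> c x y; rewrite scaler_sumr -big_split; apply: eq_bigr => i _.
by rewrite ipDl ipZl scalerDl scalerA.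
Qed.

Lemma basis_map_ap e f x : basis_map e f x = \sum_i <<x, e i>> *: f i.
Proof.
pose h : {linear V -> V} := HB.pack (fun x => \sum_i <<x, e i>> *: f i)
  (GRing.isLinear.Build R V V _ _ (basis_map_linear e f)).
exact: (lfunE h).
Qed.

Lemma basis_mapE e f i : orthonormal_family ip e -> basis_map e f (e i) = f i.
Proof.
move=> eO; rewrite basis_map_ap (bigD1 i) //= big1 => [|j ji].
  by rewrite eO eqxx scale1r addr0.
by rewrite eO eq_sym (negPf ji) scale0r.
Qed.

(** Both frames have the same structure constants. *)
Lemma basis_map_G u v w u' v' w' : special u v w -> special u' v' w' ->
  G (basis_map (frame u v w) (frame u' v' w')).
Proof.
move=> S S'; set g := basis_map _ _.
have [fO fE] := frame_onbasis dimV crossP S.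
have [fO' fE'] := frame_onbasis dimV crossP S'.
have gf i : g (frame u v w i) = frame u' v' w' i by exact: basis_mapE.
split.
  apply/eqP/lker0P => x y; rewrite !basis_map_ap => xy.
  have sumE z i : <<\sum_j <<z, frame u v w j>> *: frame u' v' w' j, frame u' v' w' i>> =
      <<z, frame u v w i>>.
    rewrite ip_suml (bigD1 i) //= big1 => [|j ji]; rewrite ipZl fO'.
      by rewrite eqxx mulr1 addr0.
    by rewrite (negPf ji) mulr0.
  apply: (eq_ip (conj fO fE)) => i; rewrite -[LHS]sumE -[RHS]sumE; congr (ip _ _).
  exact: xy.
apply: (eq_on_basis (conj fO fE)) => I.
have pE (a : altform V 3) z : a z = a (vec [:: z ord0; z (inord 1); z (inord 2)]).
  congr altfun; apply/funext => -[[|[|[|//]]] lti]; rewrite /vec /=; congr z; apply/val_inj;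
  by rewrite /= ?inordK.
rewrite [LHS]pE [RHS]pE pullback_vec /= !gf.
rewrite -[LHS]/(<<_ ** _, _>>) -[RHS]/(<<_ ** _, _>>).
by rewrite !frame_phi.
Qed.

Lemma G_transitive u v w u' v' w' : special u v w -> special u' v' w' ->
  exists2 g, G g & forall i, g (frame u v w i) = frame u' v' w' i.
Proof.
move=> S S'; exists (basis_map (frame u v w) (frame u' v' w')); first exact: basis_map_G.
by move=> i; apply: basis_mapE; exact: (frame_onbasis dimV crossP S).1.
Qed.

(** Any orthonormal pair is part of a special triple. *)
Lemma G_transitive2 u v u' v' : <<u, u>> = 1 -> <<v, v>> = 1 -> <<u, v>> = 0 ->
  <<u', u'>> = 1 -> <<v', v'>> = 1 -> <<u', v'>> = 0 ->
  exists2 g, G g & g u = u' /\ g v = v'.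
Proof.
move=> uu vv uv uu' vv' uv'.
have [w S] := special_ex dimV cross uu vv uv.
have [w' S'] := special_ex dimV cross uu' vv' uv'.
have [g Gg gf] := G_transitive S S'.
by exists g => //; split; [have := gf ord0|have := gf (inord 1)]; rewrite /special_frame /= ?inordK.
Qed.

End Group.

(** * Representations isomorphic to V, and symmetric endomorphisms *)

Section Irreducible.
Variables (R : realType) (V : vectType R) (dimV : \dim {:V} = 7%N).
Variables (ip : {dot V for idfun}) (cross : {bilinear V -> V -> V}).
Hypothesis crossP : cross_product ip cross.
Local Notation "<< u , v >>" := (ip u v) (at level 0, u, v at level 99).
Local Notation "u ** v" := (cross u v) (at level 40, left associativity).
Local Notation phi := (assoc_form crossP).
Local Notation psi := (psi_form crossP).
Local Notation G := (Ggroup phi).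
Local Notation kform := (kform crossP).
Variables (e : 'I_7 -> V) (eP : onbasis ip e).
Local Notation S0 := (S0 ip).

(** The group is transitive on unit vectors. *)
Lemma std_irreducible : irreducible G (@std_act R V) {:V}%VS.
Proof.
split=> [g x _ _||W _ Winv]; first exact: memvf.
  by rewrite -dimv_eq0 dimV.
have [->|W0] := eqVneq W 0%VS; [by left|right].
have x0 : vpick W != 0 by rewrite vpick0.
have [c _ cx] := unit_scale ip x0; set u := c *: _ in cx.
have uW : u \in W by rewrite memvZ // memv_pick.
apply/eqP; rewrite eqEsubv subvf; apply/subvP => y _.
have [->|y0] := eqVneq y 0; first exact: mem0v.
have [d d0 dy] := unit_scale ip y0.
have [v vv vu] := @unit_orth _ _ dimV ip [:: u] isT.
have [v' vv' vu'] := @unit_orth _ _ dimV ip [:: d *: y] isT.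
have uv : <<u, v>> = 0 by rewrite ipC vu // inE.
have uv' : << d *: y, v'>> = 0 by rewrite ipC vu' // inE.
have [g Gg [gu _]] := G_transitive2 dimV crossP cx vv uv dy vv' uv'.
have : g u \in W by exact: Winv Gg uW.
by rewrite gu => /(memvZ d^-1); rewrite scalerA mulVf ?scale1r ?gt_eqF.
Qed.

Lemma form_act_into k (a : altform V k.+1) g u : G g -> pullback g^-1%VF a = a ->
  into a (std_act g u) = form_act g (into a u).
Proof.
move=> Gg ga; rewrite /form_act -{1}ga -pullback_into /std_act.
by rewrite lker0_lfunK // (G_lker Gg).
Qed.

Lemma L27_rep : irreducible G (@form_act R V 2) (L27 crossP) /\
  rep_iso G (@form_act R V 2) (L27 crossP) (@std_act R V) {:V}.
Proof.
have inj : ({:V} :&: lker (linfun (into phi)))%VS = 0%VS by rewrite (into_phi_inj crossP eP) capv0.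
have equ g x : G g -> x \in {:V}%VS ->
    linfun (into phi) (std_act g x) = form_act g (linfun (into phi) x).
  by move=> Gg _; rewrite !lfunE /=; apply: form_act_into => //; case: (G_inv Gg).
have stdinv : invariant G (@std_act R V) {:V} by move=> *; exact: memvf.
split; first exact: image_irreducible inj stdinv equ std_irreducible.
exact: image_rep_iso inj stdinv equ.
Qed.

Lemma L37_rep : irreducible G (@form_act R V 3) (L37 crossP) /\
  rep_iso G (@form_act R V 3) (L37 crossP) (@std_act R V) {:V}.
Proof.
have inj : ({:V} :&: lker (linfun (into psi)))%VS = 0%VS by rewrite (into_psi_inj crossP eP) capv0.
have equ g x : G g -> x \in {:V}%VS ->
    linfun (into psi) (std_act g x) = form_act g (linfun (into psi) x).
  move=> Gg _; rewrite !lfunE /=; apply: form_act_into => //.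
  exact: (G_psi dimV (G_inv Gg)).
have stdinv : invariant G (@std_act R V) {:V} by move=> *; exact: memvf.
split; first exact: image_irreducible inj stdinv equ std_irreducible.
exact: image_rep_iso inj stdinv equ.
Qed.

Lemma L31_irreducible : irreducible G (@form_act R V 3) (L31 crossP).
Proof.
split=> [g x Gg /vlineP[c ->]||W WL _].
- rewrite /form_act pullbackZ; have [_ ->] := G_inv Gg.
  by apply/vlineP; exists c.
- by rewrite -dimv_eq0 (dim_L31 crossP eP).
have := dimv_leqif_eq WL; rewrite (dim_L31 crossP eP) => -[W1 WE].
have [->|W0] := eqVneq W 0%VS; [by left|right].
by apply/eqP; rewrite -WE eqn_leq W1 lt0n dimv_eq0.
Qed.

Lemma conjE g A x y : G g -> <<conj_act g^-1%VF A x, y>> = <<A (g x), g y>>.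
Proof.
move=> Gg; have [g0 _] := Gg; rewrite /conj_act !comp_lfunE invK //.
rewrite -(G_ip dimV Gg (g^-1%VF _)) lker0_lfunVK //; exact/eqP.
Qed.

Lemma conjEV g A x y : G g -> <<conj_act g A x, y>> = <<A (g^-1%VF x), g^-1%VF y>>.
Proof.
move=> Gg; have [g0 _] := Gg; rewrite -[g in LHS](invK g0) conjE //.
exact: G_inv Gg.
Qed.

Lemma S0_invariant : invariant G (@conj_act R V) S0.
Proof.
move=> g A Gg AS; have [Asym trA] := proj1 (S0P ip A) AS; apply/S0P.
have Gh := G_inv Gg.
split=> [x y|].
  by rewrite conjEV // Asym [RHS]ipC conjEV // ipC.
rewrite (lftraceE eP) -[RHS]trA (lftraceE (G_onbasis dimV Gh eP)).
by apply: eq_bigr => i _; rewrite conjEV.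
Qed.

Lemma kform_conj g A : G g -> kform (conj_act g A) = form_act g (kform A).
Proof.
move=> Gg; apply: eq_form3 => x y z; rewrite /form_act pullback_vec !kformE.
rewrite -(Gphi Gg (A (g^-1%VF x))) -(Gphi Gg _ (A (g^-1%VF y))).
rewrite -(Gphi Gg _ _ (A (g^-1%VF z))) /conj_act !comp_lfunE.
by rewrite !(lker0_lfunVK (G_lker Gg)).
Qed.

Definition rank1 (u v : V) : 'End(V) := linfun (fun x => <<u, x>> *: v).

Lemma rank1E u v x : rank1 u v x = <<u, x>> *: v.
Proof.
have lin : linear (fun x => <<u, x>> *: v).
  by move=> c y z; rewrite ipDr ipZr scalerDl scalerA.
pose h : {linear V -> V} := HB.pack (fun x => <<u, x>> *: v)
  (GRing.isLinear.Build R V V _ _ lin).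
exact: (lfunE h).
Qed.

Definition sym2 u v : 'End(V) := rank1 u v + rank1 v u.

Lemma sym2E u v x : sym2 u v x = <<u, x>> *: v + <<v, x>> *: u.
Proof. by rewrite add_lfunE !rank1E. Qed.

Lemma sym2Zl c u v : sym2 (c *: u) v = c *: sym2 u v.
Proof.
apply/lfunP => x; rewrite scale_lfunE !sym2E ipZl scalerDr !scalerA.
by rewrite (mulrC <<v, x>>).
Qed.

Lemma sym2C u v : sym2 u v = sym2 v u.
Proof. by rewrite /sym2 addrC. Qed.

Lemma eq_endo (f : 'I_7 -> V) (A B : 'End(V)) : onbasis ip f ->
  (forall i j, <<A (f i), f j>> = <<B (f i), f j>>) -> A = B.
Proof.
move=> fP AB; apply/lfunP => x; rewrite [x](fP.2) !linear_sum; apply: eq_bigr => i _.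
by rewrite !linearZ; congr (_ *: _); apply: (eq_ip fP) => j; exact: AB.
Qed.

(** Statements homogeneous in each of two orthogonal vectors need only be proved
    for orthonormal ones, which form a single orbit. *)
Lemma orth_from_orthonormal (P : V -> V -> Prop) :
  (forall c x y, P x y -> P (c *: x) y) -> (forall c x y, P x y -> P x (c *: y)) ->
  (forall x, P x 0) -> (forall y, P 0 y) ->
  (forall x y, <<x, x>> = 1 -> <<y, y>> = 1 -> <<x, y>> = 0 -> P x y) ->
  forall x y, <<x, y>> = 0 -> P x y.
Proof.
move=> Pl Pr P0r P0l PO x y xy.
have [->//|x0] := eqVneq x 0; have [->//|y0] := eqVneq y 0.
have [c c0 cx] := unit_scale ip x0; have [d d0 dy] := unit_scale ip y0.
rewrite -[x](scalerK (lt0r_neq0 c0)) -[y](scalerK (lt0r_neq0 d0)).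
by apply/Pl/Pr/PO => //; rewrite ipZl ipZr xy !mulr0.
Qed.

(** If A vanished on all orthonormal pairs, its diagonal entries would be equal,
    by the pair e_i + e_j, e_i - e_j, so that A would be a multiple of the
    identity of trace 0. *)
Lemma S0_offdiag A : A \in S0 -> A != 0 ->
  exists u v, [/\ <<u, u>> = 1, <<v, v>> = 1, <<u, v>> = 0 & <<A u, v>> != 0].
Proof.
move=> AS A0; have [Asym trA] := proj1 (S0P ip A) AS.
apply: contrapT => H; move/eqP: A0; apply.
have Aorth : forall x y, <<x, y>> = 0 -> <<A x, y>> = 0.
  apply: orth_from_orthonormal => [c x y Axy|c x y Axy|x|y|x y xx yy xy].
  - by rewrite linearZ ipZl Axy mulr0.
  - by rewrite ipZr Axy mulr0.
  - by rewrite ip0r.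
  - by rewrite linear0 ip0l.
  - apply/eqP; apply: contraT => Axy; exfalso; apply: H; exists x, y; by split.
have Adiag i j : <<A (e i), e i>> = <<A (e j), e j>>.
  have := Aorth (e i + e j) (e i - e j).
  rewrite !ipE !linearD /= !ipE !eP.1 !eqxx (eq_sym j) => E.
  have {}E := E ltac:(ring); have S : <<A (e j), e i>> = <<A (e i), e j>> by rewrite Asym ipC.
  rewrite S in E; lra.
have A00 : <<A (e 0), e 0>> = 0.
  have : lftrace A = 7 * <<A (e 0), e 0>>.
    rewrite (lftraceE eP); under eq_bigr => i _ do rewrite (Adiag i 0).
    by rewrite sumr_const card_ord mulr_natl.
  by rewrite trA => /esym/eqP; rewrite mulf_eq0 pnatr_eq0 => /eqP.
apply: (eq_endo eP) => i j; rewrite zero_lfunE ip0l.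
have [->|ij] := eqVneq i j; first by rewrite (Adiag j 0).
by apply: Aorth; rewrite eP.1 (negPf ij).
Qed.

(** Off the diagonal, A is a combination of the symmetric products of e_i and e_j.
    On the diagonal, tracelessness allows to subtract the square of e_0 from
    each square of e_i, and the difference of two squares is the product of
    their sum and difference, which are orthogonal. *)
Lemma S0_span (W : {vspace 'End(V)}) :
  (forall u v, <<u, u>> = 1 -> <<v, v>> = 1 -> <<u, v>> = 0 -> sym2 u v \in W) ->
  (S0 <= W)%VS.
Proof.
move=> W1; have W2 : forall u v, <<u, v>> = 0 -> sym2 u v \in W.
  apply: orth_from_orthonormal => // [c x y xyW|c x y xyW|x|y].
  - by rewrite sym2Zl memvZ.
  - by rewrite sym2C sym2Zl memvZ // sym2C.
  - by rewrite sym2C -[0](scale0r x) sym2Zl scale0r mem0v.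
  - by rewrite -[0](scale0r y) sym2Zl scale0r mem0v.
apply/subvP => A AS; have [Asym trA] := proj1 (S0P ip A) AS.
(* the subtracted terms add up to the trace of A times a square *)
have AE : A = 2^-1 *: \sum_i \sum_j <<A (e i), e j>> *:
    (sym2 (e i) (e j) - (i == j)%:R *: sym2 (e 0) (e 0)).
  apply: (eq_endo eP) => k l.
  rewrite scale_lfunE ipZl sum_lfunE ip_suml.
  transitivity (2^-1 * \sum_i \sum_j (<<A (e i), e j>> *
     ((i == k)%:R * (j == l)%:R + (j == k)%:R * (i == l)%:R)
     - (i == j)%:R * (<<A (e i), e j>> * (2 * (0 == k)%:R * (0 == l)%:R)))); last first.
    congr (_ * _); apply: eq_bigr => i _; rewrite sum_lfunE ip_suml; apply: eq_bigr => j _.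
    rewrite scale_lfunE ipZl add_lfunE opp_lfunE scale_lfunE !sym2E !ipE !eP.1.
    have [->|ij] := eqVneq i j; ring.
  have S1 i : \sum_j (<<A (e i), e j>> *
     ((i == k)%:R * (j == l)%:R + (j == k)%:R * (i == l)%:R)
     - (i == j)%:R * (<<A (e i), e j>> * (2 * (0 == k)%:R * (0 == l)%:R))) =
     (i == k)%:R * <<A (e i), e l>> + (i == l)%:R * <<A (e i), e k>> -
     <<A (e i), e i>> * (2 * (0 == k)%:R * (0 == l)%:R).
    rewrite sumrB; congr (_ - _); last first.
      rewrite (bigD1 i) //= big1 => [|j ji]; last by rewrite eq_sym (negPf ji) mul0r.
      by rewrite eqxx mul1r addr0.
    under eq_bigr => j _ do rewrite mulrDr.
    rewrite big_split /=; congr (_ + _).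
      rewrite (bigD1 l) //= big1 => [|j jl]; last by rewrite (negPf jl) !mulr0.
      by rewrite eqxx addr0 mulr1 mulrC.
    rewrite (bigD1 k) //= big1 => [|j jl]; last by rewrite (negPf jl) mul0r mulr0.
    by rewrite eqxx addr0 mul1r mulrC.
  under eq_bigr => i _ do rewrite S1.
  rewrite sumrB big_split /= -mulr_suml -(lftraceE eP) trA mul0r subr0.
  rewrite (bigD1 k) //= big1 => [|j jl]; last by rewrite (negPf jl) mul0r.
  rewrite eqxx (bigD1 l) //= big1 => [|j jl]; last by rewrite (negPf jl) mul0r.
  by rewrite eqxx !mul1r !addr0 (Asym (e l)) (ipC _ (e l)); field.
rewrite AE memvZ // memv_suml // => i _; rewrite memv_suml // => j _; rewrite memvZ //.
have [<-|ij] := eqVneq i j; last by rewrite scale0r subr0 W2 // eP.1 (negPf ij).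
rewrite scale1r (_ : _ - _ = sym2 (e i + e 0) (e i - e 0)).
  by apply: W2; rewrite !ipE !eP.1 !eqxx (eq_sym i); ring.
apply/lfunP => x; rewrite add_lfunE opp_lfunE !sym2E; apply: (@ip_nondeg _ _ ip) => y.
by rewrite !ipE; ring.
Qed.

End Irreducible.

(** * Averaging over sign changes and rotations of a frame *)

Section Averages.
Variables (R : realType) (V : vectType R) (dimV : \dim {:V} = 7%N).
Variables (ip : {dot V for idfun}) (cross : {bilinear V -> V -> V}).
Hypothesis crossP : cross_product ip cross.
Local Notation "<< u , v >>" := (ip u v) (at level 0, u, v at level 99).
Local Notation "u ** v" := (cross u v) (at level 40, left associativity).
Local Notation phi := (assoc_form crossP).
Local Notation special := (special ip cross).
Local Notation frame := (special_frame cross).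
Local Notation G := (Ggroup phi).
Local Notation skew_form := (skew_form ip).
Variables (e : 'I_7 -> V) (eP : onbasis ip e).
Local Notation L214 := (L214 cross e).

Section OneFrame.
Variables (u v w : V) (S : special u v w).
Let F (n : nat) : V := frame u v w (inord n).

(** The eigenvalues of three commuting involutions in G on the frame, induced by
    replacing (u, v, w) by (u, v, -w), (-u, -v, w) and (u, -v, w). The seven
    triples of signs are the nontrivial characters of the group that they
    generate. *)
Definition sign1 (n : nat) : R := [:: 1; 1; 1; -1; -1; -1; -1]`_n.
Definition sign2 (n : nat) : R := [:: -1; -1; 1; 1; -1; -1; 1]`_n.
Definition sign3 (n : nat) : R := [:: 1; -1; -1; 1; 1; -1; -1]`_n.

Lemma flip1 : exists2 g, G g & forall n, (n < 7)%N -> g (F n) = sign1 n *: F n.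
Proof.
have S' : special u v (- w).
  case: S => uu vv ww [uv uw vw uvw]; split; rewrite ?ipE ?opprK //.
  by split; rewrite ?ipE ?uw ?vw ?uvw ?oppr0.
have [g Gg gf] := G_transitive dimV crossP S S'; exists g => // n n7.
rewrite gf /F /special_frame /sign1 inordK //.
by move: n n7 => [|[|[|[|[|[|[|//]]]]]]] _ /=;
  rewrite ?scale1r ?scaleN1r ?(crossE) ?opprK.
Qed.

Lemma flip2 : exists2 g, G g & forall n, (n < 7)%N -> g (F n) = sign2 n *: F n.
Proof.
have S' : special (- u) (- v) w.
  case: S => uu vv ww [uv uw vw uvw]; split; rewrite ?ipE ?opprK //.
  by split; rewrite ?(crossE, ipE) ?uv ?uw ?vw ?uvw ?oppr0.
have [g Gg gf] := G_transitive dimV crossP S S'; exists g => // n n7.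
rewrite gf /F /special_frame /sign2 inordK //.
by move: n n7 => [|[|[|[|[|[|[|//]]]]]]] _ /=;
  rewrite ?scale1r ?scaleN1r ?crossE ?opprK.
Qed.

Lemma flip3 : exists2 g, G g & forall n, (n < 7)%N -> g (F n) = sign3 n *: F n.
Proof.
have S' : special u (- v) w.
  case: S => uu vv ww [uv uw vw uvw]; split; rewrite ?ipE ?opprK //.
  by split; rewrite ?(crossE, ipE) ?uv ?uw ?vw ?uvw ?oppr0.
have [g Gg gf] := G_transitive dimV crossP S S'; exists g => // n n7.
rewrite gf /F /special_frame /sign3 inordK //.
by move: n n7 => [|[|[|[|[|[|[|//]]]]]]] _ /=;
  rewrite ?scale1r ?scaleN1r ?crossE ?opprK.
Qed.

Lemma FO : orthonormal_family ip (frame u v w).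
Proof. exact: (frame_onbasis dimV crossP S).1. Qed.

(** Any later vector of the frame can replace w; this gives the elements of G that
    permute the frame up to signs. *)
Lemma F_special n : (2 < n < 7)%N -> special u v (F n).
Proof.
case/andP=> n2 n7; have FE i j : (i < 7)%N -> (j < 7)%N -> <<F i, F j>> = (i == j)%:R.
  by move=> i7 j7; rewrite FO -val_eqE /= !inordK.
have F0 : u = F 0 by rewrite /F /special_frame inordK.
have F1 : v = F 1 by rewrite /F /special_frame inordK.
have F2 : u ** v = F 2 by rewrite /F /special_frame inordK.
split; [by rewrite F0 FE | by rewrite F1 FE | by rewrite FE // eqxx | split].
- by rewrite {1}F0 F1 FE.
- by rewrite {1}F0 FE // ltn_eqF // (ltn_trans _ n2).
- by rewrite {1}F1 FE // ltn_eqF // (ltn_trans _ n2).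
- by rewrite F2 FE // ltn_eqF.
Qed.

Lemma rotate_skew : exists2 g, G g & forall n, (n < 7)%N ->
  g (F n) = [:: F 0; F 1; F 2; F 4; - F 3; - F 6; F 5]`_n.
Proof.
(* (u, v, w) to (u, v, F 4) with F 4 = -(u x w) *)
have [g Gg gf] := G_transitive dimV crossP S (F_special (isT : 2 < 4 < 7)%N).
exists g => // n n7; rewrite gf /special_frame inordK //.
have C i j := frame_cross crossP S (inord i) (inord j).
have F0 : F 0 = u by rewrite /F /special_frame inordK.
have F1 : F 1 = v by rewrite /F /special_frame inordK.
have F2 : F 2 = u ** v by rewrite /F /special_frame inordK.
move: n n7 => [|[|[|[|[|[|[|//]]]]]]] _ //=.
- by rewrite -F0 C !inordK.
- by rewrite -F1 C !inordK // opprK.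
- by rewrite -F2 C !inordK // opprK.
Qed.

Lemma rotate_sym : exists2 g, G g & forall n, (n < 7)%N ->
  g (F n) = [:: F 0; F 1; F 2; F 6; - F 5; F 4; - F 3]`_n.
Proof.
(* (u, v, w) to (u, v, F 6) with F 6 = -((u x v) x w) *)
have [g Gg gf] := G_transitive dimV crossP S (F_special (isT : 2 < 6 < 7)%N).
exists g => // n n7; rewrite gf /special_frame inordK //.
have C i j := frame_cross crossP S (inord i) (inord j).
have F0 : F 0 = u by rewrite /F /special_frame inordK.
have F1 : F 1 = v by rewrite /F /special_frame inordK.
have F2 : F 2 = u ** v by rewrite /F /special_frame inordK.
move: n n7 => [|[|[|[|[|[|[|//]]]]]]] _ //=.
- by rewrite -F0 C !inordK.
- by rewrite -F1 C !inordK // opprK.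
- by rewrite -F2 C !inordK.
Qed.

(** Under the sign changes, the component of A at F_i, F_j is multiplied by the
    product of the characters of i and j. Only for the pairs (0,1), (3,6) and
    (4,5) is this the character (1, 1, -1), so that three steps leave 8 times
    these components. The rotation keeps the first one and changes the sign of
    the other two. *)
Lemma average_sym (W : {vspace 'End(V)}) A : invariant G (@conj_act R V) W ->
  A \in W -> symmetric_endo ip A -> (16 * <<A u, v>>) *: sym2 ip u v \in W.
Proof.
move=> Winv AW Asym.
have [g1 G1' E1] := flip1; have [g2 G2' E2] := flip2; have [g3 G3' E3] := flip3.
have [h Gh Eh] := rotate_sym.
have cW g B : G g -> B \in W -> conj_act g^-1%VF B \in W by move=> Gg BW; apply: Winv => //; exact: G_inv.
pose A1 := A + conj_act g1^-1%VF A; pose A2 := A1 + conj_act g2^-1%VF A1.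
pose A3 := A2 - conj_act g3^-1%VF A2; pose A4 := A3 + conj_act h^-1%VF A3.
have A1W : A1 \in W by rewrite memvD // cW.
have A2W : A2 \in W by rewrite memvD // cW.
have A3W : A3 \in W by rewrite memvB // cW.
have A4W : A4 \in W by rewrite memvD // cW.
suff <- : A4 = (16 * <<A u, v>>) *: sym2 ip u v by [].
have F0 : F 0 = u by rewrite /F /special_frame inordK.
have F1 : F 1 = v by rewrite /F /special_frame inordK.
have E i j : (i < 7)%N -> (j < 7)%N -> <<A3 (F i), F j>> =
    (1 - sign3 i * sign3 j) * (1 + sign2 i * sign2 j) * (1 + sign1 i * sign1 j) * <<A (F i), F j>>.
  move=> i7 j7.
  have C g s B : G g -> (forall n, (n < 7)%N -> g (F n) = s n *: F n) ->
      <<conj_act g^-1%VF B (F i), F j>> = s i * s j * <<B (F i), F j>>.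
    by move=> Gg Eg; rewrite (conjE dimV _ _ _ Gg) !Eg // ipZr linearZ /= ipZl mulrCA mulrA.
  rewrite /A3 add_lfunE opp_lfunE ipDl ipNl (C _ _ _ G3' E3).
  rewrite /A2 add_lfunE ipDl (C _ _ _ G2' E2) /A1 add_lfunE ipDl (C _ _ _ G1' E1).
  ring.
apply: (eq_endo (frame_onbasis dimV crossP S)) => i j.
rewrite -[i]inord_val -[j]inord_val -![frame _ _ _ (inord _)]/(F _).
rewrite /A4 add_lfunE ipDl (conjE dimV _ _ _ Gh) !Eh //.
rewrite scale_lfunE ipZl sym2E ipDl !ipZl -F0 -F1 /F !FO -!val_eqE /= -!/(F _) !inordK //.
have s45 : <<A (F 5), F 4>> = <<A (F 4), F 5>> by rewrite Asym ipC.
have s36 : <<A (F 6), F 3>> = <<A (F 3), F 6>> by rewrite Asym ipC.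
have s01 : <<A (F 1), F 0>> = <<A (F 0), F 1>> by rewrite Asym ipC.
case: i => -[|[|[|[|[|[|[|//]]]]]]] lti; case: j => -[|[|[|[|[|[|[|//]]]]]]] ltj /=;
  rewrite ?linearN /= ?ipNl ?ipNr !E // /sign1 /sign2 /sign3 /= ?s45 ?s36 ?s01 ?mulr0n ?mulr1n; ring.
Qed.

(** Three times the projection of the wedge product of x and y to the
    14-dimensional space: the interior product is subtracted to make the
    vector [svec] vanish. *)
Definition beta (x y : V) : altform V 2 :=
  3 *: skew_form (rank1 ip x y) - into phi (x ** y).

Lemma betaE x y z t : beta x y (vec [:: z; t]) =
  3 * (<<x, z>> * <<y, t>> - <<x, t>> * <<y, z>>) - <<x ** y ** z, t>>.
Proof.
rewrite /beta altformB altformZ into_phiE skew_formE !rank1E !ipZl.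
by [].
Qed.

(** By duality, [svec] does not depend on the basis. *)
Lemma svec_frame w0 : svec cross e w0 = svec cross (frame u v w) w0.
Proof.
apply: (@ip_nondeg _ _ ip) => x; rewrite [LHS]ipC [RHS]ipC.
by rewrite -(ipform_into_phi crossP eP) -(ipform_into_phi crossP (frame_onbasis dimV crossP S)).
Qed.

Lemma sum7 (H : nat -> R) : \sum_(i < 7) H i = H 0 + H 1 + H 2 + H 3 + H 4 + H 5 + H 6.
Proof. by rewrite !big_ord_recl big_ord0 addr0 !addrA. Qed.

Lemma form2Nl (w0 : altform V 2) x y : w0 (vec [:: - x; y]) = - w0 (vec [:: x; y]).
Proof. exact: (linearN (slot w0 [::] [:: y])). Qed.
Lemma form2Nr (w0 : altform V 2) x y : w0 (vec [:: x; - y]) = - w0 (vec [:: x; y]).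
Proof. exact: (linearN (slot w0 [:: x] [::])). Qed.
Lemma form2Zl (w0 : altform V 2) c x y : w0 (vec [:: c *: x; y]) = c * w0 (vec [:: x; y]).
Proof. exact: (linearZ_LR (slot w0 [::] [:: y])). Qed.
Lemma form2Zr (w0 : altform V 2) c x y : w0 (vec [:: x; c *: y]) = c * w0 (vec [:: x; y]).
Proof. exact: (linearZ_LR (slot w0 [:: x] [::])). Qed.

(** The component of [svec] along u x v. *)
Lemma L214_condition w0 : w0 \in L214 ->
  w0 (vec [:: F 0; F 1]) = w0 (vec [:: F 3; F 6]) + w0 (vec [:: F 4; F 5]) :> R.
Proof.
move=> wL; have := proj1 (L214P cross e w0) wL; rewrite svec_frame.
move/(congr1 (fun x => <<x, F 2>>)); rewrite ip0l svec_ip => /eqP.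
rewrite mulf_eq0 invr_eq0 pnatr_eq0 /= => /eqP.
pose a j k : R := w0 (vec [:: F j; F k]).
have aN j k : a k j = - a j k by exact: form2_swap.
have -> : \sum_(j < 7) \sum_(k < 7) w0 (vec [:: frame u v w j; frame u v w k]) *
    <<frame u v w j ** frame u v w k, F 2>> =
    \sum_(j < 7) \sum_(k < 7) a j k * zr R (structZ j k 2) :> R.
  apply: eq_bigr => j _; apply: eq_bigr => k _.
  by rewrite (frame_phi crossP S) /a /F !inord_val inordK.
rewrite (sum7 (fun j => \sum_(k < 7) a j k * zr R (structZ j k 2))).
rewrite !(sum7 (fun k => a _ k * zr R (structZ _ k 2))) /structZ /=.
rewrite -[zr R 0]/(0 : R) -[zr R 1]/(1 : R) -[zr R (-1)]/(-1 : R) !mulr0 !add0r !addr0.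
rewrite (aN 0 1) (aN 3 6) (aN 4 5) -[w0 _]/(a 0 1) -[w0 (vec [:: F 3; _])]/(a 3 6).
rewrite -[w0 (vec [:: F 4; _])]/(a 4 5) => /eqP; lra.
Qed.

(** Two sign changes leave 4 times the components at (0,1), (3,6) and (4,5). The
    rotation exchanges the last two, and as these add up to the first one by
    [L214_condition], the sum is determined by the component at (0,1). *)
Lemma average_skew (W : {vspace altform V 2}) w0 : invariant G (@form_act R V 2) W ->
  w0 \in W -> w0 \in L214 -> (4 * w0 (vec [:: u; v])) *: beta u v \in W.
Proof.
move=> Winv wW wL.
have [g1 G1' E1] := flip1; have [g2 G2' E2] := flip2.
have [h Gh Eh] := rotate_skew.
have cW g B : G g -> B \in W -> pullback g B \in W.
  move=> Gg BW; have [g0 _] := Gg; rewrite -(invK g0).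
  by apply: Winv => //; exact: G_inv.
pose w1 := w0 + pullback g1 w0; pose w2 := w1 + pullback g2 w1.
pose w3 := w2 + pullback h w2.
have w1W : w1 \in W by rewrite memvD // cW.
have w2W : w2 \in W by rewrite memvD // cW.
have w3W : w3 \in W by rewrite memvD // cW.
suff <- : w3 = (4 * w0 (vec [:: u; v])) *: beta u v by [].
have F0 : F 0 = u by rewrite /F /special_frame inordK.
have F1 : F 1 = v by rewrite /F /special_frame inordK.
have F2 : F 2 = u ** v by rewrite /F /special_frame inordK.
have E i j : (i < 7)%N -> (j < 7)%N -> w2 (vec [:: F i; F j]) =
    (1 + sign2 i * sign2 j) * (1 + sign1 i * sign1 j) * w0 (vec [:: F i; F j]) :> R.
  move=> i7 j7.
  have C (g : 'End(V)) s (B : altform V 2) :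
      (forall n, (n < 7)%N -> g (F n) = s n *: F n) ->
      pullback g B (vec [:: F i; F j]) = s i * (s j * B (vec [:: F i; F j])) :> R.
    by move=> Eg; rewrite pullback_vec /= !Eg // form2Zl form2Zr.
  rewrite /w2 altformD (C _ _ _ E2) /w1 altformD (C _ _ _ E1).
  by move: (w0 _) => x; ring.
clearbody w2.
apply: (eq_on_sorted (frame_onbasis dimV crossP S)) => -[[|i [|j [|? ?]]] t2] // st.
have ij : (i < j)%N by move: st; rewrite /= andbT.
rewrite -[map _ _]/[:: frame u v w i; frame u v w j] {st t2}.
have L := L214_condition wL.
have FE n m : (n < 7)%N -> (m < 7)%N -> <<F n, F m>> = (n == m)%:R.
  by move=> n7 m7; rewrite /F FO -val_eqE /= !inordK.
have PE n m : (n < 7)%N -> (m < 7)%N -> <<F 2 ** F n, F m>> = zr R (structZ 2 n m).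
  by move=> n7 m7; rewrite /F (frame_phi crossP S) !inordK.
rewrite -[i]inord_val -[j]inord_val -![frame _ _ _ (inord _)]/(F _).
rewrite /w3 altformD pullback_vec -[map _ _]/[:: h (F i); h (F j)] !Eh // altformZ betaE -F0 -F1.
rewrite [F 0 ** F 1](_ : _ = F 2); last by rewrite F0 F1.
rewrite PE // !FE // L.
move: ij; case: i => -[|[|[|[|[|[|[|//]]]]]]] lti; case: j => -[|[|[|[|[|[|[|//]]]]]]] ltj //= _;
  rewrite ?form2Nl ?form2Nr !E // /sign1 /sign2 /= ?L ?mulr0n ?mulr1n /structZ /=
   -?[zr R 0]/(0 : R) -?[zr R 1]/(1 : R) -?[zr R (-1)]/(-1 : R);
  do ?[move: (w0 _) => ?]; ring.
Qed.

End OneFrame.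
End Averages.

(** * Irreducibility in dimensions 14 and 27 *)

Section Irreducible2.
Variables (R : realType) (V : vectType R) (dimV : \dim {:V} = 7%N).
Variables (ip : {dot V for idfun}) (cross : {bilinear V -> V -> V}).
Hypothesis crossP : cross_product ip cross.
Local Notation "<< u , v >>" := (ip u v) (at level 0, u, v at level 99).
Local Notation "u ** v" := (cross u v) (at level 40, left associativity).
Local Notation phi := (assoc_form crossP).
Local Notation G := (Ggroup phi).
Local Notation kform := (kform crossP).
Variables (e : 'I_7 -> V) (eP : onbasis ip e).
Local Notation L214 := (L214 cross e).
Local Notation S0 := (S0 ip).
Local Notation sym2 := (sym2 ip).
Local Notation beta := (beta crossP).

Lemma conj_sym2 g u v : G g -> conj_act g (sym2 u v) = sym2 (g u) (g v).
Proof.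
move=> Gg; apply/lfunP => x; rewrite /conj_act !comp_lfunE !sym2E linearD !linearZ /=.
by rewrite -!(G_ip dimV Gg _ (g^-1%VF x)) !(lker0_lfunVK (G_lker Gg)).
Qed.

Lemma S0_irreducible : irreducible G (@conj_act R V) S0.
Proof.
split=> [||W WS Winv].
- exact: (S0_invariant dimV eP).
- have [dS _ _ _] := three_forms dimV crossP eP.
  by rewrite -dimv_eq0 dS.
have [->|W0] := eqVneq W 0%VS; [by left|right].
have AW := memv_pick W; have AS := subvP WS _ AW.
have A0 : vpick W != 0 by rewrite vpick0.
have [u [v [uu vv uv Auv]]] := S0_offdiag eP AS A0.
have [w S] := special_ex dimV cross uu vv uv.
have [Asym _] := proj1 (S0P _ _) AS.
have sW := average_sym dimV S Winv AW Asym.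
have {}sW : sym2 u v \in W.
  have c0 : 16 * <<vpick W u, v>> != 0 by rewrite mulf_neq0 // pnatr_eq0.
  by rewrite -[sym2 u v](scalerK c0) memvZ.
apply/eqP; rewrite eqEsubv WS; apply: (S0_span eP) => u' v' uu' vv' uv'.
have [g Gg [gu gv]] := G_transitive2 dimV crossP uu vv uv uu' vv' uv'.
by rewrite -gu -gv -conj_sym2 //; apply: Winv.
Qed.

Lemma L327_rep : irreducible G (@form_act R V 3) (L327 crossP) /\
  rep_iso G (@form_act R V 3) (L327 crossP) (@conj_act R V) S0.
Proof.
have inj := kform_S0_cap crossP eP.
have equ g A : G g -> A \in S0 ->
    linfun kform (conj_act g A) = form_act g (linfun kform A).
  by move=> Gg _; rewrite !lfunE /=; exact: kform_conj.
have inv := S0_invariant dimV eP (crossP := crossP).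
split; first exact: image_irreducible inj inv equ S0_irreducible.
exact: image_rep_iso inj inv equ.
Qed.

Lemma L214_invariant : invariant G (@form_act R V 2) L214.
Proof.
move=> g w Gg /(proj1 (L214_wedge dimV crossP eP w)) w0.
apply: (proj2 (L214_wedge dimV crossP eP _)).
rewrite /form_act -(G_psi dimV (G_inv Gg)) -pullback_wedge w0; exact: altform_inj.
Qed.

Lemma L214_pair (w : altform V 2) : w != 0 -> exists u v,
  [/\ <<u, u>> = 1, <<v, v>> = 1, <<u, v>> = 0 & w (vec [:: u; v]) != 0].
Proof.
move=> w0; apply: contrapT => H; move/eqP: w0; apply.
have wij i j : w (vec [:: e i; e j]) = 0.
  have [->|ij] := eqVneq i j; first exact: form2_xx.
  apply/eqP; apply: contraT => wN; exfalso; apply: H.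
  by exists (e i), (e j); split; rewrite ?eP.1 ?eqxx ?(negPf ij).
apply: eq_form2 => x y; rewrite (form2_expand eP) altform0 big1 // => i _.
by rewrite big1 // => j _; rewrite wij mulr0.
Qed.

Lemma beta_pullback g u v : G g -> pullback g (beta (g u) (g v)) = beta u v.
Proof.
move=> Gg; apply: eq_form2 => x y; rewrite pullback_vec [LHS]betaE [RHS]betaE.
by rewrite -(G_cross dimV Gg) (Gphi Gg) !(G_ip dimV Gg).
Qed.

(** Projecting the expansion of w in the wedge products of e_i and e_j; the
    correction terms add up to i(s) phi for s = 0. *)
Lemma L214_span w : w \in L214 ->
  w = 6^-1 *: \sum_i \sum_j w (vec [:: e i; e j]) *: beta (e i) (e j).
Proof.
move=> wL; apply: eq_form2 => x y; rewrite altformZ altform_sum.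
have E1 := form2_expand eP w x y; have E2 := form2_expand eP w y x.
have s0 := proj1 (L214P cross e w) wL.
have E3 : \sum_i \sum_j w (vec [:: e i; e j]) * <<e i ** e j ** x, y>> = 0 :> R.
  have := congr1 (ip ^~ (x ** y)) s0; rewrite /= ip0l svec_ip => /eqP.
  rewrite mulf_eq0 invr_eq0 pnatr_eq0 /= => /eqP E; rewrite -[RHS]E.
  apply: eq_bigr => i _; apply: eq_bigr => j _.
  by rewrite (triple_rot crossP) (ipC _ (x ** y)).
transitivity (6^-1 * (3 * ((\sum_i \sum_j <<e i, x>> * <<e j, y>> * w (vec [:: e i; e j]))
    - (\sum_i \sum_j <<e i, y>> * <<e j, x>> * w (vec [:: e i; e j])))
    - \sum_i \sum_j w (vec [:: e i; e j]) * <<e i ** e j ** x, y>>) : R).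
  rewrite E3 -E1 -E2 (form2_swap w x y); move: (w _) => z; by field.
congr (_ * _); rewrite -sumrB mulr_sumr -sumrB.
apply: eq_bigr => i _; rewrite altform_sum -sumrB mulr_sumr -sumrB.
apply: eq_bigr => j _; rewrite altformZ [X in _ = _ * X]betaE.
by move: (w _) => z; ring.
Qed.

Lemma L214_irreducible : irreducible G (@form_act R V 2) L214.
Proof.
split=> [||W WL Winv]; first exact: L214_invariant.
  by rewrite -dimv_eq0 (dim_L214 dimV crossP eP).
have [->|W0] := eqVneq W 0%VS; [by left|right].
have wW := memv_pick W; have wL := subvP WL _ wW.
have w0 : vpick W != 0 by rewrite vpick0.
have [u [v [uu vv uv wuv]]] := L214_pair w0.
have [w S] := special_ex dimV cross uu vv uv.
have bW := average_skew dimV eP S Winv wW wL.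
have {}bW : beta u v \in W.
  have c0 : 4 * vpick W (vec [:: u; v]) != 0 :> R by rewrite mulf_neq0 // pnatr_eq0.
  by rewrite -[beta u v](scalerK c0) memvZ.
have bij i j : i != j -> beta (e i) (e j) \in W.
  move=> ij.
  have ii k : <<e k, e k>> = 1 by rewrite eP.1 eqxx.
  have eij : <<e i, e j>> = 0 by rewrite eP.1 (negPf ij).
  have [g Gg [gu gv]] := G_transitive2 dimV crossP (ii i) (ii j) eij uu vv uv.
  rewrite -(beta_pullback _ _ Gg) gu gv.
  have [g0 _] := Gg; rewrite -(invK g0); apply: Winv => //; exact: G_inv.
apply/eqP; rewrite eqEsubv WL; apply/subvP => w' /L214_span ->.
rewrite memvZ // memv_suml // => i _; rewrite memv_suml // => j _.
have [->|ij] := eqVneq i j; first by rewrite form2_xx scale0r mem0v.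
by rewrite memvZ // bij.
Qed.

End Irreducible2.

(** * Curves with trigonometric polynomial entries *)

Import numFieldNormedType.Exports.

Section TrigonometricPolynomials.
Variable R : realType.

(** [is_derive] for real functions of a real variable, with the direction 1 and
    the casts to modules hidden. *)
Definition dv (t : R) (f : R -> R) (d : R) : Prop := is_derive (t : R^o) (1 : R^o) (f : R^o -> R^o) d.

Lemma dv_cst t c : dv t (fun=> c) 0.
Proof. exact: (is_derive_cst (c : R^o)). Qed.

Lemma dvD t f g df dg : dv t f df -> dv t g dg -> dv t (fun x => f x + g x) (df + dg).
Proof. exact: is_deriveD. Qed.

Lemma dvM t f g df dg : dv t f df -> dv t g dg ->
  dv t (fun x => f x * g x) (f t * dg + df * g t).
Proof.
by move=> hf hg; rewrite (mulrC df); have := @is_deriveM _ _ f g t 1 df dg hf hg.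
Qed.

Lemma dv_sum t n (h : 'I_n -> R -> R) (dh : 'I_n -> R) :
  (forall i, dv t (h i) (dh i)) -> dv t (fun x => \sum_i h i x) (\sum_i dh i).
Proof.
move=> H; have -> : (fun x => \sum_i h i x) = \sum_i h i by apply/funext => x; rewrite fct_sumE.
exact: is_derive_sum.
Qed.

Lemma dv_unique t f d d' : dv t f d -> dv t f d' -> d = d'.
Proof. by move=> [_ <-] [_ <-]. Qed.

Lemma dv_comp_scale t f a d : dv (a * t) f d -> dv t (fun x => f (a * x)) (a * d).
Proof.
move=> fd; have ax : dv t (fun x => a * x) a.
  have := dvM (dv_cst t a) (is_derive_id (t : R^o) (1 : R^o)).
  by rewrite mulr1 mul0r addr0.
by rewrite mulrC; exact: (@is_derive1_comp R f (fun x => a * x) t d a).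
Qed.

Lemma dv_derive1 t f d : dv t f d -> derive1 f t = d.
Proof. by move=> [_ <-]; rewrite derive1E. Qed.

(** Closed under products and derivatives, hence consisting of smooth functions,
    and generated by what the rotation of a plane needs. Linear combinations
    of velocities will be velocities of products and rescalings of curves,
    which stay in this class. *)
Inductive trig : (R -> R) -> Prop :=
  | trig_cst c : trig (fun=> c)
  | trig_cos a : trig (fun t => cos (a * t))
  | trig_sin a : trig (fun t => sin (a * t))
  | trigD f g : trig f -> trig g -> trig (fun t => f t + g t)
  | trigM f g : trig f -> trig g -> trig (fun t => f t * g t).

Lemma trigZ c f : trig f -> trig (fun t => c * f t).
Proof. by move=> tf; apply: trigM => //; exact: trig_cst. Qed.

Lemma trig_sum n (h : 'I_n -> R -> R) : (forall i, trig (h i)) ->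
  trig (fun t => \sum_i h i t).
Proof.
elim: n h => [|n IH] h th.
  have -> : (fun t => \sum_i h i t) = fun=> 0 by apply/funext => t; rewrite big_ord0.
  exact: trig_cst.
have -> : (fun t => \sum_i h i t) = fun t => h ord0 t + \sum_i h (lift ord0 i) t.
  by apply/funext => t; rewrite big_ord_recl.
by apply: trigD => //; apply: IH.
Qed.

Lemma trig_scale a f : trig f -> trig (fun t => f (a * t)).
Proof.
elim=> [c|b|b|g h _ tg _ th|g h _ tg _ th].
- exact: trig_cst.
- have -> : (fun t => cos (b * (a * t))) = fun t => cos ((b * a) * t).
    by apply/funext => t; rewrite mulrA.
  exact: trig_cos.
- have -> : (fun t => sin (b * (a * t))) = fun t => sin ((b * a) * t).
    by apply/funext => t; rewrite mulrA.
  exact: trig_sin.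
- exact: trigD.
- exact: trigM.
Qed.

Lemma trig_dv f : trig f -> exists2 f', trig f' & forall t, dv t f (f' t).
Proof.
elim=> [c|a|a|g h _ [g' tg' dg] _ [h' th' dh]|g h tg [g' tg' dg] th [h' th' dh]].
- by exists (fun=> 0); [exact: trig_cst|move=> t; exact: dv_cst].
- exists (fun t => a * (-1 * sin (a * t))).
    by apply/trigZ/trigZ/trig_sin.
  by move=> t; rewrite mulN1r; apply: dv_comp_scale; exact: is_derive_cos.
- exists (fun t => a * cos (a * t)); first by apply/trigZ/trig_cos.
  by move=> t; apply: dv_comp_scale; exact: is_derive_sin.
- exists (fun t => g' t + h' t); first exact: trigD.
  by move=> t; exact: dvD.
- exists (fun t => g t * h' t + g' t * h t); last by move=> t; exact: dvM.
  by apply: trigD; apply: trigM.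
Qed.

Lemma trig_smooth f : trig f -> smooth_fun f.
Proof.
move=> tf n; have : trig (derive1n n f).
  elim: n => [|n IH]; first by [].
  have [f' tf' df] := trig_dv IH; rewrite derive1nS.
  have -> : derive1 (derive1n n f) = f' by apply/funext => t; exact: dv_derive1.
  by [].
by move=> /trig_dv[f' _ df] t; case: (df t).
Qed.

End TrigonometricPolynomials.

(** * The Lie algebra of the symmetry group *)

Section LieAlgebra.
Variables (R : realType) (V : vectType R) (dimV : \dim {:V} = 7%N).
Variables (ip : {dot V for idfun}) (cross : {bilinear V -> V -> V}).
Hypothesis crossP : cross_product ip cross.
Local Notation "<< u , v >>" := (ip u v) (at level 0, u, v at level 99).
Local Notation "u ** v" := (cross u v) (at level 40, left associativity).
Local Notation phi := (assoc_form crossP).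
Local Notation psif := (psi_value ip cross).
Local Notation special := (special ip cross).
Local Notation frame := (special_frame cross).
Local Notation G := (Ggroup phi).
Local Notation kform := (kform crossP).
Local Notation skew_form := (skew_form ip).
Variables (e : 'I_7 -> V) (eP : onbasis ip e).
Local Notation svec := (svec cross e).
Local Notation L214 := (L214 cross e).
Local Notation form_endo := (form_endo e).

(** Velocity at 0 of a curve of vectors, tested against the inner product. *)
Definition vel (g : R -> V) (a : V) : Prop := forall y, dv 0 (fun t => <<g t, y>>) <<a, y>>.

Lemma dv_ip g a h b : vel g a -> vel h b ->
  dv 0 (fun t => <<g t, h t>>) (<<g 0, b>> + <<a, h 0>>).
Proof.
move=> ga hb.
have -> : (fun t => <<g t, h t>>) = fun t => \sum_i <<g t, e i>> * <<h t, e i>>.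
  by apply/funext => t; exact: parseval.
rewrite (parseval eP (g 0)) (parseval eP a) -big_split.
by apply: dv_sum => i; exact: dvM.
Qed.

Lemma vel_cross g a h b : vel g a -> vel h b ->
  vel (fun t => g t ** h t) (g 0 ** b + a ** h 0).
Proof.
move=> ga hb z.
have hz : vel (fun t => h t ** z) (b ** z).
  move=> y; rewrite (triple_rot crossP) ipC.
  rewrite (_ : (fun t => _) = fun t => <<h t, z ** y>>); last first.
    by apply/funext => t; rewrite (triple_rot crossP) ipC.
  exact: hb.
have := dv_ip hz ga.
rewrite (_ : (fun t => _) = fun t => <<g t ** h t, z>>); last first.
  by apply/funext => t; rewrite -(triple_rot crossP) ipC.
by rewrite ipDl addrC (triple_rot crossP (g 0)) (triple_rot crossP a).
Qed.

(** Differentiate the invariance of the inner product and of phi. *)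
Lemma vel_skew (c : R -> 'End(V)) (A : 'End(V)) : c 0 = \1%VF -> (forall t, G (c t)) ->
  (forall x, vel (fun t => c t x) (A x)) ->
  (forall x y, <<A x, y>> = - <<A y, x>>) /\ kform A = 0.
Proof.
move=> c0 Gc cA; split=> [x y|].
  have := dv_ip (cA x) (cA y).
  rewrite (_ : (fun t => _) = fun=> <<x, y>>); last first.
    by apply/funext => t; rewrite (G_ip dimV (Gc t)).
  move/dv_unique/(_ (dv_cst _ _)); rewrite c0 !id_lfunE (ipC _ x) => H; lra.
apply: eq_form3 => x y z; rewrite kformE altform0.
have := dv_ip (vel_cross (cA x) (cA y)) (cA z).
rewrite (_ : (fun t => _) = fun=> <<x ** y, z>>); last first.
  by apply/funext => t; rewrite (Gphi (Gc t)).
move/dv_unique/(_ (dv_cst _ _)); rewrite c0 !id_lfunE ipDl => H; lra.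
Qed.

(** Contracting the derivation of a skew A with phi gives 4 w + 4 star (phi /\ w)
    for the 2-form w of A, which is 4 i(s) phi for s the vector of w. So s =
    0. *)
Lemma skew_L214 (A : 'End(V)) : (forall x y, <<A x, y>> = - <<A y, x>>) -> kform A = 0 ->
  exists2 w, w \in L214 & A = form_endo w.
Proof.
move=> Ask kA; pose w := 2^-1 *: skew_form A.
have Aw : A = form_endo w.
  by rewrite /w linearZ /= (form_endo_skew eP Ask) scalerA mulVf ?scale1r ?pnatr_eq0.
have wE x y : w (vec [:: x; y]) = <<A x, y>> by rewrite Aw (form_endoE eP).
exists w => //; apply/L214P.
have : into phi (svec w) = 0.
  have := star5_phi dimV crossP eP w => /eqP; rewrite eq_sym subr_eq => /eqP ->.
  apply: eq_form2 => x y; rewrite altformD altform0.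
  rewrite [X in X + _ = _](star_phi_wedge dimV crossP eP) wE.
  have := kform_contract crossP eP A x y.
  rewrite kA big1 => [|b _]; last by rewrite big1 // => d _; rewrite altform0 mul0r.
  have -> : \sum_b <<x ** A (e b), y ** e b>> = \sum_b psif (e b) (A (e b)) x y - <<A x, y>>.
    rewrite (Ask x y) opprK -(sum_ip_ip eP) -big_split; apply: eq_bigr => b _.
    have -> : <<x ** A (e b), y ** e b>> = psif x (A (e b)) y (e b)
       + <<x, y>> * <<A (e b), e b>> - <<x, e b>> * <<A (e b), y>> by rewrite /psi_value; ring.
    rewrite (psif_rot crossP) (psif_swap23 crossP) opprK (Ask (e b) y).
    have -> : <<A (e b), e b>> = 0 by have := Ask (e b) (e b) => H; lra.
    rewrite (ipC _ x (e b)) /=; ring.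
  have -> : \sum_j \sum_k w (vec [:: e j; e k]) * psif (e j) (e k) x y =
      \sum_j psif (e j) (A (e j)) x y.
    apply: eq_bigr => j _; rewrite -[RHS](sum_ip_scalar eP (slot (psi_form crossP) [:: e j] [:: x; y])).
    by apply: eq_bigr => k _; rewrite wE.
  by move=> H; lra.
have /eqP/lker0P inj := into_phi_inj crossP eP.
by move=> H; apply: inj; rewrite !lfunE /= H linear0.
Qed.

Definition trig_vel (g : R -> V) (a : V) : Prop :=
  (forall y, trig (fun t => <<g t, y>>)) /\ vel g a.

Lemma trig_vel_cst x : trig_vel (fun=> x) 0.
Proof. by split=> y; [exact: trig_cst | rewrite ip0l; exact: dv_cst]. Qed.

Lemma trig_velD g a h b : trig_vel g a -> trig_vel h b ->
  trig_vel (fun t => g t + h t) (a + b).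
Proof.
move=> [tg ga] [th hb]; split=> y.
  by under eq_fun => t do rewrite ipDl; exact: trigD.
by under eq_fun => t do rewrite ipDl; rewrite ipDl; exact: dvD.
Qed.

Lemma trig_velZ f d x : trig f -> dv 0 f d -> trig_vel (fun t => f t *: x) (d *: x).
Proof.
move=> tf fd; split=> y; under eq_fun => t do rewrite ipZl.
  by apply: trigM => //; exact: trig_cst.
rewrite ipZl; have := dvM fd (dv_cst 0 <<x, y>>).
by rewrite mulr0 add0r.
Qed.

Lemma trig_vel_adj g a (h h' : V -> V) : (forall x y, <<h x, y>> = <<x, h' y>>) ->
  trig_vel g a -> trig_vel (fun t => h (g t)) (h a).
Proof.
move=> hh [tg ga]; split=> y; under eq_fun => t do rewrite hh; first exact: tg.
by rewrite hh; exact: ga.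
Qed.

(** The velocities of curves with trigonometric polynomial entries. Unlike for
    [Lie], it is easy to see that they form a subspace. *)
Definition tangent (A : 'End(V)) : Prop := exists c : R -> 'End(V),
  [/\ c 0 = \1%VF, forall t, G (c t) & forall x, trig_vel (fun t => c t x) (A x)].

Lemma tangent_conj g A : G g -> tangent A -> tangent (conj_act g A).
Proof.
move=> Gg [c [c0 Gc cA]]; exists (fun t => conj_act g (c t)); split.
- apply/lfunP => x; rewrite c0 /conj_act !comp_lfunE !id_lfunE.
  exact: lker0_lfunVK (G_lker Gg) x.
- by move=> t; apply: (G_comp (G_comp Gg (Gc t)) (G_inv Gg)).
- move=> x; have [tg ga] := cA (g^-1%VF x); split=> y; under eq_fun => t do rewrite (conjEV dimV _ _ _ Gg).
    exact: tg.
  by rewrite (conjEV dimV _ _ _ Gg); exact: ga.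
Qed.

Lemma tangentZ c A : tangent A -> tangent (c *: A).
Proof.
move=> [k [k0 Gk kA]]; exists (fun t => k (c * t)); split=> [|t|x]; first by rewrite mulr0.
  exact: Gk.
have [tk dk] := kA x; split=> y; first exact: (trig_scale c (tk y)).
rewrite scale_lfunE ipZl; apply: (dv_comp_scale (f := fun t => <<k t x, y>>)).
rewrite mulr0; exact: dk.
Qed.

(** The velocity of the product of two curves through the identity is the sum of
    their velocities. *)
Lemma tangentD A B : tangent A -> tangent B -> tangent (A + B).
Proof.
move=> [c [c0 Gc cA]] [d [d0 Gd dB]]; exists (fun t => (c t \o d t)%VF); split=> [|t|x].
- by rewrite c0 d0 comp_lfun1l.
- exact: G_comp.
have E : forall y t, <<(c t \o d t)%VF x, y>> = \sum_i << d t x, e i>> * <<c t (e i), y>>.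
  move=> y t; rewrite comp_lfunE {1}(eP.2 (d t x)) linear_sum ip_suml.
  by apply: eq_bigr => i _; rewrite linearZ ipZl.
split=> y; under eq_fun => t do rewrite E.
  by apply: trig_sum => i; apply: trigM; [exact: (dB x).1 | exact: (cA (e i)).1].
rewrite add_lfunE ipDl.
have -> : <<A x, y>> + <<B x, y>> =
    \sum_i (<< d 0 x, e i>> * <<A (e i), y>> + <<B x, e i>> * <<c 0 (e i), y>>).
  rewrite c0 d0 big_split /=; congr (_ + _).
    rewrite {1}(eP.2 x) linear_sum ip_suml; apply: eq_bigr => i _.
    by rewrite linearZ ipZl id_lfunE.
  rewrite -[LHS](sum_ip_ip eP); by apply: eq_bigr => i _; rewrite id_lfunE.
by apply: dv_sum => i; apply: dvM; [exact: (dB x).2 | exact: (cA (e i)).2].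
Qed.

Lemma tangent_Lie A : tangent A -> Lie G A.
Proof.
move=> [c [c0 Gc cA]]; exists c; split=> // l u.
  have [tg _] := cA u; apply: trig_smooth.
  under eq_fun => t do rewrite (eP.2 (c t u)) linear_sum.
  apply: trig_sum => i; under eq_fun => t do rewrite linearZ /=.
  by apply: trigM; [exact: tg | exact: trig_cst].
apply: dv_derive1.
have -> : l (A u) = \sum_i (<<c 0 u, e i>> * 0 + <<A u, e i>> * l (e i)).
  rewrite {1}(eP.2 (A u)) linear_sum; apply: eq_bigr => i _.
  by rewrite linearZ /= mulr0 add0r.
under eq_fun => t do rewrite (eP.2 (c t u)) linear_sum.
apply: dv_sum => i; under eq_fun => t do rewrite linearZ /=.
by apply: dvM; [exact: (cA u).2 | exact: dv_cst].
Qed.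

Lemma Lie_vel A : Lie G A -> exists c : R -> 'End(V),
  [/\ c 0 = \1%VF, forall t, G (c t) & forall x, vel (fun t => c t x) (A x)].
Proof.
move=> [c [c0 Gc cs cA]]; exists c; split=> // x y.
have lin : scalar (fun z => <<z, y>> : R^o) by move=> k z z'; rewrite ipDl ipZl.
pose l : {scalar V} := HB.pack (fun z => <<z, y>> : R^o)
  (GRing.isLinear.Build R V R^o _ _ lin).
have := cA l x; rewrite derive1E => H; split; last exact: H.
exact: (cs l x 0%N 0).
Qed.

(** Turn w in the plane of w and -(u x w). This plane is orthogonal to u, v and u
    x v, so that (u, v, z) stays special, and the maps from the first frame to
    the frames of (u, v, z) form a curve in G. *)
Lemma tangent_circle u v w : special u v w ->
  exists2 A : 'End(V), tangent A & A w = - (u ** w).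
Proof.
move=> S; have [uu vv ww [uv uw vw uvw]] := S.
pose a := - (u ** w); pose z t := cos t *: w + sin t *: a.
have aw : <<a, w>> = 0 by rewrite ipNl (ip_crossr crossP) oppr0.
have ua : <<u, a>> = 0 by rewrite ipC ipNl (ip_crossl crossP) oppr0.
have va : <<v, a>> = 0 by rewrite ipC ipNl (triple_swap crossP) uvw !oppr0.
have aa : <<a, a>> = 1 by rewrite ipNl ipNr opprK (cross_norm crossP) uu ww uw; ring.
have uva : <<u ** v, a>> = 0 by rewrite ipNr (cross_norm crossP) uu uv vw; ring.
have Sz t : special u v (z t).
  split=> //; last by split; rewrite // ipDr !ipZr ?uw ?vw ?uvw ?ua ?va ?uva; ring.
  rewrite -[RHS](cos2Dsin2 t) !(ipDl, ipDr, ipZl, ipZr) (ipC _ w a) aw ww aa; ring.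
have zv : trig_vel z a.
  have -> : a = 0 *: w + 1 *: a by rewrite scale0r scale1r add0r.
  apply: trig_velD; apply: trig_velZ.
  - by have := trig_cos (1 : R); under eq_fun => t do rewrite mul1r.
  - by rewrite -[0 in X in dv _ _ X]oppr0 -[in X in dv _ _ X](@sin0 R); exact: is_derive_cos.
  - by have := trig_sin (1 : R); under eq_fun => t do rewrite mul1r.
  - by rewrite -(@cos0 R); exact: is_derive_sin.
have zc x : trig_vel (fun t => - (x ** z t)) (- (x ** a)).
  apply: (@trig_vel_adj _ _ (fun y => - (x ** y)) (fun y => x ** y)) => // y y'.
  by rewrite ipNl (triple_swap crossP) opprK ipC.
(* the velocities of the vectors of the frame of (u, v, z t) *)
pose D (i : 'I_7) : V := [:: 0; 0; 0; a; - (u ** a); - (v ** a); - (u ** v ** a)]`_i.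
have FD i : trig_vel (fun t => frame u v (z t) i) (D i).
  case: i => -[|[|[|[|[|[|[|//]]]]]]] lti; rewrite /special_frame /D /=;
    by [exact: trig_vel_cst | exact: zv | exact: zc].
have [fO fE] := frame_onbasis dimV crossP S.
exists (basis_map ip (frame u v w) D); last first.
  rewrite (_ : - (u ** w) = D (inord 3)); last by rewrite /D inordK.
  by rewrite -(basis_mapE D (inord 3) fO) /special_frame inordK.
exists (fun t => basis_map ip (frame u v w) (frame u v (z t))); split=> [|t|x].
- apply/lfunP => x; rewrite basis_map_ap id_lfunE.
  by rewrite {2}(fE x) /z cos0 sin0 scale1r scale0r addr0.
- exact: basis_map_G.
split=> y; under eq_fun => t do rewrite basis_map_ap ip_suml.
  apply: trig_sum => i; under eq_fun => t do rewrite ipZl.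
  by apply: trigZ; exact: (FD i).1.
rewrite basis_map_ap ip_suml; apply: dv_sum => i.
under eq_fun => t do rewrite ipZl.
have := dvM (dv_cst 0 <<x, frame u v w i>>) ((FD i).2 y).
by rewrite mul0r addr0 ipZl.
Qed.

Definition lieG : {vspace 'End(V)} := (linfun form_endo @: L214)%VS.

Lemma form_endo_conj g w : G g -> form_endo (form_act g w) = conj_act g (form_endo w).
Proof.
move=> Gg; apply/lfunP => x; apply: (@ip_nondeg _ _ ip) => y.
by rewrite (conjEV dimV _ _ _ Gg) !(form_endoE eP) /form_act pullback_vec.
Qed.

Lemma form_endo_inj w : form_endo w = 0 -> w = 0.
Proof.
move=> w0; have := skew_form_endo eP w; rewrite w0 linear0 => /esym/eqP.
by rewrite scaler_eq0 pnatr_eq0 => /eqP.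
Qed.

Lemma Lie_lieG A : Lie G A -> exists2 w, w \in L214 & A = form_endo w.
Proof. by case/Lie_vel => c [c0 Gc cA]; have [? ?] := vel_skew c0 Gc cA; exact: skew_L214. Qed.

(** The 2-forms of velocities are a nonzero invariant subspace of an irreducible
    representation. *)
Lemma L214_tangent w : w \in L214 -> tangent (form_endo w).
Proof.
have [W WP] : exists W : {vspace altform V 2}, forall w,
    w \in W <-> w \in L214 /\ tangent (form_endo w).
  apply: vspace_of_closed => [|a x y [xL tx] [yL ty]].
    split; first exact: mem0v.
    rewrite linear0 -(scale0r (0 : 'End(V))); apply: tangentZ.
    exists (fun=> \1%VF); split=> // [_|x]; first exact: G1.
    rewrite zero_lfunE; exact: trig_vel_cst.
  split; first by rewrite memvD ?memvZ.
  by rewrite linearP; apply: tangentD => //; exact: tangentZ.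
have [_ _ irr] := L214_irreducible dimV crossP eP.
have WL : (W <= L214)%VS by apply/subvP => x /(proj1 (WP x))[].
have Winv : invariant G (@form_act R V 2) W.
  move=> g x Gg /(proj1 (WP x))[xL tx]; apply/WP; split.
    exact: (L214_invariant dimV eP Gg xL).
  by rewrite form_endo_conj //; exact: tangent_conj.
have [W0|<-] := irr W WL Winv; last by move=> /(proj1 (WP w))[].
have [a [b [c S]]] := special_exists dimV ip cross.
have [A tA Ac] := tangent_circle S.
have [x xL Ax] := Lie_lieG (tangent_Lie tA).
have : x \in W by apply/WP; rewrite -Ax.
rewrite W0 memv0 => /eqP x0; exfalso; move: Ac; rewrite Ax x0 linear0 zero_lfunE.
have [aa _ cc [_ ac _ _]] := S.
move/(congr1 (fun z => <<z, a ** c>>)); rewrite ip0l ipNl (cross_norm crossP) aa cc ac.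
by move/eqP; rewrite mulr1 mulr0 subr0 eq_sym oppr_eq0 oner_eq0.
Qed.

Lemma lieG_Lie : [set` lieG]%classic = Lie G.
Proof.
apply/seteqP; split=> A /=.
  by case/memv_imgP => w wL ->; rewrite lfunE; apply/tangent_Lie/L214_tangent.
by case/Lie_lieG => w wL ->; rewrite -[form_endo w]lfunE memv_img.
Qed.

Lemma L214_rep : rep_iso G (@form_act R V 2) L214 (@conj_act R V) lieG.
Proof.
exists (linfun form_endo); split=> // [|g w Gg _].
  apply/eqP; rewrite -subv0; apply/subvP => w /memv_capP[_].
  by rewrite memv_ker lfunE => /eqP/form_endo_inj ->; rewrite mem0v.
by rewrite !lfunE; exact: form_endo_conj.
Qed.

End LieAlgebra.

(** * The standard calibration of seven-dimensional space *)

Section Phi0.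
Variable R : realType.
Local Notation R7 := 'rV[R]_7.

Lemma det2 (F : nat -> nat -> R) : \det (\matrix_(i < 2, j < 2) F i j) =
  F 0%N 0%N * F 1%N 1%N - F 0%N 1%N * F 1%N 0%N.
Proof.
rewrite (expand_det_row _ ord0) !big_ord_recl big_ord0 /cofactor !det_mx11 !mxE /=.
rewrite /bump /=; ring.
Qed.

Lemma det3 (F : nat -> nat -> R) : \det (\matrix_(i < 3, j < 3) F i j) =
  F 0%N 0%N * F 1%N 1%N * F 2%N 2%N - F 0%N 0%N * F 1%N 2%N * F 2%N 1%N
  - F 0%N 1%N * F 1%N 0%N * F 2%N 2%N + F 0%N 1%N * F 1%N 2%N * F 2%N 0%N
  + F 0%N 2%N * F 1%N 0%N * F 2%N 1%N - F 0%N 2%N * F 1%N 1%N * F 2%N 0%N.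
Proof.
rewrite (expand_det_row _ ord0) !big_ord_recl big_ord0 /cofactor !(expand_det_row _ ord0).
rewrite !big_ord_recl !big_ord0 /cofactor !det_mx11 !mxE /= /bump /=; ring.
Qed.

(** Antisymmetrizing the first two factors before the sum over all permutations
    doubles the determinant. *)
Lemma sum_perm3 (F : nat -> nat -> R) :
  2^-1 * (\sum_(s : 'S_3) (-1) ^+ s *
    ((F 0%N (s 0) * F 1%N (s 1) - F 0%N (s 1) * F 1%N (s 0)) * F 2%N (s 2))) =
  \det (\matrix_(i < 3, j < 3) F i j).
Proof.
transitivity (2^-1 * (\det (\matrix_(i < 3, j < 3) F i j) -
    \det (\matrix_(i < 3, j < 3) F (nth 0%N [:: 1; 0; 2]%N i) j))); last first.
  rewrite det3 (det3 (fun i j => F (nth 0%N [:: 1; 0; 2]%N i) j)) /=; by field.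
congr (_ * _); rewrite /determinant -sumrB; apply: eq_bigr => s _.
have sE (a b : 'I_3) : nat_of_ord a = b -> s a = s b by move=> /val_inj ->.
rewrite !big_ord_recl !big_ord0 !mxE /= /bump /= !mulr1.
rewrite (sE (lift ord0 ord0) 1) // (sE (lift ord0 (lift ord0 ord0)) 2) //.
rewrite (sE ord0 0) //.
move: (nat_of_ord (s 0)) (nat_of_ord (s 1)) (nat_of_ord (s 2)) ((-1) ^+ s : R) => x y z t; ring.
Qed.

Lemma dx3E i j k (v : seq R7) : dx3 R i j k (vec v) =
  \det (\matrix_(p < 3, q < 3) v`_q 0 (inord (nth 0%N [:: i; j; k] p).-1)).
Proof.
pose c p q : R := v`_q 0 (inord (nth 0%N [:: i; j; k] p).-1).
have w2 (f : 'I_2 -> nat) : wedge (dx R i) (dx R j) (fun m => v`_(f m)) =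
    c 0%N (f (inord 0)) * c 1%N (f (inord 1)) - c 0%N (f (inord 1)) * c 1%N (f (inord 0)) :> R.
  have := det2 (fun p q => c p (f (inord q))) => <-.
  rewrite -[LHS]/(wedge_fun _ _ _) /wedge_fun -[(_ * _)%N]/1%N invr1 mul1r.
  apply: eq_bigr => s _; rewrite !big_ord_recl big_ord0 mulr1 !mxE !inord_val.
  have sE (a b : 'I_2) : nat_of_ord a = b -> f (s a) = f (s b) by move=> /val_inj ->.
  congr (_ * (_ * _)); rewrite /c /=; first by rewrite (sE _ ord0).
  by rewrite (sE _ (lift ord0 ord0)).
rewrite -[RHS](sum_perm3 c) -[LHS]/(wedge_fun _ _ _) /wedge_fun; congr (_^-1 * _).
apply: eq_bigr => s _.
have sE (a b : 'I_3) : nat_of_ord a = b -> nat_of_ord (s a) = s b by move=> /val_inj ->.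
congr (_ * (_ * _)).
  rewrite [LHS](w2 (fun m => s (lshift 1 m))).
  by rewrite (sE (lshift 1 (inord 0 : 'I_2)) 0) ?(sE (lshift 1 (inord 1 : 'I_2)) 1) //= inordK.
by rewrite -[LHS]/(c 2%N (s (rshift 2 0))) (sE (rshift 2 (0 : 'I_1)) 2).
Qed.

(** The determinant of three coordinates of three standard basis vectors; as in
    [dx], coordinates are counted from 1. *)
Definition dxZ i j k (s : seq nat) : Z :=
  let F p q := deltaZ (nth 0%N s q) (nth 0%N [:: i; j; k] p).-1 in
  (F 0%N 0%N * F 1%N 1%N * F 2%N 2%N - F 0%N 0%N * F 1%N 2%N * F 2%N 1%N
  - F 0%N 1%N * F 1%N 0%N * F 2%N 2%N + F 0%N 1%N * F 1%N 2%N * F 2%N 0%N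
  + F 0%N 2%N * F 1%N 0%N * F 2%N 1%N - F 0%N 2%N * F 1%N 1%N * F 2%N 0%N)%BZ.

Definition phi0Z s : Z :=
  (dxZ 1 2 3 s - dxZ 1 4 5 s - dxZ 1 6 7 s - dxZ 2 4 6 s + dxZ 2 5 7 s
  - dxZ 3 4 7 s - dxZ 3 5 6 s)%BZ.

(** The standard form has the structure constants of a special frame. *)
Lemma check_phi0 : all_idx 3 0 (fun s => Z.eqb (phi0Z s) (structZ3 s)).
Proof. by vm_compute. Qed.

Definition stdb (m : nat) : R7 := delta_mx 0 (inord m).

Lemma dx3_std i j k s : all (gtn 7) s -> size s = 3%N -> all (gtn 8) [:: i; j; k] ->
  dx3 R i j k (vec (map stdb s)) = zr R (dxZ i j k s).
Proof.
move=> s7 s3 i7; rewrite dx3E (det3 (fun p q => (map stdb s)`_q 0 (inord (nth 0%N [:: i; j; k] p).-1))).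
have E p q : (p < 3)%N -> (q < 3)%N -> (map stdb s)`_q 0 (inord (nth 0%N [:: i; j; k] p).-1) =
    zr R (deltaZ (nth 0%N s q) (nth 0%N [:: i; j; k] p).-1).
  move=> p3 q3; rewrite (nth_map 0%N) ?s3 // /stdb mxE eqxx /deltaZ -val_eqE /=.
  rewrite !inordK //; first by rewrite eq_sym; case: (_ == _).
    by apply: (allP s7); rewrite mem_nth ?s3.
  have := allP i7 _ (mem_nth 0%N (p3 : p < size [:: i; j; k])%N).
  by case: (nth _ _ _).
by rewrite !E // /dxZ !(zrD, zrB, zrM).
Qed.

Lemma phi0_std s : all (gtn 7) s -> size s = 3%N ->
  phi0 R (vec (map stdb s)) = zr R (phi0Z s).
Proof.
by move=> s7 s3; rewrite /phi0 !(altformB, altformD) !dx3_std // /phi0Z !(zrD, zrB).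
Qed.
End Phi0.

Lemma pullback_cancel (R : realType) (V W : vectType R) (g : 'Hom(V, W)) (h : 'Hom(W, V))
  k (b : altform W k) : cancel h g -> pullback h (pullback g b) = b.
Proof.
by move=> hK; apply: altform_inj => v; congr (altfun b); apply/funext => i; exact: hK.
Qed.

(** * Comparison with the standard group *)

Section Transport.
Variables (R : realType) (V W : vectType R).
Variables (th : 'Hom(V, W)) (th' : 'Hom(W, V)).
Hypotheses (thK : cancel th th') (thK' : cancel th' th).
Variables (a : altform V 3) (b : altform W 3).
Hypothesis ab : pullback th b = a.

(** Conjugate the curves. *)
Lemma Lie_transport A : Lie (Ggroup a) A -> Lie (Ggroup b) (th \o A \o th')%VF.
Proof.
move=> [c [c0 Gc cs cA]]; exists (fun t => (th \o c t \o th')%VF); split.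
- by apply/lfunP => x; rewrite c0 !comp_lfunE !id_lfunE thK'.
- move=> t; have [c_inj ca] := Gc t; split.
    move/eqP/lker0P: c_inj => c_inj; apply/eqP/lker0P => x y.
    rewrite !comp_lfunE => /(can_inj thK)/c_inj; exact: (can_inj thK').
  have b_a : b = pullback th' a.
    by rewrite -ab pullback_cancel.
  rewrite [RHS]b_a -ca -ab; apply: altform_inj => v /=.
  by congr altfun; apply/funext => i; rewrite !comp_lfunE.
- move=> l u; under eq_fun => t do rewrite !comp_lfunE.
  exact: (cs (l \o th)).
- move=> l u; under eq_fun => t do rewrite !comp_lfunE.
  by rewrite !comp_lfunE; exact: (cA (l \o th)).
Qed.

End Transport.

Section G2.
Variables (R : realType) (V : vectType R) (dimV : \dim {:V} = 7%N).
Variables (ip : {dot V for idfun}) (cross : {bilinear V -> V -> V}).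
Hypothesis crossP : cross_product ip cross.
Local Notation "<< u , v >>" := (ip u v) (at level 0, u, v at level 99).
Local Notation R7 := 'rV[R]_7.

(** Coordinates in a special frame, whose signs are chosen to match the standard
    form. *)
Lemma coordinates : exists (th : 'Hom(V, R7)) (th' : 'Hom(R7, V)),
  [/\ cancel th th', cancel th' th & pullback th (phi0 R) = assoc_form crossP].
Proof.
have [u [v [w S]]] := special_exists dimV ip cross.
have fP := frame_onbasis dimV crossP S.
have f_phi := frame_phi crossP S.
move: (special_frame cross u v w) fP f_phi => f fP f_phi.
have lin : linear (fun x => \row_i <<x, f i>> : R7).
  by move=> c x y; apply/rowP => i; rewrite !mxE ipDl ipZl.
have lin' : linear (fun r : R7 => \sum_i r 0 i *: f i).
  move=> c x y; rewrite scaler_sumr -big_split; apply: eq_bigr => i _.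
  by rewrite !mxE scalerDl scalerA.
pose t : {linear V -> R7} := HB.pack (fun x => \row_i <<x, f i>> : R7)
  (GRing.isLinear.Build R V R7 _ _ lin).
pose t' : {linear R7 -> V} := HB.pack (fun r : R7 => \sum_i r 0 i *: f i)
  (GRing.isLinear.Build R R7 V _ _ lin').
have tE x : linfun t x = \row_i <<x, f i>> by rewrite lfunE.
have tE' r : linfun t' r = \sum_i r 0 i *: f i by rewrite lfunE.
exists (linfun t), (linfun t'); split.
- move=> x; rewrite tE' tE [RHS]fP.2; apply: eq_bigr => i _; by rewrite mxE.
- move=> r; rewrite tE tE'; apply/rowP => i; rewrite mxE ip_suml (bigD1 i) //= big1 => [|j ji].
    by rewrite ipZl fP.1 eqxx mulr1 addr0.
  by rewrite ipZl fP.1 (negPf ji) mulr0.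
apply: (eq_on_sorted fP) => s ss.
have s7 := val_tuple_lt s.
have s3 : size (map val s) = 3%N by rewrite size_map size_tuple.
rewrite pullback_vec map_tuple_fn (fn_phi crossP f_phi s3 s7).
have E : map (linfun t) (map (fun m => f (inord m)) (map val s)) = map (stdb R) (map val s).
  rewrite -!map_comp; apply: eq_map => m /=; rewrite tE; apply/rowP => i.
  by rewrite !mxE fP.1 eqxx eq_sym.
rewrite [LHS](congr1 (fun z => phi0 R (vec z)) E) phi0_std //; congr zr; apply/Z.eqb_eq.
exact: (all_idxP check_phi0 s3 ss s7).
Qed.

Lemma g2_exists (lieG : {vspace 'End(V)}) :
  [set` lieG]%classic = Lie (Ggroup (assoc_form crossP)) ->
  exists2 g2 : {vspace 'End(R7)}, [set` g2]%classic = Lie (Ggroup (phi0 R)) & lie_iso lieG g2.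
Proof.
move=> lieGE; have [th [th' [thK thK' th_phi]]] := coordinates.
have th_phi' : pullback th' (assoc_form crossP) = phi0 R.
  by rewrite -th_phi pullback_cancel.
have lin : linear (fun A : 'End(V) => th \o A \o th')%VF.
  by move=> c A B; apply/lfunP => x; rewrite !(comp_lfunE, add_lfunE, scale_lfunE) linearD linearZ.
pose F : {linear 'End(V) -> 'End(R7)} := HB.pack (fun A : 'End(V) => th \o A \o th')%VF
  (GRing.isLinear.Build R 'End(V) 'End(R7) _ _ lin).
have FE A : linfun F A = (th \o A \o th')%VF by rewrite lfunE.
have lieGP A : A \in lieG <-> Lie (Ggroup (assoc_form crossP)) A by rewrite -lieGE.
exists (linfun F @: lieG)%VS.
  apply/seteqP; split=> B /=.
    by case/memv_imgP => A /lieGP AL ->; rewrite FE; exact: (Lie_transport thK thK' th_phi).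
  move=> BL; have AL := Lie_transport thK' thK th_phi' BL.
  apply/memv_imgP; exists (th' \o B \o th)%VF; first exact/lieGP.
  by rewrite FE; apply/lfunP => x; rewrite !comp_lfunE !thK'.
exists (linfun F); split=> // [|A B _ _].
  apply/eqP; rewrite -subv0; apply/subvP => A /memv_capP[_].
  rewrite memv_ker FE => /eqP/lfunP A0; rewrite memv0; apply/eqP/lfunP => x.
  by apply: (can_inj thK); have := A0 (th x); rewrite !comp_lfunE thK !zero_lfunE linear0.
by rewrite !FE /lie_bracket; apply/lfunP => x;
  rewrite !(comp_lfunE, add_lfunE, opp_lfunE) linearB /= !thK.
Qed.

End G2.

(** * Eigenspaces and projections on 2-forms *)

Section Projections.
Variables (R : realType) (V : vectType R) (dimV : \dim {:V} = 7%N).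
Variables (ip : {dot V for idfun}) (cross : {bilinear V -> V -> V}).
Hypothesis crossP : cross_product ip cross.
Local Notation phi := (assoc_form crossP).
Local Notation vol := (assoc_vol ip phi).
Local Notation star5 := (@hodge R V ip 5 2 vol).
Variables (e : 'I_7 -> V) (eP : onbasis ip e).
Local Notation svec := (svec cross e).
Local Notation L27 := (L27 crossP).
Local Notation L214 := (L214 cross e).

Lemma L27_orth_L214 : {in L27 & L214, forall a b, ipform ip a b = 0}.
Proof.
move=> a b /(proj1 (L27P crossP a))[u ->] /(proj1 (L214P cross e b)) b0.
by rewrite (ipform_into_phi crossP eP) b0 ip0r.
Qed.

Lemma L27_eigen w : w \in L27 <-> star5 (wedge phi w) = 2 *: w.
Proof.
rewrite (star5_phi dimV crossP eP); split.
  case/(proj1 (L27P crossP w)) => u ->; rewrite (svec_into crossP eP) linearZ /=.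
  by rewrite -{2}[into phi u]scale1r -scalerBl; congr (_ *: _); ring.
move/eqP; rewrite subr_eq -{3}[w]scale1r -scalerDl => /eqP E.
apply: (proj2 (L27P crossP w)); exists (3^-1 *: svec w).
rewrite linearZ /= E scalerA -[LHS]scale1r; congr (_ *: _); by field.
Qed.

Lemma L214_eigen w : w \in L214 <-> star5 (wedge phi w) = - w.
Proof.
rewrite (star5_phi dimV crossP eP); split.
  by move/(proj1 (L214P cross e w)) ->; rewrite linear0 add0r.
move/eqP; rewrite -subr_eq0 opprK subrK => /eqP E; apply/L214P.
have /eqP/lker0P inj := into_phi_inj crossP eP.
by apply: inj; rewrite !lfunE /= E linear0.
Qed.

Lemma into_third w : 3^-1 *: into phi (svec w) = into phi (3^-1 *: svec w).
Proof. by rewrite [RHS]linearZ. Qed.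

(** From s(i(u) phi) = 3 u: subtracting a third of i(s(w)) phi removes the vector
    of w. *)
Lemma svec_sub_proj w : svec (w - 3^-1 *: into phi (svec w)) = 0.
Proof.
by rewrite into_third linearB /= (svec_into crossP eP) scalerA mulfV ?pnatr_eq0 //
  scale1r subrr.
Qed.

Lemma proj_L27 : is_orth_proj (@ipform R V ip 2) L27 (fun w => 3^-1 *: into phi (svec w)).
Proof.
move=> w; split.
  by apply: (proj2 (L27P crossP _)); exists (3^-1 *: svec w); exact: into_third.
by move=> y yL; rewrite ipformC L27_orth_L214 //; apply/L214P; exact: svec_sub_proj.
Qed.

Lemma proj_L214 : is_orth_proj (@ipform R V ip 2) L214
  (fun w => w - 3^-1 *: into phi (svec w)).
Proof.
move=> w; split; first by apply/L214P; exact: svec_sub_proj.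
move=> y yL; rewrite subKr L27_orth_L214 //.
by apply: (proj2 (L27P crossP _)); exists (3^-1 *: svec w); exact: into_third.
Qed.

End Projections.

Local Open Scope classical_set_scope.

Theorem theorem8p5 (R : realType) (V : vectType R) (dimV : \dim {:V} = 7%N)
    (ip : {dot V for idfun}) (cross : {bilinear V -> V -> V})
    (crossP : cross_product ip cross) :
  let phi : altform V 3 := assoc_form crossP in
  let vol : altform V 7 := assoc_vol ip phi in
  let star3 : altform V 3 -> altform V 4 := @hodge R V ip 3 4 vol in
  let star5 : altform V 5 -> altform V 2 := @hodge R V ip 5 2 vol in
  let star6 : altform V 6 -> altform V 1 := @hodge R V ip 6 1 vol in
  let psi : altform V 4 := star3 phi in
  let G : set 'End(V) := Ggroup phi in
  exists (L27 L214 : {vspace altform V 2})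
         (L31 L37 L327 : {vspace altform V 3})
         (lieG S0 : {vspace 'End(V)}) (g2 : {vspace 'End('rV[R]_7)}),
  (* the spaces *)
  [/\ [set` L27] = range (fun u => interior_prod u phi),
      [set` L27] = [set w | star5 (wedge phi w) = 2 *: w],
      [set` L214] = [set w | wedge psi w = 0] &
      [set` L214] = [set w | star5 (wedge phi w) = - w]] /\
  [/\ L31 = <[phi]>%VS,
      [set` L37] = range (fun u => interior_prod u psi) &
      [set` L327] = [set w | wedge phi w = 0 /\ wedge psi w = 0]] /\
  [/\ [set` lieG] = Lie G,
      [set` g2] = Lie (Ggroup (phi0 R)) &
      [set` S0] = [set A | symmetric_endo ip A /\ lftrace A = 0]] /\
  (* dimensions *)
  [/\ \dim L27 = 7%N, \dim L214 = 14%N &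
      [/\ \dim L31 = 1%N, \dim L37 = 7%N & \dim L327 = 27%N]] /\
  (* orthogonal splittings *)
  [/\ (L27 + L214 = {:altform V 2})%VS, directv (L27 + L214) &
      {in L27 & L214, forall a b, ipform ip a b = 0}] /\
  [/\ (L31 + L37 + L327 = {:altform V 3})%VS, directv (L31 + L37 + L327),
      {in L31 & L37, forall a b, ipform ip a b = 0},
      {in L31 & L327, forall a b, ipform ip a b = 0} &
      {in L37 & L327, forall a b, ipform ip a b = 0}] /\
  (* irreducibility *)
  [/\ irreducible G (@form_act R V 2) L27,
      irreducible G (@form_act R V 2) L214,
      irreducible G (@form_act R V 3) L31,
      irreducible G (@form_act R V 3) L37 &
      irreducible G (@form_act R V 3) L327] /\
  (* isomorphisms *)
  [/\ rep_iso G (@form_act R V 2) L27 (@std_act R V) {:V},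
      rep_iso G (@form_act R V 3) L37 (@std_act R V) {:V},
      rep_iso G (@form_act R V 2) L214 (@conj_act R V) lieG,
      lie_iso lieG g2 &
      rep_iso G (@form_act R V 3) L327 (@conj_act R V) S0] /\
  (* projections *)
  [/\ is_orth_proj (@ipform R V ip 2) L27
        (fun w => 3^-1 *: w + 3^-1 *: star5 (wedge phi w)),
      is_orth_proj (@ipform R V ip 2) L27
        (fun w => 3^-1 *: star5 (wedge psi (star6 (wedge psi w)))),
      is_orth_proj (@ipform R V ip 2) L214
        (fun w => (2 / 3) *: w - 3^-1 *: star5 (wedge phi w)) &
      is_orth_proj (@ipform R V ip 2) L214
        (fun w => w - 3^-1 *: star5 (wedge psi (star6 (wedge psi w))))].
Proof.
move=> phi vol star3 star5 star6 psi G.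
have [a [b [c S]]] := special_exists dimV ip cross.
have eP := frame_onbasis dimV crossP S.
set e := special_frame cross a b c in eP.
have psiE : psi = psi_form crossP := star_phi dimV crossP.
have lieE := lieG_Lie dimV crossP eP.
have [g2 g2E g2_iso] := g2_exists dimV lieE.
have s5 w : star5 (wedge phi w) = into phi (svec cross e w) - w := star5_phi dimV crossP eP w.
have s56 w : star5 (wedge psi (star6 (wedge psi w))) = into phi (svec cross e w).
  by rewrite psiE; exact: star5_psi_star6_psi.
exists (L27 crossP), (L214 cross e), (L31 crossP), (L37 crossP), (L327 crossP).
exists (lieG cross e), (S0 ip), g2.
split.
  split; apply/predeqP => w.
  - by rewrite [_ w](propext (L27P crossP w)); split=> [[u ->]|[u _ <-]]; exists u.
  - exact: (L27_eigen dimV crossP eP w).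
  - by rewrite psiE; exact: (L214_wedge dimV crossP eP w).
  - exact: (L214_eigen dimV crossP eP w).
split.
  split=> //; apply/predeqP => w; rewrite psiE; last exact: (L327_wedge dimV crossP eP w).
  by rewrite [_ w](propext (L37P crossP w)); split=> [[u ->]|[u _ <-]]; exists u.
split; first by split=> //; apply/predeqP => A; exact: S0P.
split.
  have [_ _ d327 _] := three_forms dimV crossP eP.
  split; last split; first exact: (dim_L27 dimV crossP eP).
  - exact: (dim_L214 dimV crossP eP).
  - exact: (dim_L31 crossP eP).
  - exact: (dim_L37 dimV crossP eP).
  - exact: d327.
split.
  split; first exact: (L27_add_L214 crossP eP); last exact: (L27_orth_L214 eP).
  by apply/directv_addP; exact: (L27_cap_L214 crossP eP).
have [sum3 dir3] := three_forms_sum dimV crossP eP.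
split.
  split=> //; [exact: (L31_orth_L37 eP) | exact: (L327_orth31 dimV eP) | exact: (L327_orth37 dimV eP)].
have [irr7 iso7] := L27_rep dimV crossP eP.
have [irr37 iso37] := L37_rep dimV crossP eP.
have [irr327 iso327] := L327_rep dimV crossP eP.
split.
  split=> //; [exact: (L214_irreducible dimV crossP eP) | exact: (L31_irreducible crossP eP)].
split; first by split=> //; exact: (L214_rep dimV crossP eP).
have eq_proj (U : {vspace altform V 2}) p q : p =1 q ->
    is_orth_proj (@ipform R V ip 2) U q -> is_orth_proj (@ipform R V ip 2) U p.
  by move=> pq qP w; rewrite pq; exact: qP.
split.
- apply: (eq_proj _ _ _ _ (proj_L27 crossP eP)) => w.
  by rewrite s5 scalerBr addrC subrK.
- by apply: (eq_proj _ _ _ _ (proj_L27 crossP eP)) => w; rewrite s56.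
- apply: (eq_proj _ _ _ _ (proj_L214 crossP eP)) => w.
  rewrite s5 scalerBr opprB addrA -scalerDl (_ : 2 / 3 + 3^-1 = 1 :> R); last by field.
  by rewrite scale1r.
- by apply: (eq_proj _ _ _ _ (proj_L214 crossP eP)) => w; rewrite s56.
Qed.
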